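(* For $t\in(0,\infty)$, let $S_t=\{(z,w)\in\mathbb{C}^2: w=p_t(z,\overline{z})\}$, where $p_t(z,\overline{z})=z^2\overline{z}+tz\overline{z}^2+\frac{t^2}{3}\overline{z}^3$. Then: (i) For $t\in(0,1)$, $S_t$ is not locally polynomially convex at the origin. (ii) If $t\in(0,\sqrt{3}/2)$, then for every $\delta>0$ the polynomially convex hull of $S_t\cap\overline{B(0;\delta)}$ contains a nonempty open ball centred at the origin. (iii) If $t\in[\sqrt{3}/2,1)$, then for every $\delta>0$ the polynomially convex hull of $S_t\cap\overline{B(0;\delta)}$ contains a one-parameter family of analytic discs with boundary in $S_t$ passing through the origin.
   Context: For a compact set $K\subset\mathbb{C}^n$, the polynomially convex hull is $\widehat{K}=\{z\in\mathbb{C}^n: |p(z)|\le\sup_K|p| \text{ for all } p\in\mathbb{C}[z_1,\dots,z_n]\}$; $K$ is polynomially convex if $\widehat{K}=K$. A closed set $E\subset\mathbb{C}^n$ is locally polynomially convex at $p\in E$ if $E\cap\overline{B(p;r)}$ is polynomially convex for some $r>0$, where $B(p;r)$ is the open ball in $\mathbb{C}^n$ with centre $p$ and radius $r$. An analytic disc with boundary in a set $E\subset\mathbb{C}^2$ is (the image of) a continuous map $\varphi:\overline{\mathbb{D}}\to\mathbb{C}^2$ that is holomorphic on the open unit disc $\mathbb{D}$ and satisfies $\varphi(\partial\mathbb{D})\subset E$. *)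

(* Defs.v *)
From HB Require Import structures.
From mathcomp Require Import all_boot all_order all_algebra.
From mathcomp Require Import all_classical all_reals all_analysis.
From mathcomp Require Import complex.
From mathcomp Require mpoly.

Set Implicit Arguments.
Unset Strict Implicit.
Unset Printing Implicit Defensive.

Import Order.TTheory GRing.Theory Num.Theory.
Import numFieldNormedType.Exports.

Local Open Scope classical_set_scope.
Local Open Scope complex_scope.
Local Open Scope ring_scope.

(* The topology of R[i] given by its modulus, and its normed module structure
   over itself: the library only attaches these to abstract number fields. *)
#[export, non_forgetful_inheritance]
HB.instance Definition _ (R : rcfType) := NormedModule.copy R[i] R[i]^o.

(* C^n is 'rV[R[i]]_n; its library topology is the usual one, but its library
   norm is the sup norm (with values in R[i]), so the Euclidean norm is defined
   here. The real-valued modulus of a complex number is normc. *)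
Definition enorm (R : realType) (n : nat) (z : 'rV[R[i]]_n) : R :=
  Num.sqrt (\sum_(i < n) ComplexField.Normc.normc (z 0 i) ^+ 2).

Definition eball (R : realType) (n : nat) (p : 'rV[R[i]]_n) (r : R) :
  set 'rV[R[i]]_n := [set z : 'rV[R[i]]_n | enorm (z - p) < r].

Definition closed_eball (R : realType) (n : nat) (p : 'rV[R[i]]_n) (r : R) :
  set 'rV[R[i]]_n := [set z : 'rV[R[i]]_n | enorm (z - p) <= r].

Definition peval (R : realType) (n : nat) (p : mpoly.mpoly n R[i])
  (z : 'rV[R[i]]_n) : R[i] := mpoly.meval (fun i => z 0 i) p.

(* For K compact only: sup is real-valued, with value 0 on the empty set and on
   sets unbounded above. *)
Definition poly_hull (R : realType) (n : nat) (K : set 'rV[R[i]]_n) :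
  set 'rV[R[i]]_n :=
  [set z : 'rV[R[i]]_n | forall p : mpoly.mpoly n R[i],
     ComplexField.Normc.normc (peval p z) <=
       sup [set ComplexField.Normc.normc (peval p x) | x in K]].

Definition polynomially_convex (R : realType) (n : nat)
  (K : set 'rV[R[i]]_n) : Prop := poly_hull K = K.

Definition locally_polynomially_convex (R : realType) (n : nat)
  (E : set 'rV[R[i]]_n) (p : 'rV[R[i]]_n) : Prop :=
  exists2 r : R, 0 < r & polynomially_convex (E `&` closed_eball p r).

Definition open_disc (R : realType) : set R[i] := [set x | `|x| < 1].

Definition closed_disc (R : realType) : set R[i] := [set x | `|x| <= 1].

Definition unit_circle (R : realType) : set R[i] := [set x | `|x| = 1].

(* derivable over the scalar field R[i] is complex differentiability. *)
Definition analytic_disc (R : realType) (E : set 'rV[R[i]]_2)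
  (phi : R[i] -> 'rV[R[i]]_2) : Prop :=
  [/\ {within @closed_disc R, continuous phi},
      forall x, @open_disc R x -> derivable phi x 1
    & phi @` @unit_circle R `<=` E].

(* The discs are nonconstant, depend continuously on the parameter s in ]0, 1[
   (jointly with the disc variable) and are pairwise distinct as subsets of
   C^2. *)
Definition disc_family (R : realType) (E : set 'rV[R[i]]_2)
  (Phi : R -> R[i] -> 'rV[R[i]]_2) : Prop :=
  [/\ {within `]0, 1[ `*` @closed_disc R,
         continuous (fun u : R * R[i] => Phi u.1 u.2)},
      forall s, 0 < s < 1 -> analytic_disc E (Phi s),
      forall s, 0 < s < 1 ->
        exists x y, [/\ closed_disc x, closed_disc y & Phi s x != Phi s y]
    & forall s s', 0 < s < 1 -> 0 < s' < 1 ->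
        Phi s @` @closed_disc R = Phi s' @` @closed_disc R -> s = s'].

Definition p_ (R : realType) (t : R) (z zbar : R[i]) : R[i] :=
  z ^+ 2 * zbar + t%:C * z * zbar ^+ 2 + (t ^+ 2 / 3%:R)%:C * zbar ^+ 3.

Definition S_ (R : realType) (t : R) : set 'rV[R[i]]_2 :=
  [set x : 'rV[R[i]]_2 | x 0 1 = p_ t (x 0 0) (x 0 0)^*].

(* Main.v *)
Require Import Defs.
From HB Require Import structures.
From mathcomp Require Import all_boot all_order all_algebra.
From mathcomp Require Import all_classical all_reals all_analysis.
From mathcomp Require Import all_solvable all_field complex.
From mathcomp Require mpoly.
From mathcomp Require Import ring lra zify.

Set Implicit Arguments.
Unset Strict Implicit.
Unset Printing Implicit Defensive.

Import Order.TTheory GRing.Theory Num.Theory.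
Import numFieldNormedType.Exports.

Local Open Scope classical_set_scope.
Local Open Scope complex_scope.
Local Open Scope ring_scope.

(* With [W = 3 t w + z^3] the surface is [W = (z + t z^* )^3]. So a disc with boundary in [S_ t]
   is a pair [(z, W)] of functions continuous on the closed disc, holomorphic inside, with
   [W = (z + t z^* )^3] on the circle; by the maximum principle it lies in the hull of its
   boundary, and the dilations [(z, W) -> (l z, l^3 W)], [l] real, preserve [S_ t].

   For [t < sqrt 3 / 2] consider the Hankel matrix of the symbol
   [((1 - r x) / (1 - r / x))^(1/3)]. Its entries are positive and, tested on the coefficients of
   [(1 - x)^(-1/2)], its quadratic form exceeds [t] for [r] close to 1. For the least [r] at which
   the form reaches [t], a maximizer [g] is a positive eigenvector for the eigenvalue [t]. By
   Wiener-Hopf factorization this gives [Y] with [(x Y(x) - t Y(1/x))^3 = x^2 (x - r) g(x)^3] on the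
   circle. Putting [x = (P N)^3], [z = i P N (P + N) Y(x)], [W = - i (P + N)^3 (x - r) g(x)^3] maps
   the torus to [S_ t], hence the bidisc to the hull. This map depends only on [P + N] and [P N],
   and it covers a set [|z|^3 <= k |W|] near 0; the discs [z = const] fill the rest of a ball.

   For [t >= sqrt 3 / 2] take [z = i F(x)], [W = i k^3 x G(x)^3], where [F - t F^*] should equal
   [k (-x)^(1/3) G] on the circle. [F] and [G] are solutions, holomorphic at 0 up to the factor
   [x^(1/3)] for [G], of one Fuchsian system with a parameter [e]. On the circle the real and
   imaginary parts of both sides satisfy the same real system, so by an energy argument they agree
   as soon as they agree at [x = -1]. That is one condition on [e], solved by the intermediate
   value theorem. Finally [F] and [G] vanish at 1, so these discs pass through the origin.

   In both cases the hull of a small piece of [S_ t] contains points outside [S_ t]. *)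

(** * Polynomial hulls and discs *)

(** At [r = 1] the Hankel entries are [sin (pi/3) / (pi (j + 2/3))], a multiple of a generalized
    Hilbert matrix, whose norm is [pi]: hence the threshold [sin (pi/3) = sqrt 3 / 2]. Compactness
    fails there. For [r < 1] the entries decay geometrically, a maximizer exists, and lowering [r]
    tunes the maximum of the form to [t]. The estimates need no value of [pi]: the same quantity
    [m po(1/2)_m^2], close to [1/pi], bounds the form of the test vector from below and its norm
    from above, and cancels. In the other case the exponents at 0 are the roots of
    [c (c - 1/3) = 0]; the second root supplies the cube root in the boundary relation. The
    solutions tend to 0 at 1, but slowly, so absolute convergence on the circle has to be extracted
    from the recursion by a Lyapunov function. The values at -1 are alternating sums; the variable
    [x / (x - 1)] turns them into series of positive terms at 1/2, which crude estimates can
    compare. *)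

Section ComplexModulus.
Variable R : realType.
Implicit Types (x y : R[i]) (a : R).

Definition nc x : R := ComplexField.Normc.normc x.

Lemma ncE x : nc x = Num.sqrt (complex.Re x ^+ 2 + complex.Im x ^+ 2).
Proof. by case: x. Qed.

Lemma norm_nc x : `|x| = (nc x)%:C.
Proof. by rewrite normc_def ncE. Qed.

Lemma nc_ge0 x : 0 <= nc x.
Proof. by rewrite ncE sqrtr_ge0. Qed.

Lemma nc0 : nc 0 = 0. Proof. exact: ComplexField.Normc.normc0. Qed.
Lemma nc1 : nc 1 = 1. Proof. exact: ComplexField.Normc.normc1. Qed.
Lemma ncM x y : nc (x * y) = nc x * nc y.
Proof. exact: ComplexField.Normc.normcM. Qed.
Lemma ncV x : nc x^-1 = (nc x)^-1.
Proof. exact: ComplexField.Normc.normcV. Qed.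
Lemma ncD x y : nc (x + y) <= nc x + nc y. Proof. exact: le_normcD. Qed.
Lemma ncN x : nc (- x) = nc x. Proof. exact: normcN. Qed.
Lemma ncB x y : nc (x - y) <= nc x + nc y.
Proof. by rewrite -(ncN y) ncD. Qed.
Lemma ncBC x y : nc (x - y) = nc (y - x).
Proof. by rewrite -ncN opprB. Qed.
Lemma ncX x n : nc (x ^+ n) = nc x ^+ n.
Proof. by elim: n => [|n IH]; rewrite ?expr0 ?nc1 // !exprS ncM IH. Qed.
Lemma ncR a : nc a%:C = `|a|.
Proof. by rewrite ncE /= expr0n addr0 sqrtr_sqr. Qed.
Lemma nc_i : nc 'i = 1.
Proof. by rewrite ncE /= expr0n expr1n add0r sqrtr1. Qed.
Lemma nc_conj x : nc x^* = nc x.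
Proof. by case: x => a b; rewrite !ncE /= sqrrN. Qed.
Lemma conjR a : (a%:C)^* = a%:C :> R[i]. Proof. exact: conjc_real. Qed.
Lemma realCM a b : (a * b)%:C = a%:C * b%:C :> R[i]. Proof. exact: rmorphM. Qed.
Lemma nc_eq0 x : (nc x == 0) = (x == 0).
Proof.
apply/eqP/eqP => [|->]; last exact: nc0.
exact: ComplexField.Normc.eq0_normc.
Qed.
Lemma nc_gt0 x : (0 < nc x) = (x != 0).
Proof. by rewrite lt0r nc_eq0 nc_ge0 andbT. Qed.
Lemma nc_sum (I : Type) (r : seq I) (P : pred I) (F : I -> R[i]) :
  nc (\sum_(i <- r | P i) F i) <= \sum_(i <- r | P i) nc (F i).
Proof.
elim/big_rec2: _ => [|i u v _ h]; first by rewrite nc0.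
by apply: (le_trans (ncD _ _)); rewrite lerD2l.
Qed.
Lemma nc_prod (I : Type) (r : seq I) (P : pred I) (F : I -> R[i]) :
  nc (\prod_(i <- r | P i) F i) = \prod_(i <- r | P i) nc (F i).
Proof. by elim/big_rec2: _ => [|i u v _ <-]; rewrite ?nc1 ?ncM. Qed.
Lemma nc_Re x : `|complex.Re x| <= nc x.
Proof. by rewrite ncE -sqrtr_sqr ler_wsqrtr // lerDl sqr_ge0. Qed.
Lemma nc_Im x : `|complex.Im x| <= nc x.
Proof. by rewrite ncE -sqrtr_sqr ler_wsqrtr // lerDr sqr_ge0. Qed.
Lemma nc_ReIm x : nc x <= `|complex.Re x| + `|complex.Im x|.
Proof.
have e : x = (complex.Re x)%:C + 'i * (complex.Im x)%:C.
  by case: x => a b; apply/eqP; rewrite eq_complex /=; apply/andP; split; apply/eqP; ring.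
by rewrite {1}e; apply: (le_trans (ncD _ _)); rewrite ncM nc_i mul1r !ncR.
Qed.
Lemma nc_triangle x y z : nc (x - z) <= nc (x - y) + nc (y - z).
Proof. by rewrite -[x - z](subrKA y) ncD. Qed.
Lemma nc_inj_small x y : (forall e, 0 < e -> nc (x - y) <= e) -> x = y.
Proof.
move=> h; apply/eqP; rewrite -subr_eq0 -nc_eq0 eq_le nc_ge0 andbT.
by apply/ler_addgt0Pr => e e0; rewrite add0r h.
Qed.
Lemma mulCconj x : x * x^* = (nc x ^+ 2)%:C.
Proof.
rewrite ncE sqr_sqrtr ?addr_ge0 ?sqr_ge0 //; case: x => a b /=.
by apply/eqP; rewrite eq_complex /=; apply/andP; split; apply/eqP; ring.
Qed.
Lemma circle_conj x : nc x = 1 -> x * x^* = 1.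
Proof. by move=> h; rewrite mulCconj h expr1n. Qed.

End ComplexModulus.

(** * The disc algebra and its maximum principle *)

Section DiscAlgebra.
Variable R : realType.

Lemma prim_root_sum (n : nat) (w : R[i]) (d : nat) : n.-primitive_root w ->
  \sum_(j < n) (w ^+ j) ^+ d = if (n %| d)%N then n%:R else 0.
Proof.
move=> hw; have n0 := prim_order_gt0 hw.
under eq_bigr do rewrite -exprM mulnC exprM.
case: ifP => [hd|hd].
  have -> : w ^+ d = 1 by apply/eqP; rewrite -(prim_order_dvd hw).
  by under eq_bigr do rewrite expr1n; rewrite sumr_const card_ord.
have h1 : w ^+ d - 1 != 0 by rewrite subr_eq0 -(prim_order_dvd hw) hd.
apply: (mulfI h1); rewrite mulr0 -subrX1 -exprM mulnC exprM.
by rewrite (prim_expr_order hw) expr1n subrr.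
Qed.

Lemma complex_prim_root n : (0 < n)%N -> exists w : R[i], n.-primitive_root w.
Proof.
move=> n0; have [r Dr] := closed_field_poly_normal ('X^n - 1 : {poly R[i]}).
rewrite (monicP (monicXnsubC _ n0)) scale1r in Dr.
have /hasP[w _ hw] : has n.-primitive_root r.
  apply: has_prim_root => //.
  - by apply/allP => z; rewrite -root_prod_XsubC -Dr.
  - rewrite -separable_prod_XsubC -Dr separable_Xn_sub_1 //.
    by rewrite pnatr_eq0 -lt0n.
  - by have := size_prod_XsubC r id; rewrite -Dr size_XnsubC // => -[->].
by exists w.
Qed.

(** Cauchy's estimate with the contour integral replaced by the average over the [n]-th roots of
    unity: since [n = size q] exceeds every degree in [q], the average isolates one coefficient
    exactly. *)
Lemma poly_coef_circle (q : {poly R[i]}) (M : R) (k : nat) :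
  (forall x, nc x = 1 -> nc q.[x] <= M) -> nc q`_k <= M.
Proof.
move=> hq; have M0 : 0 <= M by apply: le_trans (nc_ge0 _) (hq 1 (nc1 _)).
case: (ltnP k (size q)) => hk; last by rewrite nth_default // nc0.
set n := size q; have n0 : (0 < n)%N by apply: leq_trans hk.
have [w hw] := complex_prim_root n0.
have wn : w ^+ n = 1 := prim_expr_order hw.
have w1 : nc w = 1.
  apply/eqP; rewrite -(pexpr_eq1 n0 (nc_ge0 w)) -ncX wn nc1 //.
have n0' : (n%:R : R) != 0 by rewrite pnatr_eq0 -lt0n.
have key : \sum_(j < n) (w ^+ j) ^+ (n - k) * q.[w ^+ j] = n%:R * q`_k.
  under eq_bigr do rewrite horner_coef mulr_sumr.
  rewrite exchange_big /= (bigD1 (Ordinal hk)) //= [X in _ + X]big1 ?addr0.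
    under eq_bigr do rewrite mulrCA mulrA -mulrA -exprD subnK ?(ltnW hk) //.
    by rewrite -mulr_sumr prim_root_sum // dvdnn mulrC.
  move=> i hi; under eq_bigr do rewrite mulrCA -exprD.
  rewrite -mulr_sumr prim_root_sum // ifF ?mulr0 //.
  apply/negbTE/negP => /dvdnP [c hc].
  have hin : (i < n)%N := ltn_ord i; have hk' : (k < n)%N := hk.
  move/negP: hi; apply; apply/eqP/val_inj => /=.
  by case: c hc => [|[|c]] hc; nia.
rewrite -(ler_pM2l (x := n%:R)) ?ltr0n //.
have -> : n%:R * nc q`_k = nc (n%:R * q`_k).
  by rewrite ncM -(rmorph_nat (real_complex R)) ncR ger0_norm.
rewrite -key; apply: (le_trans (nc_sum _ _ _)).
have -> : n%:R * M = \sum_(j < n) M by rewrite sumr_const card_ord mulr_natl.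
apply: ler_sum => j _; rewrite ncM !ncX w1 !expr1n mul1r hq //.
by rewrite ncX w1 expr1n.
Qed.

Lemma geom_sum_le (r : R) n : 0 <= r < 1 -> \sum_(i < n) r ^+ i <= (1 - r)^-1.
Proof.
move=> /andP[r0 r1]; have h : 0 < 1 - r by rewrite subr_gt0.
rewrite -(ler_pM2l h) divff ?gt_eqF //.
have := subrX1 r n; rewrite -opprB -[r - 1]opprB mulNr => /oppr_inj <-.
by rewrite lerBlDr lerDl exprn_ge0.
Qed.

Lemma bernoulli (d : R) k : 0 <= d -> 1 + k%:R * d <= (1 + d) ^+ k.
Proof.
move=> d0; elim: k => [|k IH]; first by rewrite mul0r addr0 expr0.
rewrite exprS; apply: le_trans (ler_wpM2l _ IH); last by rewrite addr_ge0.
rewrite -natr1; have : 0 <= k%:R * d ^+ 2 :> R by rewrite mulr_ge0 ?sqr_ge0.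
nra.
Qed.

Lemma exp_bounded_le1 (y C : R) : 0 <= y -> (forall k, y ^+ k <= C) -> y <= 1.
Proof.
move=> y0 h; rewrite leNgt; apply/negP => y1.
have d0 : 0 < y - 1 by rewrite subr_gt0.
have [k hk] : exists k : nat, C / (y - 1) < k%:R.
  exists (Num.truncn (C / (y - 1))).+1; exact: truncnS_gt.
have := h k; have := @bernoulli (y - 1) k (ltW d0).
rewrite (_ : 1 + (y - 1) = y); last by ring.
move=> h1 h2; move: hk; rewrite ltr_pdivrMr //; lra.
Qed.

(** Cauchy's estimate for the powers [q^k] gives [|q(x)|^k <= M^k / (1 - |x|)] inside the disc; as
    [k] grows, the factor independent of [k] becomes harmless. *)
Lemma poly_disc_max (q : {poly R[i]}) (M : R) :
  (forall x, nc x = 1 -> nc q.[x] <= M) -> forall x, nc x <= 1 -> nc q.[x] <= M.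
Proof.
move=> hq x; rewrite le_eqVlt => /orP[/eqP|] hx; first exact: hq.
have M0 : 0 <= M by apply: le_trans (nc_ge0 _) (hq 1 (nc1 _)).
have hk k : nc q.[x] ^+ k <= M ^+ k * (1 - nc x)^-1.
  rewrite -ncX -horner_exp horner_coef; apply: (le_trans (nc_sum _ _ _)).
  apply: le_trans (_ : \sum_(i < size (q ^+ k)) M ^+ k * nc x ^+ i <= _).
    apply: ler_sum => i _; rewrite ncM ncX ler_wpM2r ?exprn_ge0 ?nc_ge0 //.
    apply: poly_coef_circle => u hu.
    by rewrite horner_exp ncX lerXn2r ?nnegrE ?nc_ge0 // hq.
  by rewrite -mulr_sumr ler_wpM2l ?exprn_ge0 // geom_sum_le // nc_ge0.
move: M0; rewrite le_eqVlt => /orP[/eqP M0|M0].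
  have := hk 1%N; rewrite -M0 expr1 expr1 mul0r => h; exact: h.
rewrite -[leRHS]mul1r -ler_pdivrMr //.
apply: (@exp_bounded_le1 _ (1 - nc x)^-1); first by rewrite divr_ge0 ?nc_ge0 // ltW.
by move=> k; rewrite expr_div_n ler_pdivrMr ?exprn_gt0 // mulrC hk.
Qed.

(** Being a uniform limit of polynomials on the closed disc serves as the notion of holomorphic
    inside and continuous up to the boundary: the maximum principle passes to such limits without
    any integration theory. *)
Definition dalg (f : R[i] -> R[i]) := forall e : R, 0 < e ->
  exists q : {poly R[i]}, forall x, nc x <= 1 -> nc (f x - q.[x]) <= e.

Lemma dalg_poly (q : {poly R[i]}) : dalg (fun x => q.[x]).
Proof. by move=> e e0; exists q => x _; rewrite subrr nc0 ltW. Qed.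

Lemma dalg_ext f g : (forall x, nc x <= 1 -> f x = g x) -> dalg f -> dalg g.
Proof.
by move=> fg hf e e0; have [q hq] := hf e e0; exists q => x hx; rewrite -fg ?hq.
Qed.

Lemma dalg_cst a : dalg (fun _ => a).
Proof.
by apply: dalg_ext (dalg_poly a%:P) => x _; rewrite hornerC.
Qed.

Lemma dalg_id : dalg id.
Proof. by apply: dalg_ext (dalg_poly 'X) => x _; rewrite hornerX. Qed.

Lemma poly_bounded (q : {poly R[i]}) : exists2 B : R, 0 <= B &
  forall x, nc x <= 1 -> nc q.[x] <= B.
Proof.
exists (\sum_(i < size q) nc q`_i); first by rewrite sumr_ge0 // => i _; exact: nc_ge0.
move=> x hx; rewrite horner_coef; apply: (le_trans (nc_sum _ _ _)).
apply: ler_sum => i _; rewrite ncM ncX ler_piMr ?nc_ge0 //.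
by rewrite exprn_ile1 ?nc_ge0.
Qed.

Lemma dalg_bounded f : dalg f -> exists2 B : R, 0 <= B &
  forall x, nc x <= 1 -> nc (f x) <= B.
Proof.
move=> hf; have [q hq] := hf 1 ltr01; have [B B0 hB] := poly_bounded q.
exists (B + 1); first by rewrite addr_ge0.
move=> x hx; rewrite -[f x](subrK q.[x]) addrC; apply: (le_trans (ncD _ _)).
by rewrite lerD ?hB ?hq.
Qed.

Lemma dalgD f g : dalg f -> dalg g -> dalg (fun x => f x + g x).
Proof.
move=> hf hg e e0; have e2 : 0 < e / 2 by rewrite divr_gt0.
have [p hp] := hf _ e2; have [q hq] := hg _ e2; exists (p + q) => x hx.
rewrite hornerD opprD addrACA; apply: (le_trans (ncD _ _)).
by rewrite [leRHS](splitr e) lerD ?hp ?hq.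
Qed.

Lemma div1_le (a b : R) : 0 <= a -> 0 <= b -> a / (b + 1) * b <= a.
Proof.
move=> a0 b0; rewrite mulrAC ler_pdivrMr ?ltr_wpDl //.
by rewrite mulrDr mulr1 lerDl.
Qed.

Lemma dalgM f g : dalg f -> dalg g -> dalg (fun x => f x * g x).
Proof.
move=> hf hg e e0.
have [Bg Bg0 hBg] := dalg_bounded hg.
have ef : 0 < e / 2 / (Bg + 1) by rewrite !divr_gt0 // ltr_wpDl.
have [p hp] := hf _ ef; have [Bp Bp0 hBp] := poly_bounded p.
have eg : 0 < e / 2 / (Bp + 1) by rewrite !divr_gt0 // ltr_wpDl.
have [q hq] := hg _ eg; exists (p * q) => x hx; rewrite hornerM.
have -> : f x * g x - p.[x] * q.[x] = (f x - p.[x]) * g x + p.[x] * (g x - q.[x]).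
  ring.
apply: (le_trans (ncD _ _)); rewrite !ncM [leRHS](splitr e); apply: lerD.
  apply: le_trans (ler_pM (nc_ge0 _) (nc_ge0 _) (hp x hx) (hBg x hx)) _.
  by apply: div1_le => //; apply: ltW; rewrite divr_gt0.
apply: le_trans (ler_pM (nc_ge0 _) (nc_ge0 _) (hBp x hx) (hq x hx)) _.
by rewrite mulrC; apply: div1_le => //; apply: ltW; rewrite divr_gt0.
Qed.

Lemma dalgN f : dalg f -> dalg (fun x => - f x).
Proof.
move=> hf; apply: dalg_ext (dalgM (dalg_cst (-1)) hf) => x _; exact: mulN1r.
Qed.

Lemma dalgB f g : dalg f -> dalg g -> dalg (fun x => f x - g x).
Proof. by move=> hf hg; apply: dalgD hf (dalgN hg). Qed.

Lemma dalgX f n : dalg f -> dalg (fun x => f x ^+ n).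
Proof.
move=> hf; elim: n => [|n IH].
  by apply: dalg_ext (dalg_cst 1) => x _; rewrite expr0.
by apply: dalg_ext (dalgM hf IH) => x _; rewrite exprS.
Qed.

Lemma dalg_sum (I : Type) (r : seq I) (F : I -> R[i] -> R[i]) :
  (forall i, dalg (F i)) -> dalg (fun x => \sum_(i <- r) F i x).
Proof.
move=> h; elim: r => [|i r IH].
  by apply: dalg_ext (dalg_cst 0) => x _; rewrite big_nil.
by apply: dalg_ext (dalgD (h i) IH) => x _; rewrite big_cons.
Qed.

Lemma dalg_prod (I : Type) (r : seq I) (F : I -> R[i] -> R[i]) :
  (forall i, dalg (F i)) -> dalg (fun x => \prod_(i <- r) F i x).
Proof.
move=> h; elim: r => [|i r IH].
  by apply: dalg_ext (dalg_cst 1) => x _; rewrite big_nil.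
by apply: dalg_ext (dalgM (h i) IH) => x _; rewrite big_cons.
Qed.

Lemma dalg_max f (M : R) : dalg f -> (forall x, nc x = 1 -> nc (f x) <= M) ->
  forall x, nc x <= 1 -> nc (f x) <= M.
Proof.
move=> hf hM x hx; apply/ler_addgt0Pr => e e0.
have e2 : 0 < e / 2 by rewrite divr_gt0.
have [q hq] := hf _ e2.
have h : nc q.[x] <= M + e / 2.
  apply: poly_disc_max hx => u hu; rewrite -[q.[u]](subrK (f u)) addrC.
  by apply: (le_trans (ncD _ _)); rewrite lerD ?hM // ncBC hq // hu.
rewrite -[f x](subrK q.[x]); apply: (le_trans (ncD _ _)).
have := hq x hx; lra.
Qed.

End DiscAlgebra.

(** * Analytic discs and polynomial hulls *)

Section Hull.
Variables (R : realType) (n : nat).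
Implicit Types K : set 'rV[R[i]]_n.

Lemma dalg_peval (p : mpoly.mpoly n R[i]) (phi : R[i] -> 'rV[R[i]]_n) :
  (forall i, dalg (fun x => phi x 0 i)) -> dalg (fun x => peval p (phi x)).
Proof.
move=> h; apply: (@dalg_ext _ (fun x => \sum_(m <- mpoly.msupp p)
  mpoly.mcoeff m p * \prod_i phi x 0 i ^+ mpoly.fun_of_multinom m i)).
  by move=> x _; rewrite /peval mpoly.mevalE.
apply: dalg_sum => m; apply: dalgM; first exact: dalg_cst.
by apply: dalg_prod => i; apply: dalgX.
Qed.

(** The boundary is only required to lie in the hull, not in [K], so that discs can be attached to
    discs: this is how one passes from the torus to the bidisc and then to a full ball. *)
Lemma poly_hull_disc K (phi : R[i] -> 'rV[R[i]]_n) :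
  (forall i, dalg (fun x => phi x 0 i)) ->
  (forall x, nc x = 1 -> poly_hull K (phi x)) ->
  forall x, nc x <= 1 -> poly_hull K (phi x).
Proof.
move=> h hK x hx p; apply: (dalg_max (dalg_peval p h) _ hx) => u hu.
exact: hK.
Qed.

Lemma peval_bounded (p : mpoly.mpoly n R[i]) (B : R) :
  exists C : R, forall x : 'rV[R[i]]_n, (forall i, nc (x 0 i) <= B) ->
    nc (peval p x) <= C.
Proof.
exists (\sum_(m <- mpoly.msupp p) nc (mpoly.mcoeff m p) *
  \prod_i B ^+ mpoly.fun_of_multinom m i) => x hx.
rewrite /peval mpoly.mevalE; apply: (le_trans (nc_sum _ _ _)).
apply: ler_sum => m _; rewrite ncM ler_wpM2l ?nc_ge0 //.
rewrite nc_prod; apply: ler_prod => i _; rewrite ncX exprn_ge0 ?nc_ge0 //=.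
by rewrite lerXn2r ?nnegrE ?nc_ge0 ?hx // (le_trans (nc_ge0 _) (hx i)).
Qed.

Lemma subset_poly_hull K (B : R) :
  (forall x, K x -> forall i, nc (x 0 i) <= B) -> K `<=` poly_hull K.
Proof.
move=> hK x Kx p; have [C hC] := peval_bounded p B.
apply: ub_le_sup; last by exists x.
by exists C => _ [y Ky <-]; apply: hC; exact: hK.
Qed.

Lemma nc_le_enorm (z : 'rV[R[i]]_n) i : nc (z 0 i) <= enorm z.
Proof.
rewrite /enorm -[leLHS]ger0_norm ?nc_ge0 //.
rewrite -sqrtr_sqr ler_wsqrtr // (bigD1 i) //= lerDl sumr_ge0 // => j _.
exact: sqr_ge0.
Qed.

End Hull.

Lemma enorm_le (R : realType) (z : 'rV[R[i]]_2) :
  enorm z <= nc (z 0 0) + nc (z 0 1).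
Proof.
have h0 := nc_ge0 (z 0 0); have h1 := nc_ge0 (z 0 1).
rewrite -[leRHS]ger0_norm ?addr_ge0 // -sqrtr_sqr ler_wsqrtr //.
rewrite !big_ord_recl big_ord0 addr0 sqrrD.
rewrite (_ : lift ord0 ord0 = 1); last by apply/val_inj.
rewrite -/(nc _) -/(nc _) addrAC lerDl mulrn_wge0 // mulr_ge0 //.
Qed.

(** * Series *)

Section RealSeries.
Variable R : realType.
Implicit Types (c w : nat -> R) (l : R).

Definition rsum c l := forall e : R, 0 < e ->
  exists N, forall n, (N <= n)%N -> `|l - \sum_(i < n) c i| <= e.

Definition bdd w := exists M : R, forall n, \sum_(i < n) w i <= M.

Lemma rsum_cvg c l : rsum c l <-> series c @ \oo --> l.
Proof.
split=> [h|/cvgrPdist_le h].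
  apply/cvgrPdist_le => e e0; have [N hN] := h e e0; exists N => // n /= Nn.
  by rewrite /series /= big_mkord hN.
move=> e e0; have [N _ hN] := h e e0; exists N => n Nn.
by have := hN n Nn; rewrite /series /= big_mkord.
Qed.

Lemma rsum_exists c w : (forall i, `|c i| <= w i) -> bdd w -> exists l, rsum c l.
Proof.
move=> hcw [M hM].
have hc : cvgn (series c).
  apply: normed_cvg; apply: nondecreasing_is_cvgn.
    by apply: nondecreasing_series => n _ _; exact: normr_ge0.
  exists M => _ [n _ <-].
  apply: (@le_trans _ _ (\sum_(0 <= i < n) `|c i|)) => //.
  by rewrite big_mkord; apply: le_trans (hM n); apply: ler_sum => i _; exact: hcw.
by exists (limn (series c)); apply/rsum_cvg.
Qed.

Lemma rsum_uniq c l l' : rsum c l -> rsum c l' -> l = l'.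
Proof.
by move=> /rsum_cvg h /rsum_cvg h'; exact: (cvg_unique _ h h').
Qed.

Lemma eq_rsum c c' l : c =1 c' -> rsum c l -> rsum c' l.
Proof.
move=> e h d d0; have [N hN] := h d d0; exists N => n Nn.
by under eq_bigr do rewrite -e; exact: hN.
Qed.

Lemma rsumD c c' l l' : rsum c l -> rsum c' l' -> rsum (fun i => c i + c' i) (l + l').
Proof.
move=> /rsum_cvg h /rsum_cvg h'; apply/rsum_cvg.
have -> : series (fun i => c i + c' i) = series c \+ series c'.
  by apply/funext => n; rewrite /series /= big_split.
exact: cvgD.
Qed.

Lemma rsumZ c a l : rsum c l -> rsum (fun i => a * c i) (a * l).
Proof.
move=> /rsum_cvg h; apply/rsum_cvg.
have -> : series (fun i => a * c i) = (fun n => a * series c n).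
  by apply/funext => n; rewrite /series /= mulr_sumr.
exact: cvgMr.
Qed.


Lemma rsum_ge_part c l n : (forall i, 0 <= c i) -> rsum c l -> \sum_(i < n) c i <= l.
Proof.
move=> c0 h; apply/ler_addgt0Pr => e e0; have [N hN] := h e e0.
have := hN (N + n)%N (leq_addr _ _); rewrite ler_norml => /andP[h1 _].
have h2 : \sum_(i < n) c i <= \sum_(i < N + n) c i.
  rewrite -!(big_mkord xpredT c) [leRHS](big_cat_nat (n := n)) ?leq_addl //=.
  by rewrite lerDl sumr_ge0.
lra.
Qed.

Lemma rsum_le_bound c l (M : R) : (forall n, \sum_(i < n) c i <= M) -> rsum c l -> l <= M.
Proof.
move=> hM h; apply/ler_addgt0Pr => e e0; have [N hN] := h e e0.
have := hN N (leqnn _); rewrite ler_norml => /andP[_ h1].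
have := hM N; lra.
Qed.

Lemma rsum_ge_bound c l (M : R) : (forall n, M <= \sum_(i < n) c i) -> rsum c l -> M <= l.
Proof.
move=> hM h; rewrite -lerN2; apply: (@rsum_le_bound (fun i => -1 * c i)).
  by move=> n; rewrite -mulr_sumr mulN1r lerN2.
by rewrite -[- l]mulN1r; exact: rsumZ.
Qed.

Lemma rsum_ge0 c l : (forall i, 0 <= c i) -> rsum c l -> 0 <= l.
Proof. by move=> c0; apply: rsum_ge_bound => n; rewrite sumr_ge0. Qed.

Lemma rsum_le c c' l l' : (forall i, c i <= c' i) -> rsum c l -> rsum c' l' -> l <= l'.
Proof.
move=> cc h h'; rewrite -subr_ge0.
apply: (@rsum_ge0 (fun i => c' i + -1 * c i)) => [i|].
  by rewrite mulN1r subr_ge0.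
by rewrite -[- l]mulN1r; apply: rsumD => //; exact: rsumZ.
Qed.

Lemma rsum_norm_le c w l l' : (forall i, `|c i| <= w i) -> rsum c l -> rsum w l' ->
  `|l| <= l'.
Proof.
move=> h hc hw; rewrite ler_norml; apply/andP; split.
  rewrite -[- l']mulN1r; apply: rsum_le (rsumZ (-1) hw) hc => i.
  by rewrite mulN1r lerNl; apply: le_trans (h i); rewrite -normrN ler_norm.
by apply: rsum_le hc hw => i; apply: le_trans (h i); exact: ler_norm.
Qed.

Lemma bdd_le c w : (forall i, c i <= w i) -> bdd w -> bdd c.
Proof.
by move=> h [M hM]; exists M => n; apply: le_trans (hM n); exact: ler_sum.
Qed.

Lemma bddD c w : bdd c -> bdd w -> bdd (fun i => c i + w i).
Proof.
by move=> [M hM] [M' hM']; exists (M + M') => n; rewrite big_split lerD.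
Qed.

Lemma bddZ c (a : R) : 0 <= a -> bdd c -> bdd (fun i => a * c i).
Proof.
by move=> a0 [M hM]; exists (a * M) => n; rewrite -mulr_sumr ler_wpM2l.
Qed.

Lemma bdd_shift c : (forall i, 0 <= c i) -> bdd c -> bdd (fun i => c i.+1).
Proof.
move=> c0 [M hM]; exists M => n; apply: le_trans (hM n.+1).
by rewrite big_ord_recl lerDr.
Qed.

Lemma bdd_unshift c : bdd (fun i => c i.+1) -> bdd c.
Proof.
move=> [M hM]; exists (Num.max 0 (c 0%N + M)) => -[|n].
  by rewrite big_ord0 le_max lexx.
by rewrite big_ord_recl le_max lerD2l hM orbT.
Qed.

Lemma bdd_tail w : (forall i, 0 <= w i) -> bdd w -> forall e : R, 0 < e ->
  exists N, forall m n, (N <= m)%N -> \sum_(m <= i < n) w i <= e.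
Proof.
move=> w0 hw e e0; have [l hl] : exists l, rsum w l.
  by apply: rsum_exists hw => i; rewrite ger0_norm.
have [N hN] := hl e e0; exists N => m n Nm.
have h1 := hN m Nm; have h2 := rsum_ge_part n w0 hl.
case: (leqP m n) => [mn|nm]; last by rewrite big_geq ?ltW // ltnW.
move: h1; rewrite ler_norml => /andP[_ h1]; move: h2.
rewrite -!(big_mkord xpredT w) in h1 *.
rewrite [leLHS](big_cat_nat (n := m)) //=; lra.
Qed.

Lemma bdd_geom (r : R) : 0 <= r < 1 -> bdd (fun i => r ^+ i).
Proof. by move=> h; exists (1 - r)^-1 => n; exact: geom_sum_le. Qed.

(** Tonelli's theorem: finitely many columns are dominated by the full rows, and finitely many rows
    by the full columns, so each total bounds the other. *)
Lemma rsum_exchange (a : nat -> nat -> R) (s s' : nat -> R) (l : R) :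
  (forall i j, 0 <= a i j) -> (forall i, rsum (a i) (s i)) ->
  (forall j, rsum (a ^~ j) (s' j)) -> rsum s l -> rsum s' l.
Proof.
move=> a0 hs hs' hl.
have s'0 j : 0 <= s' j by apply: rsum_ge0 (hs' j).
have s0 j : 0 <= s j by apply: rsum_ge0 (hs j).
have fin (u : nat -> nat -> R) (v : nat -> R) n :
    (forall i, rsum (u i) (v i)) -> rsum (fun j => \sum_(i < n) u i j) (\sum_(i < n) v i).
  move=> huv; elim: n => [|n IH].
    rewrite big_ord0 => e e0; exists 0%N => n _.
    by under eq_bigr do rewrite big_ord0; rewrite big1 ?subr0 ?normr0 ?ltW.
  rewrite big_ord_recr /=; apply: eq_rsum (rsumD IH (huv n)) => j.
  by rewrite big_ord_recr.
have h1 n : \sum_(j < n) s' j <= l.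
  apply: rsum_le (fin (fun j i => a i j) s' n hs') hl => i.
  exact: rsum_ge_part.
have [l' hl'] : exists l', rsum s' l'.
  by apply: (@rsum_exists _ s') => [i|]; [rewrite ger0_norm|exists l].
have -> : l = l' by apply/eqP; rewrite eq_le (rsum_le_bound h1 hl') andbT;
  apply: rsum_le_bound hl => n; apply: rsum_le (fin a s n hs) hl' => j;
  exact: (rsum_ge_part _ (fun i => a0 i j)).
exact: hl'.
Qed.

End RealSeries.

Section ComplexSeries.
Variable R : realType.
Implicit Types (c : nat -> R[i]) (l : R[i]).

Definition csum c l := forall e : R, 0 < e ->
  exists N, forall n, (N <= n)%N -> nc (l - \sum_(i < n) c i) <= e.

Lemma Re_sum (n : nat) c :
  complex.Re (\sum_(i < n) c i) = \sum_(i < n) complex.Re (c i).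
Proof. by rewrite raddf_sum. Qed.

Lemma Im_sum (n : nat) c :
  complex.Im (\sum_(i < n) c i) = \sum_(i < n) complex.Im (c i).
Proof. by rewrite raddf_sum. Qed.

Lemma csum_exists c w : (forall i, nc (c i) <= w i) -> bdd w -> exists l, csum c l.
Proof.
move=> hcw hw.
have [a ha] : exists a, rsum (fun i => complex.Re (c i)) a.
  by apply: rsum_exists hw => i; apply: le_trans (nc_Re _) (hcw i).
have [b hb] : exists b, rsum (fun i => complex.Im (c i)) b.
  by apply: rsum_exists hw => i; apply: le_trans (nc_Im _) (hcw i).
exists (a +i* b) => e e0; have e2 : 0 < e / 2 by rewrite divr_gt0.
have [N hN] := ha _ e2; have [N' hN'] := hb _ e2.
exists (maxn N N') => n; rewrite geq_max => /andP[n1 n2].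
apply: (le_trans (nc_ReIm _)); rewrite !raddfB /= Re_sum Im_sum.
by rewrite [leRHS](splitr e) lerD ?hN ?hN'.
Qed.

Lemma csum_uniq c l l' : csum c l -> csum c l' -> l = l'.
Proof.
move=> h h'; apply: nc_inj_small => e e0.
have e2 : 0 < e / 2 by rewrite divr_gt0.
have [N hN] := h _ e2; have [N' hN'] := h' _ e2.
pose n := maxn N N'; apply: (le_trans (nc_triangle _ (\sum_(i < n) c i) _)).
rewrite [leRHS](splitr e) lerD ?hN ?leq_maxl //.
by rewrite ncBC hN' ?leq_maxr.
Qed.

Lemma csum_tail c l (e : R) m : csum c l ->
  (forall n, \sum_(m <= i < n) nc (c i) <= e) -> nc (l - \sum_(i < m) c i) <= e.
Proof.
move=> h hm; apply/ler_addgt0Pr => d d0; have [N hN] := h d d0.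
pose n := (N + m)%N; have := hN n (leq_addr _ _) => h1.
apply: (le_trans (nc_triangle _ (\sum_(i < n) c i) _)); rewrite addrC lerD //.
have mn : (m <= n)%N by rewrite leq_addl.
rewrite -!(big_mkord xpredT c) (big_cat_nat (n := m)) //= addrAC subrr add0r.
exact: le_trans (nc_sum _ _ _) (hm n).
Qed.

Lemma csum_norm c l (M : R) : csum c l -> (forall n, \sum_(i < n) nc (c i) <= M) ->
  nc l <= M.
Proof.
move=> h hM; have := @csum_tail c l M 0 h; rewrite big_ord0 subr0; apply => n.
by rewrite big_mkord.
Qed.

Lemma eq_csum c c' l : c =1 c' -> csum c l -> csum c' l.
Proof.
move=> e h d d0; have [N hN] := h d d0; exists N => n Nn.
by under eq_bigr do rewrite -e; exact: hN.
Qed.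

Lemma csumD c c' l l' : csum c l -> csum c' l' -> csum (fun i => c i + c' i) (l + l').
Proof.
move=> h h' e e0; have e2 : 0 < e / 2 by rewrite divr_gt0.
have [N hN] := h _ e2; have [N' hN'] := h' _ e2.
exists (maxn N N') => n; rewrite geq_max => /andP[n1 n2].
rewrite big_split /= opprD addrACA; apply: (le_trans (ncD _ _)).
by rewrite [leRHS](splitr e) lerD ?hN ?hN'.
Qed.

Lemma csumZ c a l : csum c l -> csum (fun i => a * c i) (a * l).
Proof.
move=> h e e0; have e2 : 0 < e / (nc a + 1) by rewrite divr_gt0 // ltr_wpDl ?nc_ge0.
have [N hN] := h _ e2; exists N => n Nn.
rewrite -mulr_sumr -mulrBr ncM; apply: le_trans (ler_wpM2l (nc_ge0 _) (hN n Nn)) _.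
by rewrite mulrC; apply: div1_le; rewrite ?nc_ge0 ?ltW.
Qed.

Lemma csum_shift c l : csum c l -> csum (fun i => c i.+1) (l - c 0%N).
Proof.
move=> h e e0; have [N hN] := h e e0; exists N => n Nn.
have := hN n.+1 (leqW Nn); rewrite big_ord_recl opprD addrA.
by under eq_bigr do rewrite lift0.
Qed.

Lemma csum_unshift c l : csum (fun i => c i.+1) l -> csum c (c 0%N + l).
Proof.
move=> h e e0; have [N hN] := h e e0; exists N.+1 => -[//|n] Nn.
rewrite big_ord_recl opprD addrACA subrr add0r.
by under eq_bigr do rewrite lift0; exact: hN.
Qed.

End ComplexSeries.

(** * Absolutely summable power series on the closed disc and their products *)

Section PowerSeries.
Variable R : realType.
Implicit Types (c : nat -> R) (x : R[i]).

Definition l1 c := bdd (fun i => `|c i|).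

(** The default value 0 is not met for [l1 c] on the closed disc, where the series converges. *)
Definition ev c x : R[i] := xget 0 (csum (fun n => (c n)%:C * x ^+ n)).

Lemma nc_term c x n : nc x <= 1 -> nc ((c n)%:C * x ^+ n) <= `|c n|.
Proof.
move=> hx; rewrite ncM ncR ncX ler_piMr //; apply: exprn_ile1 => //; exact: nc_ge0.
Qed.

Lemma evP c x : l1 c -> nc x <= 1 -> csum (fun n => (c n)%:C * x ^+ n) (ev c x).
Proof.
move=> hc hx; have [l hl] := csum_exists (fun n => nc_term c n hx) hc.
by rewrite /ev; apply: (xgetI _ hl).
Qed.

Lemma ev_uniq c x l : l1 c -> nc x <= 1 -> csum (fun n => (c n)%:C * x ^+ n) l ->
  ev c x = l.
Proof. by move=> hc hx; apply: csum_uniq; exact: evP. Qed.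

Lemma ev_tail c x (e : R) m : l1 c -> nc x <= 1 ->
  (forall n, \sum_(m <= i < n) `|c i| <= e) ->
  nc (ev c x - \sum_(i < m) (c i)%:C * x ^+ i) <= e.
Proof.
move=> hc hx h; apply: (csum_tail (evP hc hx)) => n.
by apply: le_trans (h n); apply: ler_sum => i _; exact: nc_term.
Qed.

Lemma ev_approx c : l1 c -> forall e : R, 0 < e -> exists N, forall n, (N <= n)%N ->
  forall x, nc x <= 1 -> nc (ev c x - \sum_(i < n) (c i)%:C * x ^+ i) <= e.
Proof.
move=> hc e e0; have [N hN] := bdd_tail (fun i => normr_ge0 (c i)) hc e0.
by exists N => n Nn x hx; apply: ev_tail => // m; exact: hN.
Qed.

Lemma ev0 c : l1 c -> ev c 0 = (c 0%N)%:C.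
Proof.
move=> hc; apply: ev_uniq; rewrite ?nc0 ?ler01 // => e e0; exists 1%N => -[//|n] _.
rewrite big_ord_recl expr0 mulr1 big1 ?addr0 ?subrr ?nc0 ?ltW // => i _.
by rewrite lift0 expr0n mulr0.
Qed.

Lemma ev_conj c x : l1 c -> nc x <= 1 -> ev c x^* = (ev c x)^*.
Proof.
move=> hc hx; apply: ev_uniq => //; first by rewrite nc_conj.
move=> e e0; have [N hN] := evP hc hx e0; exists N => n Nn.
rewrite -nc_conj rmorphB /= conjCK rmorph_sum /=.
under eq_bigr do rewrite rmorphM rmorphXn /= conjCK conjR.
exact: hN.
Qed.

Lemma dalg_ev c : l1 c -> dalg (ev c).
Proof.
move=> hc e e0; have [N hN] := ev_approx hc e0.
exists (\poly_(i < N) (c i)%:C) => x hx; rewrite horner_poly; exact: hN.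
Qed.

End PowerSeries.

Section Cauchy.
Variable R : realType.
Implicit Types (a b : nat -> R).

Definition conv a b n : R := \sum_(i < n.+1) a i * b (n - i)%N.

Lemma triangle_sum (V : zmodType) (f : nat -> nat -> V) N :
  \sum_(n < N) \sum_(i < n.+1) f i (n - i)%N = \sum_(i < N) \sum_(j < N - i) f i j.
Proof.
elim: N => [|N IH]; first by rewrite !big_ord0.
rewrite big_ord_recr /= IH [RHS]big_ord_recr /= subSnn big_ord1.
rewrite [X in _ + X]big_ord_recr /= subnn addrA; congr (_ + _).
rewrite -big_split /=; apply: eq_bigr => i _.
by rewrite subSn ?big_ord_recr //= ltnW.
Qed.

Lemma l1_conv a b : l1 a -> l1 b -> l1 (conv a b).
Proof.
move=> [A hA] [B hB]; exists (A * B) => N.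
apply: (@le_trans _ _ (\sum_(n < N) \sum_(i < n.+1) `|a i| * `|b (n - i)%N|)).
  apply: ler_sum => n _; apply: (le_trans (ler_norm_sum _ _ _)).
  by apply: ler_sum => i _; rewrite normrM.
rewrite (triangle_sum (fun i j => `|a i| * `|b j|)).
apply: (@le_trans _ _ (\sum_(i < N) `|a i| * B)).
  by apply: ler_sum => i _; rewrite -mulr_sumr ler_wpM2l.
rewrite -mulr_suml ler_wpM2r //.
by apply: le_trans (hB 0%N); rewrite big_ord0.
Qed.

Lemma ev_conv a b x : l1 a -> l1 b -> nc x <= 1 ->
  ev (conv a b) x = ev a x * ev b x.
Proof.
move=> ha hb hx; have hc := l1_conv ha hb.
apply: (csum_uniq (evP hc hx)) => e e0.
have [A hA] := ha; have [B hB] := hb.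
have A0 : 0 <= A by apply: le_trans (hA 0%N); rewrite big_ord0.
have B0 : 0 <= B by apply: le_trans (hB 0%N); rewrite big_ord0.
pose sa n := \sum_(i < n) (a i)%:C * x ^+ i; pose sb n := \sum_(i < n) (b i)%:C * x ^+ i.
pose d := e / 4 / (A + B + 1).
have d0 : 0 < d by rewrite !divr_gt0 // ltr_wpDl ?addr_ge0.
have [N1 h1] := bdd_tail (fun i => normr_ge0 (a i)) ha d0.
have [N2 h2] := bdd_tail (fun i => normr_ge0 (b i)) hb d0.
(* The square of partial sums exceeds the triangle [i + j < N] by pairs with [i + j >= N]; once
   [N >= 2 M], one index of such a pair is at least [M], so a small tail can be factored out. *)
pose M := maxn N1 N2; exists (M + M)%N => N NM.
have MN : (M <= N)%N by apply: leq_trans NM; exact: leq_addr.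
have nsa : nc (sa N) <= A.
  apply: (le_trans (nc_sum _ _ _)); apply: le_trans (hA N).
  by apply: ler_sum => i _; exact: nc_term.
have nb : nc (ev b x) <= B.
  by apply: (csum_norm (evP hb hx)) => n; apply: le_trans (hB n);
    apply: ler_sum => i _; exact: nc_term.
have ea : nc (ev a x - sa N) <= d.
  by apply: ev_tail => // n; apply: h1; apply: leq_trans MN; exact: leq_maxl.
have eb : nc (ev b x - sb N) <= d.
  by apply: ev_tail => // n; apply: h2; apply: leq_trans MN; exact: leq_maxr.
have -> : \sum_(i < N) (conv a b i)%:C * x ^+ i =
    \sum_(i < N) \sum_(j < N - i) ((a i)%:C * x ^+ i) * ((b j)%:C * x ^+ j).
  rewrite -(triangle_sum (fun i j => ((a i)%:C * x ^+ i) * ((b j)%:C * x ^+ j))).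
  apply: eq_bigr => n _; rewrite rmorph_sum mulr_suml; apply: eq_bigr => i _.
  have -> : x ^+ n = x ^+ i * x ^+ (n - i) by rewrite -exprD subnKC // -ltnS.
  by rewrite rmorphM; ring.
have key : nc (sa N * sb N -
    \sum_(i < N) \sum_(j < N - i) ((a i)%:C * x ^+ i) * ((b j)%:C * x ^+ j)) <=
    d * A + d * B.
  have -> : sa N * sb N -
    \sum_(i < N) \sum_(j < N - i) ((a i)%:C * x ^+ i) * ((b j)%:C * x ^+ j) =
    \sum_(i < N) ((a i)%:C * x ^+ i) * \sum_(N - i <= j < N) ((b j)%:C * x ^+ j).
    rewrite /sa mulr_suml -sumrB; apply: eq_bigr => i _.
    rewrite -mulr_sumr -mulrBr /sb -!(big_mkord xpredT (fun j => (b j)%:C * x ^+ j)).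
    by rewrite (big_cat_nat (n := (N - i)%N)) ?leq_subr //= addrAC subrr add0r.
  apply: (le_trans (nc_sum _ _ _)).
  have tb i n : nc (\sum_(i <= j < n) (b j)%:C * x ^+ j) <= \sum_(i <= j < n) `|b j|.
    apply: (le_trans (nc_sum _ _ _)); apply: ler_sum => j _; exact: nc_term.
  have tbB i n : \sum_(i <= j < n) `|b j| <= B.
    case: (leqP i n) => hin; last by rewrite big_geq // ltnW.
    apply: le_trans (hB n); rewrite -(big_mkord xpredT (fun j => `|b j|)).
    by rewrite [leRHS](big_cat_nat (n := i)) //= lerDr sumr_ge0.
  rewrite -(big_mkord xpredT (fun i => nc ((a i)%:C * x ^+ i *
     \sum_(N - i <= j < N) ((b j)%:C * x ^+ j)))).
  rewrite (big_cat_nat (n := M)) //=; apply: lerD.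
    apply: (@le_trans _ _ (\sum_(0 <= i < M) `|a i| * d)).
      rewrite !big_nat; apply: ler_sum => i /andP[_ iM]; rewrite ncM.
      apply: ler_pM; rewrite ?nc_ge0 // ?nc_term //; apply: (le_trans (tb _ _)).
      apply: h2; apply: leq_trans (leq_maxr N1 _) _; rewrite -/M.
      by rewrite leq_subRL; [apply: leq_trans NM; rewrite leq_add2r ltnW|rewrite (leq_trans (ltnW iM))].
    by rewrite -mulr_suml mulrC big_mkord; apply: ler_wpM2l => //; exact: ltW.
  apply: (@le_trans _ _ (\sum_(M <= i < N) `|a i| * B)).
    apply: ler_sum => i _; rewrite ncM; apply: ler_pM; rewrite ?nc_ge0 // ?nc_term //.
    exact: le_trans (tb _ _) (tbB _ _).
  by rewrite -mulr_suml ler_wpM2r // h1 // leq_maxl.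
apply: (le_trans (nc_triangle _ (sa N * sb N) _)).
have -> : ev a x * ev b x - sa N * sb N =
   (ev a x - sa N) * ev b x + sa N * (ev b x - sb N) by ring.
have h3 : nc ((ev a x - sa N) * ev b x + sa N * (ev b x - sb N)) <= d * B + A * d.
  by apply: (le_trans (ncD _ _)); rewrite !ncM lerD // ler_pM ?nc_ge0.
have h4 : d * (A + B + 1) = e / 4 by rewrite /d divfK // gt_eqF // ltr_wpDl ?addr_ge0.
have := lerD h3 key; nra.
Qed.

End Cauchy.

(** * Binomial coefficients and a Hankel matrix *)

Section Pochhammer.
Variable R : realType.
Implicit Types s : R.

(* The coefficients of [(1 - x)^(-s)]. *)
Fixpoint po s n : R := if n is m.+1 then po s m * (s + m%:R) / m.+1%:R else 1.

Arguments po : simpl never.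

Lemma po0 s : po s 0 = 1. Proof. by []. Qed.

Lemma poE s n : po s n.+1 = po s n * (s + n%:R) / n.+1%:R. Proof. by []. Qed.

Lemma poS s n : n.+1%:R * po s n.+1 = (s + n%:R) * po s n.
Proof. by rewrite poE mulrCA divff ?pnatr_eq0 // mulr1 mulrC. Qed.

Lemma po_gt0 s n : 0 < s -> 0 < po s n.
Proof.
move=> s0; elim: n => [|n IH]; rewrite ?po0 ?ltr01 // poE.
by rewrite divr_gt0 // mulr_gt0 // ltr_pwDl.
Qed.

Lemma po_le1 s n : 0 < s <= 1 -> po s n <= 1.
Proof.
move=> /andP[s0 s1]; elim: n => [|n IH]; rewrite ?po0 // poE.
rewrite ler_pdivrMr ?ltr0n // mul1r.
have h : s + n%:R <= n.+1%:R by rewrite -natr1 addrC lerD2l.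
rewrite -[leRHS]mul1r; apply: ler_pM => //; first exact/ltW/po_gt0.
by apply: addr_ge0 => //; exact: ltW.
Qed.

(** Vandermonde's identity. Weighing each term by [n + 1 = i + (n + 1 - i)] is the Leibniz rule read
    on coefficients, and [poS] is the differential equation of [(1 - x)^(-s)]. *)
Lemma conv_po s s' n : conv (po s) (po s') n = po (s + s') n.
Proof.
elim: n => [|n IH]; first by rewrite /conv big_ord1 mulr1.
apply: (mulfI (x := n.+1%:R)); first by rewrite pnatr_eq0.
rewrite poS -IH /conv.
have -> : n.+1%:R * \sum_(i < n.+2) po s i * po s' (n.+1 - i)%N =
  \sum_(i < n.+2) i%:R * po s i * po s' (n.+1 - i)%N +
  \sum_(i < n.+2) po s i * ((n.+1 - i)%:R * po s' (n.+1 - i)%N).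
  rewrite mulr_sumr -big_split /=; apply: eq_bigr => i _.
  have -> : n.+1%:R = i%:R + (n.+1 - i)%:R :> R.
    by rewrite -natrD subnKC // -ltnS.
  by ring.
rewrite big_ord_recl /= !mul0r add0r [X in _ + X]big_ord_recr /= subnn mul0r mulr0 addr0.
rewrite -big_split /= mulr_sumr; apply: eq_bigr => i _.
have hi : (i <= n)%N by rewrite -ltnS.
rewrite /bump /= add1n subSS subSn // !poS.
have -> : n%:R = i%:R + (n - i)%:R :> R by rewrite -natrD subnKC.
by ring.
Qed.

Lemma po_0S n : po 0 n.+1 = 0.
Proof. by elim: n => [|n IH]; rewrite poE ?addr0 ?mulr0 ?mul0r // IH !mul0r. Qed.

Lemma po_1 n : po 1 n = 1.
Proof.
elim: n => [|n IH] //; by rewrite poE IH mul1r addrC natr1 divff.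
Qed.

Lemma po_N1 n : po (-1) n.+2 = 0.
Proof.
by elim: n => [|n IH]; rewrite poE ?IH ?mul0r // addNr mulr0 mul0r.
Qed.

(** Coefficients of [- (1 - x)^(1/3)]: with this sign all of them except the constant one are
    positive. *)
Definition gam n : R := - po (- (1/3)) n.

Lemma gamS n : gam n.+1 = 1/3 * po (2/3) n / n.+1%:R.
Proof.
rewrite /gam; elim: n => [|n IH]; first by rewrite poE !po0; field.
have h : n%:R + 1 != 0 :> R by rewrite natr1 pnatr_eq0.
have h' : n%:R + 1 + 1 != 0 :> R by rewrite !natr1 pnatr_eq0.
rewrite poE -[po _ n.+1]opprK IH poE -!natr1; field.
by rewrite h h'.
Qed.

Lemma gam_gt0 n : 0 < gam n.+1.
Proof. by rewrite gamS divr_gt0 // mulr_gt0 ?po_gt0 // divr_gt0. Qed.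

Lemma gam_le1 n : gam n.+1 <= 1.
Proof.
rewrite gamS ler_pdivrMr ?ltr0n // !mul1r.
apply: (@le_trans _ _ 1); last by rewrite ler1n.
have := @po_le1 (2/3) n ltac:(lra); have := @po_gt0 (2/3) n ltac:(lra); lra.
Qed.

(** At [r = 1] the series of a Hankel entry has partial sums in closed form. The limit in [m] is the
    entry [sin (pi/3) / (pi (j + 2/3))] of a scaled Hilbert matrix. *)
Lemma bet_gam_sum m j :
  \sum_(i < m) po (1/3) i * gam (i + j).+1 =
  m%:R * po (1/3) m * po (2/3) (m + j) / (j%:R + 2/3).
Proof.
have hj : j%:R + 2/3 != 0 :> R by rewrite gt_eqF // ltr_wpDl // divr_gt0.
elim: m => [|m IH]; first by rewrite big_ord0 !mul0r.
rewrite big_ord_recr /= IH gamS addSn poE [po (2/3) _.+1]poE -!natr1 natrD.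
have h1 : m%:R + 1 != 0 :> R by rewrite natr1 pnatr_eq0.
have h2 : m%:R + j%:R + 1 != 0 :> R by rewrite -natrD natr1 pnatr_eq0.
field; rewrite h1 h2 /= andbT.
by apply/eqP => e; move/eqP: hj; apply; lra.
Qed.

Lemma po_half_sq m : (m%:R * po (1/2) m ^+ 2 : R) <= m.+1%:R * po (1/2) m.+1 ^+ 2.
Proof.
have -> : m.+1%:R * po (1/2) m.+1 ^+ 2 = (1/2 + m%:R) ^+ 2 / m.+1%:R * po (1/2) m ^+ 2 :> R.
  by rewrite poE -natr1; field; rewrite natr1 pnatr_eq0.
rewrite ler_wpM2r ?sqr_ge0 // ler_pdivlMr ?ltr0n // -natr1.
have : 0 <= m%:R :> R by []. nra.
Qed.

Lemma po_half_sq_nd : {homo (fun m => m%:R * po (1/2) m ^+ 2 : R) : m n / (m <= n)%N >-> m <= n}.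
Proof. by apply: homo_leq => [//|y x z|m]; [exact: le_trans|exact: po_half_sq]. Qed.

(** While [m po_m^2] increases, [(m + 1/2) po_m^2] decreases from its value [1/2] at [m = 0]; the
    second fact carries the induction. *)
Lemma po_half_sq_le m : (m%:R * po (1/2) m ^+ 2 : R) <= 1/2.
Proof.
have h : (m%:R + 1/2) * po (1/2) m ^+ 2 <= 1/2 :> R.
  elim: m => [|m IH]; first by rewrite po0; lra.
  apply: le_trans IH.
  have -> : (m.+1%:R + 1/2) * po (1/2) m.+1 ^+ 2 =
     (m.+1%:R + 1/2) * (1/2 + m%:R) ^+ 2 / m.+1%:R ^+ 2 * po (1/2) m ^+ 2 :> R.
    by rewrite poE -natr1; field; rewrite natr1 pnatr_eq0.
  rewrite ler_wpM2r ?sqr_ge0 // ler_pdivrMr ?exprn_gt0 ?ltr0n // -natr1.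
  have : 0 <= m%:R :> R by []. nra.
have := sqr_ge0 (po (1/2) m : R); nra.
Qed.

(** Together with [po_halves] this writes [po_ratio] through factorials, to which Stirling's formula
    applies. *)
Lemma po_thirds m : po (1/3) m * po (2/3) m * (27%:R ^+ m * m`!%:R ^+ 3) = (3 * m)`!%:R :> R.
Proof.
elim: m => [|m IH]; first by rewrite !po0 muln0 !fact0 !expr0 expr1n !mulr1.
rewrite (_ : (3 * m.+1 = (3 * m).+3)%N); last by lia.
rewrite !factS !natrM -IH !poE exprS -!natr1 natrM; field.
by rewrite natr1 pnatr_eq0.
Qed.

Lemma po_halves m : po (1/2) m * (4%:R ^+ m * m`!%:R ^+ 2) = (2 * m)`!%:R :> R.
Proof.
elim: m => [|m IH]; first by rewrite !po0 muln0 !fact0 !expr0 expr1n !mulr1.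
rewrite (_ : (2 * m.+1 = (2 * m).+2)%N); last by lia.
rewrite !factS !natrM -IH !poE exprS -!natr1 natrM; field.
by rewrite natr1 pnatr_eq0.
Qed.

End Pochhammer.

(** * The constant [sqrt 3 / 2] through Stirling's formula *)

Section Stirling.
Variable R : realType.

Lemma homo_ge0_from0 (f df : R -> R) (x : R) : 0 <= x ->
  (forall y : R, 0 <= y -> is_derive y 1 f (df y)) ->
  (forall y : R, 0 <= y -> 0 <= df y) ->
  f 0 <= f x.
Proof.
rewrite le_eqVlt => /orP[/eqP <- //|x0] hd hp.
have cf : {within `[0, x], continuous f}.
  apply: derivable_within_continuous => y; rewrite in_itv /= => /andP[y0 _].
  by case: (hd y y0).
have hd' (y : R) : y \in `]0, x[ -> is_derive y 1 f (df y).
  by rewrite in_itv /= => /andP[/ltW y0 _]; exact: hd.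
have [c] := MVT x0 hd' cf.
rewrite in_itv /= => /andP[c0 _] e.
by rewrite -subr_ge0 e mulr_ge0 ?hp ?subr_ge0 // ltW.
Qed.

(** At [u = 1/n] the left side is [1 / (n + 1/2)], exactly what makes the sequence [stirling]
    nonincreasing. *)
Lemma ln1D_ge (u : R) : 0 <= u -> 2 * u / (2 + u) <= ln (1 + u).
Proof.
move=> u0; rewrite -subr_ge0.
have := @homo_ge0_from0 (fun u => ln (1 + u) - 2 * u / (2 + u))
  (fun u => u ^+ 2 / ((1 + u) * (2 + u) ^+ 2)) u u0.
rewrite addr0 ln1 mulr0 mul0r subr0; apply.
  move=> y y0; have h1 : 0 < 1 + y by rewrite ltr_pwDl.
  have h2 : 2 + y != 0 by rewrite gt_eqF // ltr_pwDl.
  have h3 : 1 + y != 0 by rewrite gt_eqF.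
  have hl := is_derive1_ln h1.
  apply: is_derive_eq.
  rewrite /GRing.scale /=; field; rewrite ?h2 ?h3 //.
by move=> y y0; rewrite divr_ge0 ?sqr_ge0 // mulr_ge0 ?sqr_ge0 // addr_ge0.
Qed.

Lemma ln1D_le (u : R) : 0 <= u -> ln (1 + u) <= u - u ^+ 2 / 2 + u ^+ 3 / 3.
Proof.
move=> u0; rewrite -subr_ge0.
have := @homo_ge0_from0 (fun u => u - u ^+ 2 / 2 + u ^+ 3 / 3 - ln (1 + u))
  (fun u => u ^+ 3 / (1 + u)) u u0.
rewrite addr0 ln1 !expr0n /= !mul0r subr0 addr0 subr0; apply.
  move=> y y0; have h1 : 0 < 1 + y by rewrite ltr_pwDl.
  have h3 : 1 + y != 0 by rewrite gt_eqF.
  have hl := is_derive1_ln h1.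
  apply: is_derive_eq.
  rewrite /GRing.scale /=; field; rewrite ?h3 //.
by move=> y y0; rewrite divr_ge0 ?exprn_ge0 // addr_ge0.
Qed.

(** Logarithm of [n! / (sqrt n (n/e)^n)]. Its limit [ln (sqrt (2 pi))] never has to be identified,
    as only differences are compared. *)
Definition stirling n : R := ln (n`!%:R) - (n%:R + 1/2) * ln n%:R + n%:R.

Lemma stirlingB n : (0 < n)%N ->
  stirling n - stirling n.+1 = (n%:R + 1/2) * ln (1 + n%:R^-1) - 1.
Proof.
move=> n0; have n0' : 0 < n%:R :> R by rewrite ltr0n.
have -> : ln (1 + n%:R^-1) = ln n.+1%:R - ln n%:R :> R.
  rewrite -ln_div ?posrE ?ltr0n //; congr ln; rewrite -natr1.
  by rewrite mulrDl divff ?gt_eqF // mul1r.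
rewrite /stirling factS natrM lnM ?posrE ?ltr0n ?fact_gt0 //.
rewrite -[in n.+1%:R + 1/2]natr1 -[in X in _ - (_ + X)]natr1.
ring.
Qed.

Lemma stirlingB_ge0 n : (0 < n)%N -> 0 <= stirling n - stirling n.+1.
Proof.
move=> n0; rewrite stirlingB //; have n0' : 0 < n%:R :> R by rewrite ltr0n.
have := @ln1D_ge n%:R^-1 (ltac:(by rewrite invr_ge0)).
have -> : 2 * n%:R^-1 / (2 + n%:R^-1) = (n%:R + 1/2)^-1 :> R.
  field; do ?[apply/andP; split]; rewrite gt_eqF //; nra.
have n2 : 0 < n%:R + 1/2 :> R by lra.
by move=> h; rewrite subr_ge0 mulrC -ler_pdivrMr // -[leLHS]/(1 * _) mul1r.
Qed.

Lemma ln1D_half_le (v : R) : 0 < v <= 1 ->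
  (v^-1 + 1/2) * ln (1 + v) - 1 <= v - (v^-1 + 1)^-1.
Proof.
move=> /andP[v0 v1]; have v0' : v != 0 by rewrite gt_eqF.
have w0 : 0 < v^-1 by rewrite invr_gt0.
have -> : (v^-1 + 1)^-1 = v / (1 + v).
  by field; rewrite v0' /= gt_eqF // addr_gt0.
have -> : v - v / (1 + v) = v ^+ 2 / (1 + v).
  by field; rewrite gt_eqF // addr_gt0.
apply: (@le_trans _ _ (v ^+ 2 / 2)); last first.
  by rewrite ler_wpM2l ?sqr_ge0 // lef_pV2 ?posrE ?addr_gt0 // lerD2l.
have h := ln1D_le (ltW v0).
have : (v^-1 + 1/2) * ln (1 + v) <= (v^-1 + 1/2) * (v - v ^+ 2 / 2 + v ^+ 3 / 3).
  by rewrite ler_wpM2l // addr_ge0 // ltW.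
have -> : (v^-1 + 1/2) * (v - v ^+ 2 / 2 + v ^+ 3 / 3) = 1 + v ^+ 2 / 12%:R + v ^+ 3 / 6%:R.
  by field.
have : v ^+ 3 <= v ^+ 2 by rewrite exprS ler_piMl ?sqr_ge0.
have := sqr_ge0 v; lra.
Qed.

Lemma stirlingB_le n : (0 < n)%N ->
  stirling n - stirling n.+1 <= n%:R^-1 - n.+1%:R^-1.
Proof.
move=> n0; rewrite stirlingB //.
have := @ln1D_half_le n%:R^-1; rewrite invrK natr1; apply.
by rewrite invr_gt0 ltr0n n0 invf_le1 ?ltr0n // ler1n.
Qed.

Lemma stirlingD_le n k : (0 < n)%N ->
  0 <= stirling n - stirling (n + k) <= n%:R^-1 - (n + k)%:R^-1.
Proof.
move=> n0; elim: k => [|k /andP[h1 h2]]; first by rewrite addn0 !subrr lexx.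
have nk : (0 < n + k)%N by rewrite addn_gt0 n0.
move: h1 h2 (stirlingB_ge0 nk) (stirlingB_le nk); rewrite addnS.
move: (stirling n) (stirling _) (stirling _) n%:R^-1 (n + k)%:R^-1 (n + k).+1%:R^-1.
move=> a b c d e f; lra.
Qed.

(** Decreases to [Gamma(1/2)^2 / (Gamma(1/3) Gamma(2/3)) = sin (pi/3)]; this ratio is what links the
    Hankel entries to the test vector. *)
Definition po_ratio m : R := po (1/3) m * po (2/3) m / po (1/2) m ^+ 2.

Lemma po_ratio_gt0 m : 0 < po_ratio m.
Proof. by rewrite divr_gt0 ?exprn_gt0 ?mulr_gt0 ?po_gt0 ?divr_gt0. Qed.

Lemma po_ratio_ni : {homo po_ratio : m n / (m <= n)%N >-> n <= m}.
Proof.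
apply: (homo_leq (r := fun x y => y <= x)) => [//|y x z h1 h2|m]; first exact: le_trans h1.
rewrite /po_ratio !poE.
have h0 : 0 < po (1/2) m :> R by rewrite po_gt0 // divr_gt0.
have hm : 0 < m.+1%:R :> R by rewrite ltr0n.
have hh : 0 < 1/2 + m%:R :> R by rewrite ltr_pwDl // divr_gt0.
have -> : po (1/3) m * (1/3 + m%:R) / m.+1%:R * (po (2/3) m * (2/3 + m%:R) / m.+1%:R) /
   (po (1/2) m * (1/2 + m%:R) / m.+1%:R) ^+ 2 =
   po (1/3) m * po (2/3) m / po (1/2) m ^+ 2 *
     ((1/3 + m%:R) * (2/3 + m%:R) / (1/2 + m%:R) ^+ 2) :> R.
  field; do ?[apply/andP; split]; rewrite gt_eqF //; nra.
rewrite ler_piMr ?(ltW (po_ratio_gt0 m)) // ler_pdivrMr ?exprn_gt0 // mul1r; nra.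
Qed.

Lemma ln_po_ratio m : (0 < m)%N ->
  ln (po_ratio m) = stirling (3 * m) + stirling m - 2 * stirling (2 * m) + ln (Num.sqrt 3 / 2).
Proof.
move=> m0.
have f0 n : 0 < n`!%:R :> R by rewrite ltr0n fact_gt0.
have m0' : 0 < m%:R :> R by rewrite ltr0n.
have -> : po_ratio m = (3 * m)`!%:R * m`!%:R * 4%:R ^+ m ^+ 2 / (27%:R ^+ m * (2 * m)`!%:R ^+ 2).
  rewrite -po_thirds -po_halves /po_ratio; field.
  by rewrite !gt_eqF ?exprn_gt0 ?ltr0n ?fact_gt0 // po_gt0 // divr_gt0.
have -> : ln (Num.sqrt 3 / 2) = ln (Num.sqrt 3) - ln 2 :> R.
  by rewrite ln_div ?posrE ?sqrtr_gt0.
rewrite ln_div ?posrE ?mulr_gt0 ?exprn_gt0 ?ltr0n ?fact_gt0 //.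
rewrite !lnM ?posrE ?mulr_gt0 ?exprn_gt0 ?ltr0n ?fact_gt0 //.
rewrite !lnXn ?exprn_gt0 ?ltr0n ?fact_gt0 //.
have -> : ln (Num.sqrt 3) = 1/2 * ln 3 :> R.
  have : ln (Num.sqrt 3 ^+ 2) = ln 3 :> R by rewrite sqr_sqrtr.
  rewrite lnXn ?sqrtr_gt0 // => <-; by rewrite -mulr_natl; field.
have -> : (27%:R : R) = 3 ^+ 3 by rewrite -natrX.
have -> : (4%:R : R) = 2 ^+ 2 by rewrite -natrX.
rewrite !lnXn // /stirling !natrM !lnM ?posrE //.
move: (ln (3 * m)`!%:R) (ln m`!%:R) (ln (2 * m)`!%:R) (ln m%:R) (ln 3) (ln 2) => a b c d e f.
have [x hx] : exists x : R, m%:R = x by exists m%:R.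
have xE y : y *+ m = x * y by rewrite -hx mulr_natl.
by rewrite hx !xE; field.
Qed.

(** In [ln_po_ratio] the coefficients 1, 1, -2 of the values of [stirling] add up to 0, so their
    unknown limit cancels. By monotonicity the bound can be checked at a large index, where the
    error is at most [1/n]. *)
Lemma po_ratio_ge m : Num.sqrt 3 / 2 <= po_ratio m.
Proof.
have s0 : 0 < Num.sqrt 3 / 2 :> R by rewrite divr_gt0 // sqrtr_gt0.
rewrite -ler_ln ?posrE ?po_ratio_gt0 //; apply/ler_addgt0Pr => e e0.
pose n := (maxn m.+1 (Num.truncn (e^-1)).+1).
have n0 : (0 < n)%N by rewrite leq_max.
have en : n%:R^-1 <= e.
  rewrite invf_ple ?posrE ?ltr0n //; apply/ltW/(lt_le_trans (truncnS_gt _)).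
  by rewrite ler_nat leq_maxr.
have h1 : po_ratio n <= po_ratio m.
  by apply: po_ratio_ni; apply: ltnW; rewrite /n leq_maxl.
rewrite -(ler_ln (x := po_ratio n)) ?posrE ?po_ratio_gt0 // in h1.
rewrite ln_po_ratio // in h1.
have := @stirlingD_le n n n0; rewrite addnn -mul2n => /andP[h2 _].
have := @stirlingD_le (2 * n)%N n (ltac:(by rewrite muln_gt0)).
have -> : (2 * n + n = 3 * n)%N by lia.
move=> /andP[_ h3].
have h4 : (2 * n)%:R^-1 <= n%:R^-1 :> R.
  by rewrite lef_pV2 ?posrE ?ltr0n ?muln_gt0 // ler_nat; lia.
have h5 : 0 <= (3 * n)%:R^-1 :> R by rewrite invr_ge0.
lra.
Qed.

End Stirling.

(** * Entries of the Hankel matrix *)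

Section Hankel.
Variable R : realType.
Implicit Types (r : R) (c : nat -> R).

Lemma rsum_finite c n : (forall i, (n <= i)%N -> c i = 0) -> rsum c (\sum_(i < n) c i).
Proof.
move=> h e e0; exists n => m nm; rewrite -!(big_mkord xpredT c).
rewrite [X in _ - X](big_cat_nat (n := n)) //= opprD addrA subrr add0r normrN.
rewrite big_nat big1 ?normr0 ?ltW // => i /andP[ni _]; exact: h.
Qed.

Lemma rsum_shiftn c n l : rsum (fun i => c (i + n)%N) l ->
  rsum (fun i => if (i < n)%N then 0 else c i) l.
Proof.
move=> h e e0; have [N hN] := h e e0; exists (N + n)%N => m hm.
have nm : (n <= m)%N by apply: leq_trans hm; rewrite leq_addl.
rewrite -(big_mkord xpredT (fun i => if (i < n)%N then 0 else c i)).
rewrite (big_cat_nat (n := n)) //=.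
have -> : \sum_(0 <= i < n) (if (i < n)%N then 0 else c i) = 0.
  by rewrite big_nat big1 // => i /andP[_ ->].
rewrite add0r.
have -> : \sum_(n <= i < m) (if (i < n)%N then 0 else c i) =
    \sum_(i < m - n) c (i + n)%N.
  rewrite -{1}[n]add0n big_addn big_mkord.
  by apply: eq_bigr => i _; rewrite ltnNge leq_addl.
by apply: hN; rewrite -(leq_add2r n) subnK.
Qed.

Lemma rsum_head c l : rsum c l -> rsum (fun i => c i.+1) (l - c 0%N).
Proof.
move=> h e e0; have [N hN] := h e e0; exists N => n Nn.
have := hN n.+1 (leqW Nn); rewrite big_ord_recl opprD addrA.
by under eq_bigr do rewrite lift0.
Qed.

Lemma exp_sub_le (r1 r r' : R) m : 0 <= r1 < 1 -> 0 <= r <= r1 -> 0 <= r' <= r1 ->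
  `|r ^+ m - r' ^+ m| <= `|r - r'| / (1 - r1).
Proof.
move=> /andP[r10 r11] /andP[r0 rr] /andP[r'0 rr'].
have h : 0 < 1 - r1 by rewrite subr_gt0.
case: m => [|m]; first by rewrite !expr0 subrr normr0 divr_ge0 // ltW.
rewrite subrXX normrM ler_wpM2l // ger0_norm; last first.
  by rewrite sumr_ge0 // => i _; rewrite mulr_ge0 ?exprn_ge0.
apply: (le_trans _ (@geom_sum_le _ r1 m.+1 _)); last by rewrite r10.
rewrite [leRHS](reindex_inj rev_ord_inj) /=; apply: ler_sum => i _.
rewrite -[leRHS]mulr1; apply: ler_pM; rewrite ?exprn_ge0 //.
  by rewrite lerXn2r ?nnegrE.
by rewrite exprn_ile1 // (le_trans rr') // ltW.
Qed.

Lemma po23_ni m j : po (2/3) (m + j) <= po (2/3) m :> R.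
Proof.
elim: j => [|j IH]; first by rewrite addn0.
rewrite addnS poE; apply: le_trans IH.
have h := @po_gt0 R (2/3) (m + j) (ltac:(lra)).
rewrite -mulrA ler_piMr ?(ltW h) // ler_pdivrMr ?ltr0n // mul1r -natr1; lra.
Qed.

(** From [po_ratio <= 1] and [m po(1/2)_m^2 <= 1/2] the sum is at most [(1/2) / (j + 2/3)]. The
    bound is uniform in [m], so the entries are defined up to and including [r = 1]. *)
Lemma bet_gam_le1 m j : \sum_(i < m) po (1/3) i * gam R (i + j).+1 <= 1.
Proof.
rewrite bet_gam_sum ler_pdivrMr; last by rewrite ltr_wpDl // divr_gt0.
have h1 := @po_ratio_ni R 0%N m (leq0n _).
have h2 := po_half_sq_le R m.
have h3 : po_ratio R 0%N = 1 by rewrite /po_ratio !po0 expr1n divr1 mulr1.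
have hb := @po_gt0 R (1/2) m (ltac:(lra)).
have e : po (1/3) m * po (2/3) m = po_ratio R m * po (1/2) m ^+ 2.
  by rewrite /po_ratio divfK // gt_eqF // exprn_gt0.
apply: (@le_trans _ _ (m%:R * po (1/3) m * po (2/3) m)).
  rewrite ler_wpM2l ?po23_ni // mulr_ge0 // ltW // po_gt0 //; lra.
rewrite -mulrA e; apply: (@le_trans _ _ (m%:R * po (1/2) m ^+ 2)).
  rewrite ler_wpM2l // ler_piMl ?sqr_ge0 // -h3 //.
apply: (le_trans h2); have : 0 <= j%:R :> R by []. lra.
Qed.

(** The coefficient of [x^(i+j+1)] in [- (1 - r x)^(1/3)] times that of [x^(-i)] in
    [(1 - r / x)^(-1/3)]; the sign makes all terms positive for [r > 0]. *)
Definition hterm j r i : R := po (1/3) i * gam R (i + j).+1 * r ^+ (2 * i + j).+1.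

(* Entries of the Hankel matrix of the symbol [((1 - r x) / (1 - r / x))^(1/3)]. *)
Definition hk j r : R := xget 0 (rsum (hterm j r)).

Lemma hterm_ge0 j r i : 0 <= r -> 0 <= hterm j r i.
Proof.
move=> r0; rewrite mulr_ge0 ?exprn_ge0 // mulr_ge0 ?ltW ?gam_gt0 // po_gt0 //; lra.
Qed.

Lemma hterm_le j r i : 0 <= r <= 1 ->
  hterm j r i <= r ^+ j.+1 * (po (1/3) i * gam R (i + j).+1).
Proof.
move=> /andP[r0 r1]; rewrite /hterm mulrC ler_wpM2r //.
  rewrite mulr_ge0 ?ltW ?gam_gt0 // po_gt0 //; lra.
by rewrite ler_wiXn2l // ltnS leq_addl.
Qed.

Lemma hterm_sum_le j r n : 0 <= r <= 1 -> \sum_(i < n) hterm j r i <= r ^+ j.+1.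
Proof.
move=> hr; apply: (@le_trans _ _ (\sum_(i < n) r ^+ j.+1 * (po (1/3) i * gam R (i + j).+1))).
  by apply: ler_sum => i _; exact: hterm_le.
by rewrite -mulr_sumr ler_piMr ?bet_gam_le1 // exprn_ge0 //; case/andP: hr.
Qed.

Lemma hkP j r : 0 <= r <= 1 -> rsum (hterm j r) (hk j r).
Proof.
move=> hr; have [l hl] : exists l, rsum (hterm j r) l.
  apply: (@rsum_exists _ _ (hterm j r)); last by exists (r ^+ j.+1) => n; exact: hterm_sum_le.
  by move=> i; rewrite ger0_norm // hterm_ge0 //; case/andP: hr.
exact: (xgetI _ hl).
Qed.

Lemma hk_le j r : 0 <= r <= 1 -> hk j r <= r ^+ j.+1.
Proof. by move=> hr; apply: rsum_le_bound (hkP j hr) => n; exact: hterm_sum_le. Qed.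

Lemma hk_ge_part j r n : 0 <= r <= 1 -> \sum_(i < n) hterm j r i <= hk j r.
Proof.
move=> hr; apply: rsum_ge_part (hkP j hr) => i; apply: hterm_ge0; by case/andP: hr.
Qed.

Lemma hk_ge0 j r : 0 <= r <= 1 -> 0 <= hk j r.
Proof. by move=> hr; have := @hk_ge_part j r 0 hr; rewrite big_ord0. Qed.

Lemma hk_gt0 j r : 0 < r <= 1 -> 0 < hk j r.
Proof.
move=> /andP[r0 r1]; have := @hk_ge_part j r 1 (ltac:(by rewrite ltW)).
rewrite big_ord1; apply: lt_le_trans; rewrite /hterm po0 mul1r.
by rewrite mulr_gt0 ?gam_gt0 ?exprn_gt0.
Qed.

Lemma gam_ni n : gam R n.+2 <= gam R n.+1.
Proof.
have h := @po_gt0 R (2/3) n (ltac:(lra)).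
rewrite !gamS ler_pM ?invr_ge0 //.
- by rewrite mulr_ge0 // ltW // po_gt0 //; lra.
- by rewrite ler_wpM2l //; have := po23_ni n 1; rewrite addn1.
- by rewrite lef_pV2 ?posrE ?ltr0n // ler_nat.
Qed.

Lemma hk_S j r : 0 <= r <= 1 -> hk j.+1 r <= r * hk j r.
Proof.
move=> hr; have /andP[r0 r1] := hr.
apply: (rsum_le _ (hkP _ hr) (rsumZ r (hkP j hr))) => i.
rewrite /hterm addnS (addnS (2 * i)) exprS mulrCA ler_wpM2l // ler_wpM2r ?exprn_ge0 //.
by rewrite ler_wpM2l ?gam_ni // ltW // po_gt0 //; lra.
Qed.

Lemma hk_lip j (r1 r r' : R) : 0 <= r1 < 1 -> 0 <= r <= r1 -> 0 <= r' <= r1 ->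
  `|hk j r - hk j r'| <= `|r - r'| / (1 - r1).
Proof.
move=> h1 h h'; have /andP[r10 r11] := h1.
have hr : 0 <= r <= 1 by case/andP: h => -> /le_trans; apply; exact: ltW.
have hr' : 0 <= r' <= 1 by case/andP: h' => -> /le_trans; apply; exact: ltW.
set d := `|r - r'| / (1 - r1).
have d0 : 0 <= d by rewrite divr_ge0 // subr_ge0 ltW.
have hd := rsumD (hkP j hr) (rsumZ (-1) (hkP j hr')).
have bnd n : `|\sum_(i < n) (hterm j r i + -1 * hterm j r' i)| <= d.
  apply: (le_trans (ler_norm_sum _ _ _)).
  apply: (@le_trans _ _ (\sum_(i < n) d * (po (1/3) i * gam R (i + j).+1))).
    apply: ler_sum => i _.
    have p0 : 0 <= po (1/3) i * gam R (i + j).+1.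
      rewrite mulr_ge0 ?ltW ?gam_gt0 // po_gt0 //; lra.
    rewrite mulN1r -mulrBr normrM (ger0_norm p0) mulrC ler_wpM2r //.
    exact: exp_sub_le.
  by rewrite -mulr_sumr ler_piMr // bet_gam_le1.
rewrite -[- hk j r']mulN1r ler_norml; apply/andP; split.
  by apply: rsum_ge_bound hd => n; have := bnd n; rewrite ler_norml => /andP[].
by apply: rsum_le_bound hd => n; have := bnd n; rewrite ler_norml => /andP[].
Qed.

(* The coefficients of [(1 - x)^(1/3) (1 - x)^(-1/3) = 1]. *)
Lemma gam_po_conv s : \sum_(i < s.+1) gam R i.+1 * po (1/3) (s - i)%N = po (1/3) s.+1.
Proof.
have := conv_po (- (1/3) : R) (1/3) s.+1; rewrite addNr po_0S /conv big_ord_recl po0 mul1r subn0.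
move/eqP; rewrite addr_eq0 => /eqP ->; rewrite -sumrN; apply: eq_bigr => i _.
by rewrite lift0 subSS mulNr.
Qed.

(** Multiplying the symbol by [(1 - r / x)^(1/3)] cancels its second factor and leaves the
    coefficient of [x^(j+1)] in [- (1 - r x)^(1/3)]. The double series is regrouped by total index
    [s], where [gam_po_conv] performs the cancellation. *)
Lemma hk_toeplitz j r : 0 <= r <= 1 ->
  rsum (fun i => gam R i.+1 * r ^+ i.+1 * hk (i + j).+1 r)
       (hk j r - gam R j.+1 * r ^+ j.+1).
Proof.
move=> hr; have /andP[r0 r1] := hr.
pose b (s i : nat) : R := if (s < i)%N then 0 else
  gam R i.+1 * r ^+ i.+1 * hterm (i + j).+1 r (s - i).
have b0 s i : 0 <= b s i.
  rewrite /b; case: ifP => // _; rewrite mulr_ge0 ?hterm_ge0 // mulr_ge0 ?exprn_ge0 //.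
  exact/ltW/gam_gt0.
have bE s : \sum_(i < s.+1) b s i = hterm j r s.+1.
  rewrite /hterm -gam_po_conv !mulr_suml; apply: eq_bigr => i _.
  have hi : (i <= s)%N by rewrite -ltnS.
  rewrite /b ltnNge hi /= /hterm.
  have -> : (s - i + (i + j).+1).+1 = (s.+1 + j).+1 by lia.
  have -> : r ^+ (2 * s.+1 + j).+1 = r ^+ i.+1 * r ^+ (2 * (s - i) + (i + j).+1).+1.
    by rewrite -exprD; congr (_ ^+ _); lia.
  by ring.
apply: (rsum_exchange b0 _ _ (s := fun s => hterm j r s.+1)).
- move=> s; rewrite -bE; apply: rsum_finite => i hi.
  by rewrite /b hi.
- move=> i; apply: (@rsum_shiftn (fun s => gam R i.+1 * r ^+ i.+1 * hterm (i + j).+1 r (s - i))).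
  apply: (eq_rsum _ (rsumZ (gam R i.+1 * r ^+ i.+1) (hkP (i + j).+1 hr))) => s.
  by rewrite addnK.
- have -> : gam R j.+1 * r ^+ j.+1 = hterm j r 0 by rewrite /hterm po0 mul1r.
  exact: rsum_head (hkP j hr).
Qed.

End Hankel.

(** * The quadratic form on the coefficients of [(1 - x)^(-1/2)] *)

Section HankelForm.
Variable R : realType.
Implicit Types (r t : R) (u : nat -> R).

Definition hform N r u : R := \sum_(k < N) \sum_(n < N) hk (k + n) r * u k * u n.

Lemma harmonic_unbounded (A : R) : exists N : nat, A <= \sum_(j < N) j.+1%:R^-1.
Proof.
apply: contrapT => /forallNP h; apply: (@dvg_harmonic R).
apply: nondecreasing_is_cvgn; first by apply: nondecreasing_series => n _ _; rewrite invr_ge0.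
exists A => _ [n _ <-]; rewrite /series /= big_mkord leNgt; apply/negP => hn.
by apply: (h n); exact: ltW.
Qed.

Lemma po23_ge m j : (0 < m)%N -> (1 - j%:R / m%:R) * po (2/3) m <= po (2/3) (m + j) :> R.
Proof.
move=> m0; have m0' : 0 < m%:R :> R by rewrite ltr0n.
have hp n : 0 < po (2/3) n :> R by apply: po_gt0; lra.
elim: j => [|j IH]; first by rewrite mul0r subr0 mul1r addn0.
rewrite addnS poE -mulrA.
set b := m%:R^-1; have b0 : 0 < b by rewrite invr_gt0.
have hb : 1 - b <= (2/3 + (m + j)%:R) / (m + j).+1%:R.
  rewrite ler_pdivlMr ?ltr0n // -natr1 mulrBl mul1r.
  have : 1 <= b * ((m + j)%:R + 1).
    by rewrite mulrC ler_pdivlMr // mul1r natr1 ler_nat -addnS leq_addr.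
  lra.
have hb0 : 0 <= (2/3 + (m + j)%:R) / (m + j).+1%:R :> R by rewrite divr_ge0 // addr_ge0 // divr_ge0.
apply: (@le_trans _ _ ((1 - j%:R * b) * po (2/3) m * ((2/3 + (m + j)%:R) / (m + j).+1%:R))).
  rewrite mulrAC ler_wpM2r ?(ltW (hp _)) //.
  set c := _ / _ in hb hb0 *.
  have c1 : c <= 1.
    by rewrite ler_pdivrMr ?ltr0n // mul1r -natr1; lra.
  have jb : 0 <= j%:R * b by rewrite mulr_ge0 // ltW.
  have := mulr_ge0 jb (ltac:(by rewrite subr_ge0) : 0 <= 1 - c); rewrite -natr1; lra.
by rewrite ler_wpM2r.
Qed.

(** Only the terms [i < m] are kept; there every power of [r] is at least [r^(2m+N)]. The index [m]
    stays free so that the factor [m po(1/2)_m^2] can be matched with the same factor in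
    [po_half_sum]. *)
Lemma hk_ge (r : R) N m j : 0 <= r <= 1 -> (0 < m)%N -> (j < N)%N -> (N <= m)%N ->
  r ^+ (2 * m + N) * (1 - N%:R / m%:R) * (Num.sqrt 3 / 2) *
    (m%:R * po (1/2) m ^+ 2) * j.+1%:R^-1 <= hk j r.
Proof.
move=> hr m0 jN Nm; have /andP[r0 r1] := hr.
have hp s n : 0 < s -> 0 < po s n :> R by exact: po_gt0.
apply: (le_trans _ (hk_ge_part j m hr)).
apply: (@le_trans _ _ (r ^+ (2 * m + N) * \sum_(i < m) po (1/3) i * gam R (i + j).+1)); last first.
  rewrite mulr_sumr; apply: ler_sum => i _; rewrite mulrC /hterm ler_wpM2l //.
    by rewrite mulr_ge0 ?ltW ?gam_gt0 // hp //; lra.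
  rewrite ler_wiXn2l //; have := ltn_ord i; lia.
rewrite bet_gam_sum -!mulrA ler_wpM2l ?exprn_ge0 //.
have x1 : m%:R * (po (1/3) m * po (2/3) m) = po_ratio R m * (m%:R * po (1/2) m ^+ 2).
  by rewrite /po_ratio; field; rewrite gt_eqF // hp.
have x0 : 0 <= m%:R * po (1/2) m ^+ 2 :> R by rewrite mulr_ge0 ?sqr_ge0.
have h1 : 1 - N%:R / m%:R <= 1 - j%:R / m%:R :> R.
  by rewrite lerB // ler_pM2r ?invr_gt0 ?ltr0n // ler_nat ltnW.
have h0 : 0 <= 1 - N%:R / m%:R :> R.
  by rewrite subr_ge0 ler_pdivrMr ?ltr0n // mul1r ler_nat.
have hR := po_ratio_ge R m.
have s0 : 0 <= Num.sqrt 3 / 2 :> R by rewrite divr_ge0.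
rewrite !mulrA; apply: (@le_trans _ _ ((1 - j%:R / m%:R) * (m%:R * (po (1/3) m * po (2/3) m)) * j.+1%:R^-1)).
  rewrite x1; apply: (@le_trans _ _ (((1 - N%:R / m%:R) * (Num.sqrt 3 / 2)) *
      (m%:R * po (1/2) m ^+ 2 * j.+1%:R^-1))).
    by rewrite le_eqVlt; apply/orP; left; apply/eqP; ring.
  apply: (@le_trans _ _ (((1 - j%:R / m%:R) * po_ratio R m) *
      (m%:R * po (1/2) m ^+ 2 * j.+1%:R^-1))).
    apply: ler_wpM2r; first by apply: mulr_ge0; rewrite ?invr_ge0.
    exact: ler_pM.
  by rewrite le_eqVlt; apply/orP; left; apply/eqP; ring.
apply: (@le_trans _ _ ((m%:R * po (1/3) m * po (2/3) (m + j)) * j.+1%:R^-1)).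
  rewrite ler_wpM2r ?invr_ge0 //.
  have := po23_ge j m0; have : 0 <= m%:R * po (1/3) m :> R.
    by rewrite mulr_ge0 // ltW // hp //; lra.
  move: (po (2/3) m) (po (2/3) (m + j)) => a b; nra.
rewrite ler_wpM2l //.
  rewrite mulr_ge0 // ?mulr_ge0 // ltW // hp //; lra.
have j0 : 0 < j%:R + 2/3 :> R by rewrite ltr_wpDl // divr_gt0.
by rewrite lef_pV2 ?posrE ?ltr0n // -natr1; lra.
Qed.

(** The square of indices contains the triangle [k + n < N], and along each antidiagonal the
    products of test coefficients add up to 1, because [(1 - x)^(-1/2)] squared is the geometric
    series. *)
Lemma hform_po_half N r : 0 <= r <= 1 -> \sum_(j < N) hk j r <= hform N r (po (1/2)).
Proof.
move=> hr; have hp n : 0 <= po (1/2) n :> R by apply/ltW/po_gt0; lra.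
pose f k n := hk (k + n) r * po (1/2) k * po (1/2) n.
have f0 k n : 0 <= f k n by rewrite !mulr_ge0 ?hk_ge0.
have -> : \sum_(j < N) hk j r = \sum_(j < N) \sum_(i < j.+1) f i (j - i)%N.
  apply: eq_bigr => j _.
  have -> : \sum_(i < j.+1) f i (j - i)%N = hk j r * conv (po (1/2)) (po (1/2)) j.
    rewrite /conv mulr_sumr; apply: eq_bigr => i _.
    by rewrite /f subnKC -1?ltnS // mulrA.
  by rewrite conv_po (_ : 1/2 + 1/2 = 1) ?po_1 ?mulr1 //; field.
rewrite triangle_sum; apply: ler_sum => k _.
rewrite -!(big_mkord xpredT (f k)) [leRHS](big_cat_nat (n := (N - k)%N)) ?leq_subr //=.
by rewrite lerDl sumr_ge0.
Qed.

(** Monotonicity of [n po_n^2] gives [po_n^2 <= m po_m^2 / n]; the term [n = 0] is the isolated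
    1. *)
Lemma po_half_sum N m : (N <= m)%N ->
  \sum_(n < N) po (1/2) n ^+ 2 <= 1 + m%:R * po (1/2) m ^+ 2 * \sum_(n < N) n.+1%:R^-1 :> R.
Proof.
case: N => [|N] Nm; first by rewrite !big_ord0 mulr0 addr0.
rewrite big_ord_recl po0 expr1n lerD2l mulr_sumr [leRHS]big_ord_recr /=.
rewrite -[leLHS]addr0; apply: lerD; last by rewrite mulr_ge0 ?invr_ge0 // mulr_ge0 ?sqr_ge0.
apply: ler_sum => i _; rewrite ler_pdivlMr ?ltr0n // mulrC.
apply: (@po_half_sq_nd R i.+1 m); apply: leq_trans Nm; exact: (leqW (ltn_ord i)).
Qed.

Lemma hform_large t : 0 < t -> t < Num.sqrt 3 / 2 -> exists r, exists N,
  [/\ 0 < r < 1, (0 < N)%N & t * \sum_(n < N) po (1/2) n ^+ 2 <= hform N r (po (1/2))].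
Proof.
move=> t0; set s : R := Num.sqrt 3 / 2 => ts.
have s0 : 0 < s by exact: lt_trans ts.
have st0 : 0 < s - t by rewrite subr_gt0.
(* The harmonic sum has to absorb the isolated 1 in the norm of the test vector: as
   [m po_m^2 >= 1/4], this size yields [2 t <= (s - t) x H] below. *)
have [N0 hN0] := harmonic_unbounded (8 * t / (s - t)).
pose N := N0.+1; set H : R := \sum_(j < N) j.+1%:R^-1.
have hN : 8 * t / (s - t) <= H.
  by apply: (le_trans hN0); rewrite /H big_ord_recr lerDl invr_ge0.
have H0 : 0 < H by apply: lt_le_trans hN; rewrite divr_gt0 // mulr_gt0.
(* Two factors [1 - eta] are lost, one to [r^M] and one to [1 - N/m]; since [eta s = (s - t) / 4],
   at least [(s + t) / 2] of [s] survives. *)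
pose eta := (s - t) / (4 * s).
have eta0 : 0 < eta by rewrite divr_gt0 // mulr_gt0.
have eta1 : eta < 1 by rewrite /eta ltr_pdivrMr ?mulr_gt0 //; lra.
pose m := maxn N (Num.truncn (N%:R / eta)).+1.
have Nm : (N <= m)%N by exact: leq_maxl.
have m0 : (0 < m)%N by apply: leq_trans Nm.
have m0' : 0 < m%:R :> R by rewrite ltr0n.
have hm : N%:R / m%:R <= eta :> R.
  rewrite ler_pdivrMr // mulrC -ler_pdivrMr //; apply: ltW.
  by apply: (lt_le_trans (truncnS_gt _)); rewrite ler_nat leq_maxr.
pose M := (2 * m + N)%N.
have M0 : 1 <= M%:R :> R by rewrite ler1n (leq_trans m0) // (leq_trans _ (leq_addr _ _)) // leq_pmull.
pose r := 1 - eta / M%:R.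
have hr0 : 0 < eta / M%:R by rewrite divr_gt0 //; lra.
have hr1 : eta / M%:R < 1 by rewrite ltr_pdivrMr ?mul1r; lra.
have hr : 0 < r < 1 by rewrite /r; lra.
have hrM : 1 - eta <= r ^+ M.
  have bern k : 1 - k%:R * (eta / M%:R) <= r ^+ k.
    elim: k => [|k IH]; first by rewrite mul0r subr0 expr0.
    have : 0 <= k%:R * (eta / M%:R) by rewrite mulr_ge0 // ltW.
    move=> h; rewrite exprS -natr1; apply: (@le_trans _ _ (r * (1 - k%:R * (eta / M%:R)))).
      rewrite /r; nra.
    by rewrite ler_wpM2l // /r; lra.
  by have := bern M; rewrite mulrCA divff ?mulr1 // gt_eqF //; lra.
exists r, N; split=> //.
set x : R := m%:R * po (1/2) m ^+ 2.
have x4 : 1/4 <= x.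
  have := @po_half_sq_nd R 1%N m m0; rewrite -/x poE po0 mul1r; lra.
have hr' : 0 <= r <= 1 by lra.
apply: (le_trans _ (hform_po_half N hr')).
apply: (@le_trans _ _ (r ^+ M * (1 - N%:R / m%:R) * s * x * H)); last first.
  rewrite /H mulr_sumr; apply: ler_sum => j _; exact: hk_ge.
apply: (@le_trans _ _ (t * (1 + x * H))).
  by apply: ler_wpM2l; [exact: ltW|exact: po_half_sum].
have h1 : (1 - eta) * (1 - eta) <= r ^+ M * (1 - N%:R / m%:R).
  by apply: ler_pM => //; lra.
have h2 : (s + t) / 2 <= (1 - eta) * (1 - eta) * s.
  have e1 : eta * s = (s - t) / 4 by rewrite /eta; field; rewrite gt_eqF.
  have : 0 <= eta * (eta * s) by apply: mulr_ge0; [|apply: mulr_ge0]; exact: ltW.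
  nra.
have xH : 0 < x * H by rewrite mulr_gt0 //; lra.
have h3 : 2 * t <= (s - t) * (x * H).
  have : 8 * t <= (s - t) * H by move: hN; rewrite ler_pdivrMr // [H * _]mulrC.
  move=> h; have := ler_wpM2l (ltac:(lra) : 0 <= x) h; have := ler_wpM2r (ltW t0) x4; lra.
have h4 : (s + t) / 2 * (x * H) <= r ^+ M * (1 - N%:R / m%:R) * s * (x * H).
  rewrite ler_wpM2r ?(ltW xH) //; apply: (le_trans h2); rewrite ler_wpM2r // ltW //.
rewrite -[_ * x * H]mulrA; nra.
Qed.

End HankelForm.

(** * Existence of the least parameter *)

Section Extremal.
Variable R : realType.
Implicit Types (r t : R) (u : nat -> R).
Variables (t r1 : R).
Hypotheses (t0 : 0 < t) (r10 : 0 <= r1) (r11 : r1 < 1).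

(** Since the entries are at most [r1^(k+n)], this bounds the part of the form outside the [N] by
    [N] square for vectors with entries in [[-1, 1]]. *)
Definition htail N : R := 2 * r1 ^+ N / (1 - r1) ^+ 2.

Lemma geom_tail_le m n : \sum_(m <= i < n) r1 ^+ i <= r1 ^+ m / (1 - r1).
Proof.
rewrite -{1}[m]add0n big_addn big_mkord.
under eq_bigr do rewrite addnC exprD.
rewrite -mulr_sumr ler_wpM2l ?exprn_ge0 // geom_sum_le //.
by rewrite r10.
Qed.

Lemma hform_tail r N N' u : 0 <= r <= r1 -> (forall k, `|u k| <= 1) -> (N <= N')%N ->
  `|hform N' r u - hform N r u| <= htail N.
Proof.
move=> /andP[r0 rr] hu NN.
have hr : 0 <= r <= 1 by rewrite r0 (le_trans rr) // ltW.
pose f k n := hk (k + n) r * u k * u n.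
have hf k n : `|f k n| <= r1 ^+ k * r1 ^+ n.
  rewrite /f !normrM -exprD ger0_norm ?hk_ge0 //.
  apply: (@le_trans _ _ (hk (k + n) r)).
    rewrite -mulrA ler_piMr ?hk_ge0 //; apply: mulr_ile1 => //.
  apply: (le_trans (hk_le _ hr)); apply: (@le_trans _ _ (r ^+ (k + n))).
    by rewrite exprS ler_piMl ?exprn_ge0 //; case/andP: hr.
  by rewrite lerXn2r ?nnegrE.
have h1 : 0 < 1 - r1 by rewrite subr_gt0.
have bnd a b c d : \sum_(a <= k < b) \sum_(c <= n < d) `|f k n| <=
    r1 ^+ a / (1 - r1) * (r1 ^+ c / (1 - r1)).
  apply: (@le_trans _ _ ((\sum_(a <= k < b) r1 ^+ k) * (\sum_(c <= n < d) r1 ^+ n))).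
    rewrite mulr_suml; apply: ler_sum => k _; rewrite mulr_sumr.
    by apply: ler_sum => n _.
  apply: ler_pM; rewrite ?geom_tail_le // sumr_ge0 // => i _; exact: exprn_ge0.
have e : hform N' r u - hform N r u =
   \sum_(0 <= k < N') \sum_(N <= n < N') f k n + \sum_(N <= k < N') \sum_(0 <= n < N) f k n.
  have -> : hform N' r u = \sum_(0 <= k < N') \sum_(0 <= n < N') f k n.
    by rewrite big_mkord; apply: eq_bigr => k _; rewrite big_mkord.
  have -> : hform N r u = \sum_(0 <= k < N) \sum_(0 <= n < N) f k n.
    by rewrite big_mkord; apply: eq_bigr => k _; rewrite big_mkord.
  have -> : \sum_(0 <= k < N') \sum_(0 <= n < N') f k n =
     \sum_(0 <= k < N') \sum_(N <= n < N') f k n + \sum_(0 <= k < N') \sum_(0 <= n < N) f k n.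
    rewrite -big_split /=; apply: eq_bigr => k _.
    by rewrite (big_cat_nat (n := N)) //= addrC.
  rewrite -addrA; congr (_ + _); rewrite (big_cat_nat (n := N)) //= addrAC subrr add0r //.
rewrite e; apply: (le_trans (ler_normD _ _)).
have nn a b c d : `|\sum_(a <= k < b) \sum_(c <= n < d) f k n| <=
    \sum_(a <= k < b) \sum_(c <= n < d) `|f k n|.
  apply: (le_trans (ler_norm_sum _ _ _)); apply: ler_sum => k _; exact: ler_norm_sum.
apply: (le_trans (lerD (nn _ _ _ _) (nn _ _ _ _))).
apply: (le_trans (lerD (bnd _ _ _ _) (bnd _ _ _ _))).
by rewrite expr0 /htail le_eqVlt; apply/orP; left; apply/eqP; field; rewrite gt_eqF.
Qed.

Lemma htail_small (e : R) : 0 < e -> exists N0, forall N, (N0 <= N)%N -> htail N <= e.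
Proof.
move=> e0; have h1 : 0 < 1 - r1 by rewrite subr_gt0.
have c0 : 0 < e * (1 - r1) ^+ 2 / 2 by rewrite !mulr_gt0 ?exprn_gt0.
have /cvgrPdist_le/(_ _ c0)[N0 _ hN] : (fun n => r1 ^+ n) @ \oo --> (0 : R).
  by apply: cvg_expr; rewrite ger0_norm.
exists N0 => N hh; have := hN N hh; rewrite sub0r normrN ger0_norm ?exprn_ge0 // => h.
rewrite /htail ler_pdivrMr ?exprn_gt0 //; lra.
Qed.

(** States that the infinite form is at least [t], but through truncations with the tail as slack:
    each condition involves finitely many coordinates, hence is closed in the product topology, in
    which the unit ball is compact. *)
Definition feasible r u := [/\ 0 <= r <= r1, forall k, `|u k| <= 1,
  forall N, \sum_(k < N) u k ^+ 2 <= 1 & forall N, t - htail N <= hform N r u].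

Definition clamp r : R := Num.max 0 (Num.min r r1).

Lemma clampP r : 0 <= clamp r <= r1.
Proof. by rewrite /clamp le_max lexx ge_max r10 ge_min lexx orbT. Qed.

Lemma clamp_id r : 0 <= r <= r1 -> clamp r = r.
Proof. by move=> /andP[h1 h2]; rewrite /clamp min_l // max_r. Qed.

Lemma clamp_continuous : continuous clamp.
Proof.
move=> x; rewrite /clamp; apply: (@continuous_max _ _ (fun=> 0) (fun r => Num.min r r1)).
  exact: cvg_cst.
by apply: (@continuous_min _ _ id (fun=> r1)); [exact: cvg_id|exact: cvg_cst].
Qed.

Lemma hk_clamp_continuous j : continuous (fun r => hk j (clamp r)).
Proof.
move=> x; apply/cvgrPdist_le => e e0.
have h1 : 0 < 1 - r1 by rewrite subr_gt0.
have d0 : 0 < e * (1 - r1) by rewrite mulr_gt0.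
have /cvgrPdist_le/(_ _ d0) := @clamp_continuous x.
apply: filterS => y hy.
apply: (le_trans (hk_lip j _ (clampP x) (clampP y))); first by rewrite r10.
by rewrite ler_pdivrMr.
Qed.

Lemma continuous_bigsum (T : topologicalType) n (f : nat -> T -> R) :
  (forall i, continuous (f i)) -> continuous (fun x => \sum_(i < n) f i x).
Proof.
move=> h; elim: n => [|n IH] x.
  by under [fun _ => _]funext do rewrite big_ord0; exact: cvg_cst.
under [fun _ => _]funext do rewrite big_ord_recr /=.
apply: (@continuousD _ _ _ (fun x => \sum_(i < n) f i x) (f n)); [exact: IH|exact: h].
Qed.

(** The parameter is packed with the vector as coordinate 0 of one point in a product of segments.
    Tychonoff's theorem makes the feasible set compact, and coordinate 0 is continuous on it. *)
Lemma feasible_min : (exists r u, feasible r u) ->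
  exists r u, feasible r u /\ forall r' u', feasible r' u' -> r <= r'.
Proof.
move=> [ri [ui hi]].
pose T : topologicalType := prod_topology (fun _ : nat => R).
pose box : set T := [set p | forall i, (if i is 0%N then `[0, r1]%classic else `[-1, 1]%classic : set R) (p i)].
have cbox : compact box.
  apply: (@tychonoff nat (fun _ => R)
    (fun i => if i is 0%N then `[0, r1]%classic else `[-1, 1]%classic)).
  by case=> [|i]; exact: segment_compact.
have pc i : continuous (fun p : T => p i : R).
  by move=> p; exact: (@proj_continuous nat (fun _ => R) i p).
have hkc j : continuous (fun p : T => hk j (clamp (p 0%N))).
  move=> p; apply: (@continuous_comp T R R (fun p => p 0%N) (fun r => hk j (clamp r))).
    exact: pc.
  exact: hk_clamp_continuous.
pose form N (p : T) := hform N (clamp (p 0%N)) (fun k => p k.+1).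
have fc N : continuous (form N).
  apply: (@continuous_bigsum T N (fun k p => \sum_(n < N) hk (k + n) (clamp (p 0%N)) * p k.+1 * p n.+1)) => k.
  apply: (@continuous_bigsum T N (fun n p => hk (k + n) (clamp (p 0%N)) * p k.+1 * p n.+1)) => n p.
  apply: (@continuousM _ T (fun p => hk (k + n) (clamp (p 0%N)) * p k.+1) (fun p => p n.+1)).
    apply: (@continuousM _ T (fun p => hk (k + n) (clamp (p 0%N))) (fun p => p k.+1)).
      exact: hkc.
    exact: pc.
  exact: pc.
have sc N : continuous (fun p : T => \sum_(k < N) p k.+1 ^+ 2).
  apply: (@continuous_bigsum T N (fun k p => p k.+1 ^+ 2)) => k p.
  by apply: (@continuousM _ T (fun p => p k.+1) (fun p => p k.+1)); exact: pc.
pose S1 : set T := \bigcap_(N in setT) ((fun p => \sum_(k < N) p k.+1 ^+ 2) @^-1` [set x | x <= 1]).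
pose S2 : set T := \bigcap_(N in setT) (form N @^-1` [set x | t - htail N <= x]).
have cS : compact (box `&` (S1 `&` S2)).
  apply: compact_closedI => //; apply: closedI; apply: closed_bigI => N _.
    by apply: preimage_closed; [move=> p _; exact: sc|exact: closed_le].
  by apply: preimage_closed; [move=> p _; exact: fc|exact: closed_ge].
have toS r u : feasible r u -> (box `&` (S1 `&` S2)) (fun i => if i is k.+1 then u k else r).
  move=> [hr hu hs hf]; split; last split.
  - move=> [|i] /=; rewrite in_itv //=; have := hu i; rewrite ler_norml //.
  - by move=> N _; exact: hs.
  - by move=> N _; rewrite /= /form /= clamp_id //; exact: hf.
have ofS p : (box `&` (S1 `&` S2)) p -> feasible (p 0%N) (fun k => p k.+1).
  move=> [hb [h1 h2]]; have hr : 0 <= p 0%N <= r1 by have := hb 0%N; rewrite /= in_itv.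
  split=> //.
  - by move=> k; have := hb k.+1; rewrite /= in_itv /= ler_norml.
  - by move=> N; exact: (h1 N I).
  - by move=> N; have := h2 N I; rewrite /= /form clamp_id.
have [p /set_mem hp hmin] := @compact_EVT_min T R (fun p => p 0%N) _
   (ex_intro _ _ (toS _ _ hi)) cS (continuous_subspaceT (pc 0%N)).
exists (p 0%N), (fun k => p k.+1); split; first exact: ofS.
by move=> r' u' /toS h; have := hmin _ (mem_set h).
Qed.

End Extremal.

(** * The extremal vector is an eigenvector *)

Section Eigenvector.
Variable R : realType.
Implicit Types (r : R) (u v w : nat -> R).
Variables (t r1 : R).
Hypotheses (t0 : 0 < t) (r10 : 0 <= r1) (r11 : r1 < 1).

Local Notation htail := (htail r1).
Local Notation feasible := (feasible t r1).

Lemma htail_ge0 N : 0 <= htail N.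
Proof. by apply: divr_ge0; [rewrite mulr_ge0 ?exprn_ge0|exact: sqr_ge0]. Qed.

Lemma unit_range r : 0 <= r <= r1 -> 0 <= r <= 1.
Proof. by move=> /andP[-> h]; rewrite (le_trans h) // ltW. Qed.

Lemma sum_cst (N : nat) (x : R) : \sum_(k < N) x = N%:R * x.
Proof. by rewrite sumr_const card_ord mulr_natl. Qed.

Lemma hform_lip N r r' u : 0 <= r <= r1 -> 0 <= r' <= r1 -> (forall k, `|u k| <= 1) ->
  `|hform N r u - hform N r' u| <= N%:R ^+ 2 * (`|r - r'| / (1 - r1)).
Proof.
move=> hr hr' hu; rewrite /hform -sumrB; apply: (le_trans (ler_norm_sum _ _ _)).
apply: (@le_trans _ _ (\sum_(k < N) N%:R * (`|r - r'| / (1 - r1)))); last first.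
  by rewrite sum_cst expr2 -mulrA.
apply: ler_sum => k _; rewrite -sumrB; apply: (le_trans (ler_norm_sum _ _ _)).
apply: (@le_trans _ _ (\sum_(n < N) (`|r - r'| / (1 - r1)))); last first.
  by rewrite sum_cst.
apply: ler_sum => n _; rewrite -!mulrA -mulrBl normrM.
have h := @hk_lip R (k + n) r1 r r' (ltac:(by rewrite r10)) hr hr'.
apply: (le_trans _ h); rewrite ler_piMr // normrM; exact: mulr_ile1.
Qed.

Lemma feasible_from_large r w N : 0 <= r <= r1 -> (forall k, `|w k| <= 1) ->
  (forall N, \sum_(k < N) w k ^+ 2 <= 1) -> t + htail N <= hform N r w -> feasible r w.
Proof.
move=> hr hw hs hN; split=> // N'.
have h0 := htail_ge0 N; have h0' := htail_ge0 N'.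
case: (leqP N N') => hNN.
  by have := hform_tail r10 r11 hr hw hNN; rewrite ler_norml => /andP[]; lra.
by have := hform_tail r10 r11 hr hw (ltnW hNN); rewrite ler_norml => /andP[]; lra.
Qed.

Lemma hk_at0 j : hk j (0 : R) = 0.
Proof.
apply/eqP; rewrite eq_le hk_ge0 ?lexx ?ler01 // andbT.
by have := @hk_le R j 0; rewrite lexx ler01 exprS mul0r; apply.
Qed.

Variables (r : R) (u0 : nat -> R).
Hypothesis hfeas : feasible r u0.
Hypothesis hmin : forall r' u', feasible r' u' -> r <= r'.

Let hr : 0 <= r <= r1. Proof. by case: hfeas. Qed.

Lemma extremal_gt0 : 0 < r.
Proof.
have [/andP[h _] _ _ hf] := hfeas.
rewrite lt0r h andbT; apply/eqP => r0.
have t2 : 0 < t / 2 by rewrite divr_gt0.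
have [N hN] := htail_small r10 r11 t2.
have := hf N; rewrite r0 /hform.
under eq_bigr do under eq_bigr do rewrite hk_at0 !mul0r.
rewrite !big1 ?sumr_const ?mul0rn //; have := hN N (leqnn _); lra.
Qed.

(** A strict excess over [t + htail N] would survive a small decrease of [r], as the truncated form
    is Lipschitz in [r], and so produce a feasible pair with a smaller parameter. Monotonicity in
    [r] does not enter. *)
Lemma extremal_le w N : (forall k, `|w k| <= 1) ->
  (forall N, \sum_(k < N) w k ^+ 2 <= 1) -> hform N r w <= t + htail N.
Proof.
move=> hw hs; rewrite leNgt; apply/negP => hlt.
have r0 := extremal_gt0; have /andP[_ rr] := hr.
have h1 : 0 < 1 - r1 by rewrite subr_gt0.
pose d := hform N r w - (t + htail N).
have d0 : 0 < d by rewrite subr_gt0.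
have n0 : 0 < N%:R ^+ 2 + 1 :> R by rewrite ltr_wpDl ?sqr_ge0.
pose e := Num.min r (d * (1 - r1) / (N%:R ^+ 2 + 1)).
have e0 : 0 < e by rewrite /e lt_min r0 divr_gt0 ?mulr_gt0.
have er : e <= r by rewrite /e ge_min lexx.
have ed : e * (N%:R ^+ 2 + 1) <= d * (1 - r1).
  by rewrite -ler_pdivlMr // /e ge_min lexx orbT.
have hr' : 0 <= r - e <= r1 by rewrite subr_ge0 er /=; lra.
have hf : feasible (r - e) w.
  apply: (feasible_from_large (N := N)) => //.
  have := hform_lip N hr hr' hw.
  have -> : r - (r - e) = e by ring.
  rewrite (gtr0_norm e0) => hl.
  have : N%:R ^+ 2 * (e / (1 - r1)) <= d.
    rewrite mulrA ler_pdivrMr //; apply: (le_trans _ ed); lra.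
  move: hl; rewrite ler_norml /d => /andP[]; lra.
have := hmin hf; lra.
Qed.

Lemma extremal_scaled v N (M : R) : 0 < M -> (forall N, \sum_(k < N) v k ^+ 2 <= M) ->
  hform N r v <= M * (t + htail N).
Proof.
move=> M0 hs; pose q := (Num.sqrt M)^-1.
have s0 : 0 < Num.sqrt M by rewrite sqrtr_gt0.
have qq : q ^+ 2 * M = 1.
  by rewrite /q exprVn sqr_sqrtr ?ltW // mulVf // gt_eqF.
pose w k := q * v k.
have hw2 n : \sum_(k < n) w k ^+ 2 <= 1.
  under eq_bigr do rewrite /w exprMn.
  by rewrite -mulr_sumr -qq ler_wpM2l ?sqr_ge0.
have hw k : `|w k| <= 1.
  have : w k ^+ 2 <= 1.
    by apply: le_trans (hw2 k.+1); rewrite big_ord_recr lerDr sumr_ge0 // => i _; exact: sqr_ge0.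
  by rewrite -sqrtr_sqr -(ler_sqrt _ ler01) sqrtr1.
have := extremal_le N hw hw2.
have -> : hform N r w = q ^+ 2 * hform N r v.
  rewrite /hform mulr_sumr; apply: eq_bigr => k _; rewrite mulr_sumr.
  by apply: eq_bigr => n _; rewrite /w; ring.
move=> h; have := ler_wpM2l (ltW M0) h.
by rewrite (_ : M * (q ^+ 2 * hform N r v) = hform N r v) // mulrA [M * q ^+ 2]mulrC qq mul1r.
Qed.

Lemma sum_delta (F : nat -> R) N k (s : R) : (k < N)%N ->
  \sum_(i < N) F i * (if i == k :> nat then s else 0) = F k * s.
Proof.
move=> kN; rewrite (bigD1 (Ordinal kN)) //= eqxx big1 ?addr0 // => i hi.
by rewrite ifF ?mulr0 //; apply/negbTE; apply: contra hi => /eqP e; apply/eqP/val_inj.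
Qed.

Lemma hform_perturb N u k s : (k < N)%N ->
  hform N r (fun j => u j + (if j == k then s else 0)) =
  hform N r u + 2 * s * (\sum_(n < N) hk (k + n) r * u n) + s ^+ 2 * hk (k + k) r.
Proof.
move=> kN; rewrite /hform.
have e i : \sum_(n < N) hk (i + n) r * (u i + (if i == k then s else 0)) *
      (u n + (if n == k :> nat then s else 0)) =
    \sum_(n < N) hk (i + n) r * u i * u n + hk (i + k) r * s * u i +
    (\sum_(n < N) hk (i + n) r * u n + hk (i + k) r * s) * (if i == k then s else 0).
  under eq_bigr do rewrite mulrDr.
  rewrite big_split /= (sum_delta (fun n => hk (i + n) r * (u i + (if i == k then s else 0)))) //.
  have -> : \sum_(n < N) hk (i + n) r * (u i + (if i == k then s else 0)) * u n =
    \sum_(n < N) hk (i + n) r * u i * u n +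
    (\sum_(n < N) hk (i + n) r * u n) * (if i == k then s else 0).
    rewrite mulr_suml -big_split /=; apply: eq_bigr => n _; ring.
  move: (\sum_(n < N) hk (i + n) r * u i * u n) (\sum_(n < N) hk (i + n) r * u n) (hk _ _) => A B C.
  case: ifP => _; ring.
under eq_bigr do rewrite e.
rewrite big_split /= (sum_delta (fun i => \sum_(n < N) hk (i + n) r * u n + hk (i + k) r * s)) //.
rewrite big_split /=.
have -> : \sum_(i < N) hk (i + k) r * s * u i = s * \sum_(n < N) hk (k + n) r * u n.
  by rewrite mulr_sumr; apply: eq_bigr => i _; rewrite addnC; ring.
ring.
Qed.

(** The matrix has nonnegative entries, so absolute values do not lower the form; positivity of the
    eigenvector starts here. *)
Let u k := `|u0 k|.

Lemma abs_feasible : feasible r u.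
Proof.
have [h1 h2 h3 h4] := hfeas; split=> //.
- by move=> k; rewrite normr_id.
- by move=> N; under eq_bigr do rewrite real_normK ?num_real //.
- move=> N; apply: (le_trans (h4 N)); apply: ler_sum => k _; apply: ler_sum => n _.
  have h := hk_ge0 (k + n) (unit_range hr).
  rewrite -!mulrA ler_wpM2l // /u -normrM ler_norm //.
Qed.

Lemma hk_row_exists k v : (forall n, `|v n| <= 1) ->
  exists l, rsum (fun n => hk (k + n) r * v n) l.
Proof.
move=> hv; have /andP[r0 rr] := hr.
apply: (@rsum_exists _ _ (fun n => r ^+ n)); last first.
  by apply: bdd_geom; rewrite r0 (le_lt_trans rr).
move=> n; rewrite normrM ger0_norm ?hk_ge0 ?unit_range //.
apply: (@le_trans _ _ (hk (k + n) r)); first by rewrite ler_piMr // hk_ge0 ?unit_range.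
apply: (le_trans (hk_le _ (unit_range hr))).
by rewrite ler_wiXn2l ?leqW ?leq_addl //; case/andP: (unit_range hr).
Qed.

(** First variation in a single coordinate: the perturbed vector still satisfies the extremal
    inequality, and the linear term in [s] must vanish because [s] may have either sign. *)
Lemma extremal_eigen k : rsum (fun n => hk (k + n) r * u n) (t * u k).
Proof.
have [_ hu hs hf] := abs_feasible.
have [l hl] := hk_row_exists k hu.
suff : l = t * u k by move=> <-.
have uk0 : 0 <= u k by exact: normr_ge0.
have uk1 : u k <= 1 by have := hu k; rewrite /u normr_id.
(* Compares the form at [u + s e_k], at most [t (1 + 2 s u_k + s^2)], with the form at [u], at least
   [t], both up to a tail. The range of [s] keeps the bound [1 + 2 s u_k + s^2] on the squared norm
   positive. *)
have key s : `|s| <= 1/4 -> 2 * s * (l - t * u k) <= s ^+ 2 * t.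
  move=> s4; apply/ler_addgt0Pr => e e0; have e4 : 0 < e / 6 by rewrite divr_gt0.
  have [N1 hN1] := hl _ e4; have [N2 hN2] := htail_small r10 r11 e4.
  pose N := maxn k.+1 (maxn N1 N2).
  have kN : (k < N)%N by rewrite /N leq_max leqnn.
  have hL := hN1 N (ltac:(by rewrite /N !leq_max leqnn orbT)).
  have hT := hN2 N (ltac:(by rewrite /N !leq_max leqnn !orbT)).
  have M0 : 0 < 1 + 2 * s * u k + s ^+ 2.
    move: s4; rewrite ler_norml => /andP[sl sr].
    have : - (1/4) <= s * u k by nra.
    have := sqr_ge0 s; lra.
  have hs' n : \sum_(j < n) (u j + (if j == k :> nat then s else 0)) ^+ 2 <=
      1 + 2 * s * u k + s ^+ 2.
    have e1 : \sum_(j < n) (u j + (if j == k :> nat then s else 0)) ^+ 2 =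
       \sum_(j < n) u j ^+ 2 + \sum_(j < n) (2 * u j + s) * (if j == k :> nat then s else 0).
      by rewrite -big_split /=; apply: eq_bigr => j _; case: ifP => _; ring.
    case: (ltnP k n) => hkn.
      by rewrite e1 (sum_delta (fun j => 2 * u j + s)) //; have := hs n; lra.
    have e2 : \sum_(j < n) (u j + (if j == k :> nat then s else 0)) ^+ 2 = \sum_(j < n) u j ^+ 2.
      apply: eq_bigr => j _; rewrite ifF ?addr0 //.
      by apply/negbTE; rewrite neq_ltn (leq_trans (ltn_ord j)).
    have h3 : \sum_(j < n) u j ^+ 2 + u k ^+ 2 <= 1.
      apply: le_trans (hs k.+1); rewrite big_ord_recr /= lerD2r.
      rewrite -!(big_mkord xpredT (fun j => u j ^+ 2)) [leRHS](big_cat_nat (n := n)) //=.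
      by rewrite lerDl sumr_ge0 // => i _; exact: sqr_ge0.
    rewrite e2; have := sqr_ge0 (u k + s); nra.
  have := @extremal_scaled (fun j => u j + (if j == k then s else 0)) N _ M0 hs'.
  rewrite hform_perturb //.
  have := hf N; have hh := hk_ge0 (k + k) (unit_range hr).
  have ss : 0 <= s ^+ 2 by exact: sqr_ge0.
  have sh : 0 <= s ^+ 2 * hk (k + k) r by exact: mulr_ge0.
  move: hL; move: (\sum_(n < N) _) (hform N r u) => L Q.
  rewrite ler_norml => /andP[hL1 hL2] h1 h2.
  have hT0 := htail_ge0 N.
  move: s4; rewrite ler_norml => /andP[sl sr].
  have sL : `|2 * s * (l - L)| <= 1/2 * (e / 6).
    rewrite normrM; apply: ler_pM; rewrite ?normr_ge0 // ?ler_norml; lra.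
  have M2 : (1 + 2 * s * u k + s ^+ 2) * htail N <= 2 * (e / 6).
    apply: ler_pM => //; first exact: ltW.
    have : s * u k <= 1/4 by nra.
    nra.
  move: sL; rewrite ler_norml => /andP[sL1 sL2]; lra.
set a := l - t * u k in key.
suff : a = 0 by move=> /eqP; rewrite subr_eq0 => /eqP.
apply/eqP; rewrite eq_le; apply/andP; split.
  apply/ler_addgt0Pr => e e0; rewrite add0r.
  pose s := Num.min (1/4) (e / t).
  have s0 : 0 < s by rewrite /s lt_min; apply/andP; split; [lra|exact: divr_gt0].
  have st : s * t <= e by rewrite -ler_pdivlMr // /s ge_min lexx orbT.
  have := key s (ltac:(by rewrite gtr0_norm // /s ge_min lexx)).
  rewrite expr2 -mulrA [2 * _]mulrCA -mulrA ler_pM2l //; lra.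
rewrite -oppr_le0; apply/ler_addgt0Pr => e e0; rewrite add0r.
pose s := Num.min (1/4) (e / t).
have s0 : 0 < s by rewrite /s lt_min; apply/andP; split; [lra|exact: divr_gt0].
have st : s * t <= e by rewrite -ler_pdivlMr // /s ge_min lexx orbT.
have := key (- s) (ltac:(by rewrite normrN gtr0_norm // /s ge_min lexx)).
rewrite sqrrN expr2 mulrN mulNr -mulrN -mulrA [2 * _]mulrCA -mulrA ler_pM2l //; lra.
Qed.

Lemma extremal_neq0 : exists k, u k != 0.
Proof.
apply: contrapT => /forallNP h.
have hu k : `|u0 k| = 0 by apply: contrapT => /eqP; exact: h.
have [_ _ _ hf] := abs_feasible.
have t2 : 0 < t / 2 by rewrite divr_gt0.
have [N hN] := htail_small r10 r11 t2.
have := hf N; rewrite /hform big1; last first.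
  by move=> k _; rewrite big1 // => n _; rewrite /u !hu !mulr0.
have := hN N (leqnn _); lra.
Qed.

End Eigenvector.

Section EigenvectorExists.
Variable R : realType.

Lemma hankel_eigenvector (t : R) : 0 < t -> t < Num.sqrt 3 / 2 ->
  exists r : R, exists g : nat -> R,
  [/\ 0 < r < 1, forall k, 0 < g k, forall k, g k <= r ^+ k
    & forall k, rsum (fun n => hk (k + n) r * g n) (t * g k)].
Proof.
move=> t0 ts; have [r1 [N [/andP[r10 r11] N0 hN]]] := hform_large t0 ts.
pose D : R := \sum_(n < N) po (1/2) n ^+ 2.
have D1 : 0 < D.
  rewrite /D; case: N N0 {hN} D => // N _ _; rewrite big_ord_recl po0 expr1n.
  by rewrite ltr_wpDr // sumr_ge0 // => i _; exact: sqr_ge0.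
pose q := (Num.sqrt D)^-1.
have qq : q ^+ 2 * D = 1.
  by rewrite /q exprVn sqr_sqrtr ?ltW // mulVf // gt_eqF.
pose w n : R := if (n < N)%N then q * po (1/2) n else 0.
have hw2 n : \sum_(k < n) w k ^+ 2 <= 1.
  have le1 m : (m <= N)%N -> \sum_(k < m) w k ^+ 2 <= 1.
    move=> mN; rewrite -[leRHS]qq /D mulr_sumr -(big_mkord xpredT (fun k => w k ^+ 2)).
    rewrite -(big_mkord xpredT (fun k => q ^+ 2 * po (1/2) k ^+ 2)).
    rewrite [leRHS](big_cat_nat (n := m)) //= ler_wpDr //.
      by rewrite sumr_ge0 // => i _; rewrite mulr_ge0 ?sqr_ge0.
    rewrite big_nat [leRHS]big_nat; apply: ler_sum => i /andP[_ im].
    by rewrite /w (leq_trans im) // exprMn.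
  case: (leqP n N) => nN; first exact: le1.
  apply: le_trans (le1 N (leqnn _)).
  rewrite -!(big_mkord xpredT (fun k => w k ^+ 2)) [leLHS](big_cat_nat (n := N)) 1?ltnW //=.
  rewrite gerDl big_nat big1 // => i /andP[Ni _]; rewrite /w ltnNge Ni /= expr0n //.
have hw k : `|w k| <= 1.
  have : w k ^+ 2 <= 1.
    by apply: le_trans (hw2 k.+1); rewrite big_ord_recr lerDr sumr_ge0 // => i _; exact: sqr_ge0.
  by rewrite -sqrtr_sqr -(ler_sqrt _ ler01) sqrtr1.
have hr1 : 0 <= r1 <= r1 by rewrite ltW /=.
have hN' n : (N <= n)%N -> t <= hform n r1 w.
  move=> Nn; have -> : hform n r1 w = q ^+ 2 * hform N r1 (po (1/2)).
    rewrite /hform mulr_sumr -(big_mkord xpredT (fun k => \sum_(m < n) hk (k + m) r1 * w k * w m)).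
    rewrite (big_cat_nat (n := N)) //= [X in _ + X]big_nat [X in _ + X]big1 ?addr0; last first.
      by move=> k /andP[Nk _]; rewrite big1 // => m _; rewrite /w ltnNge Nk mulr0 mul0r.
    rewrite big_mkord; apply: eq_bigr => k _; rewrite mulr_sumr.
    rewrite -(big_mkord xpredT (fun m => hk (k + m) r1 * w k * w m)).
    rewrite (big_cat_nat (n := N)) //= [X in _ + X]big_nat [X in _ + X]big1 ?addr0; last first.
      by move=> m /andP[Nm _]; rewrite [w m]/w ltnNge Nm mulr0.
    rewrite big_mkord; apply: eq_bigr => m _; rewrite /w !ltn_ord; ring.
  have -> : t = q ^+ 2 * (t * D) by rewrite mulrCA qq mulr1.
  apply: ler_wpM2l; first exact: sqr_ge0.
  exact: hN.
have [r [u0 [hf hmin]]] : exists r u, feasible t r1 r u /\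
    forall r' u', feasible t r1 r' u' -> r <= r'.
  apply: feasible_min => //; first exact: ltW.
  exists r1, w; split; [exact: hr1|exact: hw|exact: hw2|move=> N'].
  case: (leqP N N') => NN'.
    by have := hN' N' NN'; have := htail_ge0 (ltW r10) N'; lra.
  have := hform_tail (ltW r10) r11 hr1 hw (ltnW NN'); have := hN' N (leqnn _).
  by rewrite ler_norml => h1 /andP[]; lra.
have r10' := ltW r10.
have r0 : 0 < r := extremal_gt0 t0 r10' r11 hf.
have [hr hu _ _] := abs_feasible r11 hf.
have rlt : r < 1 by case/andP: hr => _ /le_lt_trans; apply.
have rr : 0 < r <= 1 by rewrite r0 ltW.
have rr' : 0 <= r <= 1 by rewrite ltW //= ltW.
have he k := extremal_eigen t0 r10' r11 hf hmin k.
have [k0 hk0] := extremal_neq0 t0 r10' r11 hf.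
pose g k := `|u0 k|.
have g0 k : 0 <= g k by exact: normr_ge0.
have gpos k : 0 < g k.
  rewrite -(pmulr_rgt0 _ t0); apply: (@lt_le_trans _ _ (hk (k + k0) r * g k0)).
    by rewrite mulr_gt0 ?hk_gt0 // lt0r hk0 g0.
  apply: le_trans (rsum_ge_part k0.+1 _ (he k)); last first.
    by move=> n; rewrite mulr_ge0 ?hk_ge0.
  by rewrite big_ord_recr /= lerDr sumr_ge0 // => i _; rewrite mulr_ge0 ?hk_ge0.
exists r, g; split=> //; first by rewrite r0.
(* The rows of the matrix decay by a factor [r], and an eigenvector inherits this from its
   equation. *)
have gS k : g k.+1 <= r * g k.
  rewrite -(ler_pM2l t0) mulrCA.
  apply: (rsum_le _ (he k.+1) (rsumZ r (he k))) => n.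
  by rewrite mulrA ler_wpM2r // addSn hk_S.
elim=> [|k IH]; first by rewrite expr0; have := hu 0%N; rewrite normr_id.
by apply: (le_trans (gS k)); rewrite exprS ler_wpM2l // ltW.
Qed.

End EigenvectorExists.

Section ComplexLimits.
Variable R : realType.

Lemma rsum_unshift (c : nat -> R) l : rsum (fun i => c i.+1) l -> rsum c (c 0%N + l).
Proof.
move=> h e e0; have [N hN] := h e e0; exists N.+1 => -[//|n] Nn.
rewrite big_ord_recl opprD addrACA subrr add0r.
by under eq_bigr do rewrite lift0; exact: hN.
Qed.

Implicit Types (u v : nat -> R[i]) (a b : R[i]).

Definition nclim u a := forall e : R, 0 < e ->
  exists N, forall n, (N <= n)%N -> nc (a - u n) <= e.

Lemma nclim_cst a : nclim (fun _ => a) a.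
Proof. by move=> e e0; exists 0%N => n _; rewrite subrr nc0 ltW. Qed.

Lemma nclim_uniq u a b : nclim u a -> nclim u b -> a = b.
Proof.
move=> h h'; apply: nc_inj_small => e e0; have e2 : 0 < e / 2 by rewrite divr_gt0.
have [N hN] := h _ e2; have [N' hN'] := h' _ e2; pose n := maxn N N'.
apply: (le_trans (nc_triangle _ (u n) _)); rewrite [leRHS](splitr e) lerD //.
  by rewrite hN ?leq_maxl.
by rewrite ncBC hN' ?leq_maxr.
Qed.

Lemma nclimD u v a b : nclim u a -> nclim v b -> nclim (fun n => u n + v n) (a + b).
Proof.
move=> h h' e e0; have e2 : 0 < e / 2 by rewrite divr_gt0.
have [N hN] := h _ e2; have [N' hN'] := h' _ e2.
exists (maxn N N') => n; rewrite geq_max => /andP[n1 n2].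
rewrite opprD addrACA; apply: (le_trans (ncD _ _)).
by rewrite [leRHS](splitr e) lerD ?hN ?hN'.
Qed.

Lemma nclimM u v a b : nclim u a -> nclim v b -> nclim (fun n => u n * v n) (a * b).
Proof.
move=> h h' e e0.
have [N0 h0] := h' _ (ltr01 : 0 < 1 :> R).
have c0 : 0 < e / (nc a + nc b + 1 + 1) by rewrite divr_gt0 // !ltr_wpDl ?addr_ge0 ?nc_ge0.
have [N hN] := h _ c0; have [N' hN'] := h' _ c0.
exists (maxn N0 (maxn N N')) => n; rewrite !geq_max => /andP[n0 /andP[n1 n2]].
have -> : a * b - u n * v n = a * (b - v n) + (a - u n) * v n by ring.
apply: (le_trans (ncD _ _)); rewrite !ncM.
have hv : nc (v n) <= nc b + 1.
  by rewrite -[v n](subKr b); apply: (le_trans (ncB _ _)); rewrite lerD2l h0.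
apply: (le_trans (lerD (ler_wpM2l (nc_ge0 _) (hN' n n2))
  (ler_pM (nc_ge0 _) (nc_ge0 _) (hN n n1) hv))).
rewrite [nc a * _]mulrC -mulrDr addrA.
rewrite mulrAC ler_pdivrMr; last by rewrite !ltr_wpDl ?addr_ge0 ?nc_ge0.
by rewrite ler_wpM2l ?(ltW e0) // lerDl.
Qed.

Lemma nclimN u a : nclim u a -> nclim (fun n => - u n) (- a).
Proof.
move=> h e e0; have [N hN] := h e e0; exists N => n Nn.
by rewrite -opprD ncN hN.
Qed.

Lemma nclim_ev (c : nat -> R) (x : R[i]) : l1 c -> nc x <= 1 ->
  nclim (fun n => \sum_(i < n) (c i)%:C * x ^+ i) (ev c x).
Proof. exact: evP. Qed.

End ComplexLimits.

(** * A Riemann-Hilbert problem on the circle *)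

Section RiemannHilbert.
Variable R : realType.
Variables (t r : R) (g : nat -> R).
Hypotheses (t0 : 0 < t) (r0 : 0 < r) (r1 : r < 1).
Hypothesis g0 : forall k, 0 < g k.
Hypothesis gr : forall k, g k <= r ^+ k.
Hypothesis hg : forall k, rsum (fun n => hk (k + n) r * g n) (t * g k).

Local Notation gam := (gam R).

Let rr : 0 <= r <= 1. Proof. by rewrite !ltW. Qed.
Let r00 : 0 <= r. Proof. exact: ltW. Qed.
Let rlt : 0 <= r < 1. Proof. by rewrite r00. Qed.

Lemma g_le1 k : g k <= 1.
Proof. by apply: (le_trans (gr k)); rewrite exprn_ile1 // ltW. Qed.

Lemma gam_r_le n : 0 <= gam n.+1 * r ^+ n.+1 <= r ^+ n.+1.
Proof.
have h : 0 <= r ^+ n.+1 by exact: exprn_ge0.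
by rewrite mulr_ge0 ?(ltW (gam_gt0 _ _)) //= ler_piMl ?gam_le1.
Qed.

Lemma toeplitz_exists k : exists s, rsum (fun i => gam i.+1 * r ^+ i.+1 * g (i + k).+1) s.
Proof.
apply: (@rsum_exists _ _ (fun i => r ^+ i)); last exact: bdd_geom.
move=> i; have /andP[h1 h2] := gam_r_le i.
rewrite ger0_norm; last by rewrite mulr_ge0 // ltW.
apply: (@le_trans _ _ (r ^+ i.+1 * 1)); last by rewrite mulr1 exprS ler_piMl ?exprn_ge0 ?ltW.
by apply: ler_pM => //; [exact: ltW|exact: g_le1].
Qed.

(** Applies the Toeplitz matrix of [(1 - r / x)^(1/3)] to the eigenvector equation. With
    [y_k = g_k - s], the coefficient of [x^k] in [(1 - r / x)^(1/3) g(x)], the conclusion says that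
    the coefficient of [x^(-k-1)] in the same product is [- t y_k]. *)
Lemma wiener_hopf k s : rsum (fun i => gam i.+1 * r ^+ i.+1 * g (i + k).+1) s ->
  rsum (fun n => gam (n + k).+1 * r ^+ (n + k).+1 * g n) (t * (g k - s)).
Proof.
move=> hs.
pose a i n := gam i.+1 * r ^+ i.+1 * (hk ((i + k).+1 + n) r * g n).
have a0 i n : 0 <= a i n.
  have /andP[h1 _] := gam_r_le i; rewrite mulr_ge0 // mulr_ge0 ?hk_ge0 //; exact: ltW.
have h1 i : rsum (a i) (gam i.+1 * r ^+ i.+1 * (t * g (i + k).+1)).
  exact: rsumZ (hg _).
have h2 n : rsum (a ^~ n) (g n * (hk (n + k) r - gam (n + k).+1 * r ^+ (n + k).+1)).
  apply: (eq_rsum _ (rsumZ (g n) (hk_toeplitz (n + k) rr))) => i.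
  by rewrite /a (_ : ((i + k).+1 + n = (i + (n + k)).+1)%N) //; [ring|lia].
have h3 : rsum (fun i => gam i.+1 * r ^+ i.+1 * (t * g (i + k).+1)) (t * s).
  by apply: (eq_rsum _ (rsumZ t hs)) => i; ring.
have h4 := rsum_exchange a0 h1 h2 h3.
have h5 := rsumD (hg k) (rsumZ (-1) h4).
rewrite mulrBr -[- (t * s)]mulN1r; apply: (eq_rsum _ h5) => n.
by rewrite addnC; ring.
Qed.

Lemma wiener_hopf_pair : exists y : nat -> R, forall k,
  rsum (fun i => gam i.+1 * r ^+ i.+1 * g (i + k).+1) (g k - y k) /\
  rsum (fun n => gam (n + k).+1 * r ^+ (n + k).+1 * g n) (t * y k).
Proof.
have /choice [s hs] := toeplitz_exists.
exists (fun k => g k - s k) => k; split; last exact: wiener_hopf.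
by rewrite opprB addrC subrK.
Qed.

Variable y : nat -> R.
Hypothesis hy1 : forall k, rsum (fun i => gam i.+1 * r ^+ i.+1 * g (i + k).+1) (g k - y k).
Hypothesis hy2 : forall k,
  rsum (fun n => gam (n + k).+1 * r ^+ (n + k).+1 * g n) (t * y k).

Lemma y_gt0 k : 0 < y k.
Proof.
rewrite -(pmulr_rgt0 _ t0).
apply: (lt_le_trans _ (rsum_ge_part 1 _ (hy2 k))).
  by rewrite big_ord1 mulr_gt0 // mulr_gt0 ?gam_gt0 // exprn_gt0.
move=> n; have /andP[h _] := gam_r_le (n + k); rewrite mulr_ge0 // ltW //.
Qed.

Lemma y_le k : y k <= r ^+ k / (t * (1 - r)).
Proof.
have h1 : 0 < 1 - r by rewrite subr_gt0.
rewrite ler_pdivlMr ?mulr_gt0 // mulrA -ler_pdivlMr // mulrC.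
apply: (rsum_le_bound _ (hy2 k)) => n.
apply: (@le_trans _ _ (\sum_(i < n) r ^+ k * r ^+ i)).
  apply: ler_sum => i _; have /andP[h2 h3] := gam_r_le (i + k).
  apply: (@le_trans _ _ (r ^+ (i + k).+1 * 1)).
    by apply: ler_pM => //; [exact: ltW|exact: g_le1].
  by rewrite mulr1 -exprD addnC exprS ler_piMl ?exprn_ge0 // ltW.
by rewrite -mulr_sumr ler_wpM2l ?exprn_ge0 // geom_sum_le.
Qed.

Lemma l1_geom (c : nat -> R) (C : R) : (forall k, `|c k| <= C * r ^+ k) -> l1 c.
Proof.
move=> h; exists (C * (1 - r)^-1) => n.
have C0 : 0 <= C by have := h 0%N; rewrite expr0 mulr1; apply: le_trans.
apply: (@le_trans _ _ (\sum_(i < n) C * r ^+ i)); first exact: ler_sum.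
by rewrite -mulr_sumr ler_wpM2l // geom_sum_le.
Qed.

Lemma l1_g : l1 g.
Proof. by apply: (@l1_geom _ 1) => k; rewrite mul1r gtr0_norm. Qed.

Lemma l1_y : l1 y.
Proof.
apply: (@l1_geom _ (t * (1 - r))^-1) => k; rewrite gtr0_norm ?y_gt0 //.
by rewrite mulrC y_le.
Qed.

(* The coefficients of [(1 - r x)^(-s)]. *)
Definition acoef (s : R) i : R := po s i * r ^+ i.

Lemma conv_acoef s s' : conv (acoef s) (acoef s') =1 acoef (s + s').
Proof.
move=> n; rewrite /acoef -conv_po /conv mulr_suml; apply: eq_bigr => i _.
have -> : r ^+ n = r ^+ i * r ^+ (n - i) by rewrite -exprD subnKC // -ltnS.
ring.
Qed.

Lemma acoef_norm i : `|acoef (- (1/3)) i| <= r ^+ i.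
Proof.
rewrite /acoef normrM (ger0_norm (exprn_ge0 _ _)) // ler_piMl ?exprn_ge0 //.
case: i => [|i]; first by rewrite po0 normr1.
by rewrite -normrN gtr0_norm ?gam_le1 // gam_gt0.
Qed.

Lemma l1_acoef : l1 (acoef (- (1/3))).
Proof. by apply: (@l1_geom _ 1) => k; rewrite [1 * _ ^+ _]mul1r acoef_norm. Qed.

Lemma eq_ev (c c' : nat -> R) x : c =1 c' -> ev c x = ev c' x.
Proof. by move=> /funext ->. Qed.

Lemma ev_acoef_cube x : nc x <= 1 -> ev (acoef (- (1/3))) x ^+ 3 = 1 - r%:C * x.
Proof.
move=> hx; have ha := l1_acoef.
have h2 := l1_conv ha ha; have h3 := l1_conv ha h2.
rewrite !exprS expr0 mulr1 -ev_conv // -ev_conv //.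
have e : conv (acoef (- (1/3))) (conv (acoef (- (1/3))) (acoef (- (1/3)))) =1 acoef (-1).
  have /funext -> := conv_acoef (- (1/3)) (- (1/3)).
  by move=> n; rewrite conv_acoef; congr acoef; field.
apply: (ev_uniq h3 hx) => d d0; exists 2%N => -[//|[//|n]] _.
rewrite !big_ord_recl /= big1 ?addr0; last first.
  by move=> i _; rewrite e /acoef po_N1 mul0r rmorph0 mul0r.
rewrite !e /acoef !poE !po0 !expr0 !expr1 !mulr1 mul1r addr0 divr1 mulN1r rmorphN mulNr.
by rewrite rmorph1 subrr nc0 ltW.
Qed.

(** Sorts a square by diagonals, so that nonnegative and negative powers of [x] in a product of a
    series in [1/x] and one in [x] are separated at finite level. *)
Lemma square_sum (V : zmodType) (f : nat -> nat -> V) N :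
  \sum_(i < N) \sum_(n < N) f i n =
  \sum_(k < N) \sum_(i < N - k) f i (i + k)%N +
  \sum_(k < N) \sum_(n < N - k.+1) f (n + k).+1 n.
Proof.
elim: N => [|N IH]; first by rewrite !big_ord0 addr0.
have -> : \sum_(i < N.+1) \sum_(n < N.+1) f i n =
    \sum_(i < N) \sum_(n < N) f i n + (\sum_(i < N.+1) f i N + \sum_(n < N) f N n).
  rewrite big_ord_recr /=; under eq_bigr do rewrite big_ord_recr /=.
  rewrite big_split /= [\sum_(i < N.+1) f i N]big_ord_recr /= [X in _ + X = _]big_ord_recr /=.
  by rewrite -!addrA; congr (_ + (_ + _)); rewrite addrC.
rewrite IH addrACA; congr (_ + _).
  rewrite [RHS]big_ord_recr /= subSnn big_ord1 add0n.
  under [in RHS]eq_bigr => k _ do rewrite subSn 1?ltnW // big_ord_recr /= subnK 1?ltnW //.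
  rewrite big_split /= -addrA; congr (_ + _).
  rewrite [LHS](reindex_inj rev_ord_inj) big_ord_recr /= subSS subnn; congr (_ + _).
rewrite [RHS]big_ord_recr /= subnn big_ord0 addr0.
have e (k : 'I_N) : \sum_(n < N.+1 - k.+1) f (n + k).+1 n =
    \sum_(n < N - k.+1) f (n + k).+1 n + f N (N - k.+1)%N.
  rewrite subSS -(subnSK (ltn_ord k)) big_ord_recr /=; congr (_ + f _ _).
  by have := ltn_ord k; lia.
under [in RHS]eq_bigr do rewrite e.
by rewrite big_split /= [X in _ + X](reindex_inj rev_ord_inj).
Qed.

Lemma rsum_tail_le (c : nat -> R) l m (M : R) : rsum c l ->
  (forall n, \sum_(m <= i < n) `|c i| <= M) -> `|l - \sum_(i < m) c i| <= M.
Proof.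
move=> h hM; have hc : csum (fun i => (c i)%:C) l%:C.
  move=> e e0; have [N hN] := h e e0; exists N => n Nn.
  by rewrite -rmorph_sum -rmorphB ncR hN.
rewrite -ncR rmorphB rmorph_sum; apply: (csum_tail hc) => n.
by under eq_bigr do rewrite ncR.
Qed.

(** The Laurent expansion of [(1 - r / x)^(1/3) g(x)] multiplied by [x]. Bilateral series are
    avoided: square partial sums differ from the limit coefficients by [O(r^N)] in total. *)
Lemma circle_identity x : nc x = 1 ->
  x * ev y x - t%:C * ev y x^* = x * ev (acoef (- (1/3))) x^* * ev g x.
Proof.
move=> x1; have x1' : nc x <= 1 by rewrite x1.
have xc1 : nc x^* <= 1 by rewrite nc_conj.
have xx := circle_conj x1.
pose a := acoef (- (1/3)).
have ha : l1 a := l1_acoef.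
have aS i : a i.+1 = - (gam i.+1 * r ^+ i.+1) by rewrite /a /acoef mulNr opprK.
have h1 : 0 < 1 - r by rewrite subr_gt0.
pose B : R := (1 - r)^-1.
have B0 : 0 < B by rewrite invr_gt0.
have ga m : `|a m| <= r ^+ m by exact: acoef_norm.
have geo m n : \sum_(m <= i < n) r ^+ i <= r ^+ m * B := geom_tail_le r00 r1 m n.
have e1 N k : (k <= N)%N ->
    `|y k - \sum_(i < N - k) a i * g (i + k)%N| <= r ^+ N * r ^+ (N - k) * B.
  move=> kN.
  have hs : rsum (fun i => a i * g (i + k)%N) (y k).
    have e := rsumZ (-1) (hy1 k).
    have : rsum (fun i => a i.+1 * g (i.+1 + k)%N) (-1 * (g k - y k)).
      by apply: (eq_rsum _ e) => i; rewrite aS addSn; ring.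
    move=> hh; have := rsum_unshift (c := fun i => a i * g (i + k)%N) hh.
    by rewrite /a /acoef po0 expr0 !mul1r add0n mulN1r opprB addrCA subrr addr0.
  apply: (rsum_tail_le hs) => n; apply: (@le_trans _ _ (\sum_(N - k <= i < n) r ^+ N * r ^+ i)).
    rewrite big_nat [leRHS]big_nat; apply: ler_sum => i /andP[hi _].
    rewrite normrM (gtr0_norm (g0 _)) mulrC; apply: ler_pM => //; first exact: ltW.
    by apply: (le_trans (gr _)); apply: ler_wiXn2l; [exact: ltW|exact: ltW|lia].
  by rewrite -mulr_sumr -mulrA ler_wpM2l ?exprn_ge0.
have e2 N k : (k < N)%N ->
    `|- (t * y k) - \sum_(n < N - k.+1) a (n + k).+1 * g n| <= r ^+ N * r ^+ (N - k.+1) * B.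
  move=> kN.
  have hs : rsum (fun n => a (n + k).+1 * g n) (- (t * y k)).
    rewrite -mulN1r; apply: (eq_rsum _ (rsumZ (-1) (hy2 k))) => n; rewrite aS; ring.
  apply: (rsum_tail_le hs) => n.
  apply: (@le_trans _ _ (\sum_(N - k.+1 <= i < n) r ^+ N * r ^+ i)).
    rewrite big_nat [leRHS]big_nat; apply: ler_sum => i /andP[hi _].
    rewrite normrM (gtr0_norm (g0 _)); apply: ler_pM => //; first exact: ltW.
    by apply: (le_trans (ga _)); apply: ler_wiXn2l; [exact: ltW|exact: ltW|lia].
  by rewrite -mulr_sumr -mulrA ler_wpM2l ?exprn_ge0.
pose sy N (u : R[i]) := \sum_(i < N) (y i)%:C * u ^+ i.
pose sa N := \sum_(i < N) (a i)%:C * x^* ^+ i.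
pose sg N := \sum_(i < N) (g i)%:C * x ^+ i.
have key N : nc (x * sy N x - t%:C * sy N x^* - x * sa N * sg N) <= r ^+ N * (B * B + B * B).
  have exp1 k i : x ^+ (i + k) * x * x^* ^+ i = x ^+ k.+1.
    rewrite exprD exprSr; have : x ^+ i * x^* ^+ i = 1 by rewrite -exprMn xx expr1n.
    by move=> e; rewrite -[RHS]mul1r -e; ring.
  have exp2 k n : x ^+ n * x * x^* ^+ (n + k).+1 = x^* ^+ k.
    rewrite -addSn exprD -exprSr; have : x ^+ n.+1 * x^* ^+ n.+1 = 1 by rewrite -exprMn xx expr1n.
    by move=> e; rewrite mulrA e mul1r.
  have -> : x * sa N * sg N =
      \sum_(k < N) x ^+ k.+1 * (\sum_(i < N - k) a i * g (i + k)%N)%:C +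
      \sum_(k < N) x^* ^+ k * (\sum_(n < N - k.+1) a (n + k).+1 * g n)%:C.
    have -> : x * sa N * sg N =
        \sum_(i < N) \sum_(n < N) ((a i * g n)%:C * (x ^+ n * x * x^* ^+ i)).
      rewrite -mulrA /sa mulr_suml mulr_sumr; apply: eq_bigr => i _.
      rewrite /sg mulr_sumr mulr_sumr; apply: eq_bigr => n _; rewrite (realCM (a i) (g n)).
      move: ((a i)%:C) ((g n)%:C) (x ^+ n) (x^* ^+ i) => b1 b2 b3 b4; ring.
    rewrite (square_sum (fun i n => (a i * g n)%:C * (x ^+ n * x * x^* ^+ i)) N); congr (_ + _); apply: eq_bigr => k _.
      rewrite rmorph_sum mulr_sumr; apply: eq_bigr => i _; rewrite exp1 mulrC //.
    rewrite rmorph_sum mulr_sumr; apply: eq_bigr => n _; rewrite exp2 mulrC //.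
  have -> : x * sy N x = \sum_(k < N) x ^+ k.+1 * (y k)%:C.
    by rewrite /sy mulr_sumr; apply: eq_bigr => k _; rewrite exprS mulrCA mulrC.
  have -> : - (t%:C * sy N x^*) = \sum_(k < N) x^* ^+ k * (- (t * y k))%:C.
    rewrite /sy mulr_sumr -sumrN; apply: eq_bigr => k _.
    have -> : (- (t * y k))%:C = - (t%:C * (y k)%:C) by rewrite -realCM; exact: rmorphN.
    by rewrite mulrN mulrA [X in _ = - X]mulrC.
  rewrite opprD addrACA -!sumrB; apply: (le_trans (ncD _ _)); rewrite mulrDr.
  have sumB m : \sum_(k < m) r ^+ k <= B by apply: geom_sum_le.
  apply: lerD; apply: (le_trans (nc_sum _ _ _)).
    apply: (@le_trans _ _ (\sum_(k < N) r ^+ N * B * r ^+ (N - k.+1))).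
      apply: ler_sum => k _; rewrite -mulrBr -rmorphB ncM ncX x1 expr1n mul1r ncR.
      apply: (le_trans (e1 N k (ltnW (ltn_ord k)))); rewrite mulrAC.
      apply: ler_wpM2l; first by rewrite mulr_ge0 ?exprn_ge0 // ltW.
      by apply: ler_wiXn2l; [exact: ltW|exact: ltW|lia].
    rewrite -mulr_sumr mulrA ler_wpM2l //; first by rewrite mulr_ge0 ?exprn_ge0 // ltW.
    by apply: le_trans (sumB N); rewrite [leRHS](reindex_inj rev_ord_inj).
  apply: (@le_trans _ _ (\sum_(k < N) r ^+ N * B * r ^+ (N - k.+1))).
    apply: ler_sum => k _; rewrite -mulrBr -rmorphB ncM ncX nc_conj x1 expr1n mul1r ncR.
    by apply: (le_trans (e2 N k (ltn_ord k))); rewrite mulrAC.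
  rewrite -mulr_sumr mulrA ler_wpM2l //; first by rewrite mulr_ge0 ?exprn_ge0 // ltW.
  by apply: le_trans (sumB N); rewrite [leRHS](reindex_inj rev_ord_inj).
apply/eqP; rewrite -subr_eq0; apply/eqP.
have l1 := nclimD (nclimD (nclimM (nclim_cst x) (nclim_ev l1_y x1'))
  (nclimN (nclimM (nclim_cst t%:C) (nclim_ev l1_y xc1))))
  (nclimN (nclimM (nclimM (nclim_cst x) (nclim_ev ha xc1)) (nclim_ev l1_g x1'))).
apply: (nclim_uniq l1) => e e0.
have c0 : 0 < e / (B * B + B * B) by rewrite divr_gt0 // addr_gt0 // mulr_gt0.
have /cvgrPdist_le/(_ _ c0)[N0 _ hN] : (fun n => r ^+ n) @ \oo --> (0 : R).
  by apply: cvg_expr; rewrite ger0_norm.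
exists N0 => N NN; rewrite sub0r ncN; apply: (le_trans (key N)).
have := hN N NN; rewrite sub0r normrN ger0_norm ?exprn_ge0 //.
by rewrite ler_pdivlMr // addr_gt0 // mulr_gt0.
Qed.

Lemma circle_cube x : nc x = 1 ->
  (x * ev y x - t%:C * ev y x^*) ^+ 3 = x ^+ 2 * (x - r%:C) * ev g x ^+ 3.
Proof.
move=> x1.
have h : ev (acoef (- (1/3))) x^* ^+ 3 = 1 - r%:C * x^* by apply: ev_acoef_cube; rewrite nc_conj x1.
have cub (a b c : R[i]) : (a * b * c) ^+ 3 = a ^+ 3 * b ^+ 3 * c ^+ 3 by rewrite !exprMn.
rewrite (circle_identity x1) cub h.
have xx := circle_conj x1.
have -> : x ^+ 3 * (1 - r%:C * x^*) = x ^+ 2 * (x - r%:C * (x * x^*)) by ring.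
by rewrite xx mulr1.
Qed.

End RiemannHilbert.

(** * The hull of the surface below the threshold *)

Section Surface.
Variable R : realType.
Implicit Types (t : R) (z w W x : R[i]).

(* In the coordinates [(z, W)] with [W = 3 t w + z^3] the surface [S_ t] is
   [W = (z + t z^* )^3]. *)
Definition pt t z W : 'rV[R[i]]_2 :=
  \row_(i < 2) (if i == 0 then z else (W - z ^+ 3) / (3 * t%:C)).

Lemma pt0 t z W : pt t z W 0 0 = z.
Proof. by rewrite mxE. Qed.

Lemma pt1 t z W : pt t z W 0 1 = (W - z ^+ 3) / (3 * t%:C).
Proof. by rewrite mxE. Qed.

Lemma ord2_cases (P : 'I_2 -> Prop) : P 0 -> P 1 -> forall i, P i.
Proof.
move=> h0 h1 i; case: (unliftP 0 i) => [j ->|-> //].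
by rewrite (_ : lift 0 j = 1) //; apply/val_inj; case: j => -[].
Qed.

Lemma realC_neq0 (a : R) : (a%:C != 0 :> R[i]) = (a != 0).
Proof. by rewrite -nc_gt0 ncR normr_gt0. Qed.

Lemma ptE t (u : 'rV[R[i]]_2) : t != 0 ->
  u = pt t (u 0 0) (3 * t%:C * u 0 1 + u 0 0 ^+ 3).
Proof.
move=> t0; apply/rowP; apply: ord2_cases; rewrite ?pt0 ?pt1 //.
by rewrite addrK mulrC mulKf // mulf_neq0 ?pnatr_eq0 // realC_neq0.
Qed.

Lemma p_E t z zb : t != 0 ->
  p_ t z zb = ((z + t%:C * zb) ^+ 3 - z ^+ 3) / (3 * t%:C).
Proof.
move=> t0; have t0' : t%:C != 0 :> R[i] by rewrite realC_neq0.
have e : (t ^+ 2 / 3%:R)%:C = t%:C ^+ 2 / 3 :> R[i].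
  by rewrite -!(rmorph_nat (real_complex R)) -rmorphXn -fmorph_div.
by rewrite /p_ e; field.
Qed.

Lemma S_pt t z W : t != 0 -> S_ t (pt t z W) <-> W = (z + t%:C * z^*) ^+ 3.
Proof.
move=> t0; rewrite /S_ /= pt0 pt1 p_E //.
have h : 3 * t%:C != 0 :> R[i] by rewrite mulf_neq0 ?pnatr_eq0 // realC_neq0.
split=> [/(mulIf (invr_neq0 h))/addIr //|-> //].
Qed.

Lemma enorm_pt_small t (d : R) : 0 < t -> 0 < d -> exists2 e : R, 0 < e &
  forall z W, nc z <= e -> nc W <= e -> closed_eball 0 d (pt t z W).
Proof.
move=> t0 d0; have t3 : 0 < 3 * t by rewrite mulr_gt0.
have c0 : 0 < 1 + 2 / (3 * t) by rewrite addr_gt0 // divr_gt0.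
exists (Num.min 1 (d / (1 + 2 / (3 * t)))); first by rewrite lt_min ltr01 divr_gt0.
move=> z W; set e := Num.min _ _ => hz hW.
have e1 : e <= 1 by rewrite /e ge_min lexx.
have ed : e * (1 + 2 / (3 * t)) <= d by rewrite -ler_pdivlMr // /e ge_min lexx orbT.
rewrite /closed_eball /= subr0; apply: (le_trans (enorm_le _)); rewrite pt0 pt1.
have nct : nc (3 * t%:C)^-1 = (3 * t)^-1.
  by rewrite ncV ncM -(rmorph_nat (real_complex R)) !ncR normr_nat gtr0_norm.
have hz3 : nc z ^+ 3 <= e.
  have z0 := nc_ge0 z; apply: (le_trans _ hz); rewrite exprS ler_piMr // exprn_ile1 //.
  exact: le_trans e1.
have : nc ((W - z ^+ 3) / (3 * t%:C)) <= (e + e) / (3 * t).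
  rewrite ncM nct ler_wpM2r ?invr_ge0 ?(ltW t3) //.
  by apply: (le_trans (ncB _ _)); rewrite ncX lerD.
have -> : (e + e) / (3 * t) = e * (2 / (3 * t)) by field; rewrite gt_eqF.
lra.
Qed.

Lemma eball_sub_bounded t d : forall x : 'rV[R[i]]_2, (S_ t `&` closed_eball (0 : 'rV[R[i]]_2) d) x ->
  forall i, nc (x 0 i) <= d.
Proof.
move=> x [_ hx] i; apply: (le_trans (nc_le_enorm _ _)).
by move: hx; rewrite /closed_eball /= subr0.
Qed.

Lemma S_sub_hull t d :
  S_ t `&` closed_eball (0 : 'rV[R[i]]_2) d `<=` poly_hull (S_ t `&` closed_eball 0 d).
Proof. exact: subset_poly_hull (@eball_sub_bounded t d). Qed.

Lemma hull_disc_pt (K : set 'rV[R[i]]_2) t (zf Wf : R[i] -> R[i]) :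
  dalg zf -> dalg Wf ->
  (forall x, nc x = 1 -> poly_hull K (pt t (zf x) (Wf x))) ->
  forall x, nc x <= 1 -> poly_hull K (pt t (zf x) (Wf x)).
Proof.
move=> hz hW; apply: poly_hull_disc; apply: ord2_cases.
  by apply: dalg_ext hz => x _; rewrite pt0.
apply: (@dalg_ext _ (fun x => (Wf x - zf x ^+ 3) * (3 * t%:C)^-1)).
  by move=> x _; rewrite pt1.
by apply: dalgM; [apply: dalgB => //; exact: dalgX|exact: dalg_cst].
Qed.

End Surface.

(** * Fixed points and Lipschitz bounds on small discs *)

Section Contraction.
Variable R : realType.
Implicit Types (x : R[i]).

Lemma complex_fixpoint (T : R[i] -> R[i]) (rho : R) : 0 < rho ->
  (forall x, nc x <= rho -> nc (T x) <= rho) ->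
  (forall x x', nc x <= rho -> nc x' <= rho -> nc (T x - T x') <= 1/2 * nc (x - x')) ->
  exists2 x, nc x <= rho & T x = x.
Proof.
move=> rho0 hT hL; pose u n := iter n T 0.
have hu n : nc (u n) <= rho.
  by elim: n => [|n IH]; [rewrite (_ : u 0%N = 0) // nc0 ltW|exact: hT].
have hd n : nc (u n.+1 - u n) <= rho * (1/2) ^+ n.
  elim: n => [|n IH]; first by rewrite expr0 mulr1 (_ : u 0%N = 0) // subr0 hu.
  apply: (le_trans (hL (u n.+1) (u n) (hu _) (hu _))); rewrite exprS mulrCA ler_wpM2l //.
have [l hl] : exists l, csum (fun n => u n.+1 - u n) l.
  apply: (csum_exists hd); apply: bddZ; first exact: ltW.
  apply: bdd_geom; lra.
have sE n : \sum_(i < n) (u i.+1 - u i) = u n.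
  by rewrite -(big_mkord xpredT (fun i => u i.+1 - u i)) telescope_sumr // (_ : u 0%N = 0) // subr0.
have ul : nclim u l.
  by move=> e e0; have [N hN] := hl e e0; exists N => n Nn; rewrite -sE hN.
have lr : nc l <= rho.
  apply/ler_addgt0Pr => e e0; have [N hN] := ul e e0.
  rewrite -[l](subrK (u N)); apply: (le_trans (ncD _ _)); rewrite addrC lerD //.
  exact: hN.
exists l => //; apply: (nclim_uniq (u := fun n => u n.+1)).
  move=> e e0; have [N hN] := ul e e0; exists N => n Nn.
  apply: (le_trans (hL l (u n) lr (hu n))); have := hN n Nn; have := nc_ge0 (l - u n); lra.
by move=> e e0; have [N hN] := ul e e0; exists N => n Nn; apply: hN; exact: leqW.
Qed.

(** Radius 1/2 is convenient because [n (1/2)^(n-1) <= 1]: the Lipschitz constant of a power series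
    there is just a bound on the sum of its [|c i|]. *)
Lemma pow_half_lip x x' n : nc x <= 1/2 -> nc x' <= 1/2 ->
  nc (x ^+ n - x' ^+ n) <= nc (x - x').
Proof.
move=> hx hx'; case: n => [|n]; first by rewrite !expr0 subrr nc0 nc_ge0.
rewrite subrXX ncM ler_piMr ?nc_ge0 //; apply: (le_trans (nc_sum _ _ _)).
apply: (@le_trans _ _ (\sum_(i < n.+1) (1/2) ^+ n)).
  apply: ler_sum => i _; have hi : (i <= n)%N by rewrite -ltnS.
  have -> : (1/2) ^+ n = (1/2) ^+ (n - i) * (1/2) ^+ i :> R by rewrite -exprD subnK.
  rewrite ncM !ncX; by apply: ler_pM; rewrite ?exprn_ge0 ?nc_ge0 // lerXn2r ?nnegrE ?nc_ge0 //; lra.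
rewrite sum_cst; elim: n => [|n IH]; first by rewrite expr0 mulr1.
rewrite exprS -natr1; apply: le_trans IH.
have q0 : 0 <= (1/2) ^+ n :> R by rewrite exprn_ge0.
have m1 : 1 <= n.+1%:R :> R by rewrite ler1n.
by move: ((1/2) ^+ n) (n.+1%:R) q0 m1 => q m q0 m1; nra.
Qed.

Lemma ev_half_lip (c : nat -> R) : l1 c -> exists2 L : R, 0 <= L &
  forall x x', nc x <= 1/2 -> nc x' <= 1/2 -> nc (ev c x - ev c x') <= L * nc (x - x').
Proof.
move=> hc; have [M hM] := hc.
have M0 : 0 <= M by have := hM 0%N; rewrite big_ord0.
exists M => // x x' hx hx'.
have x1 : nc x <= 1 by lra. have x1' : nc x' <= 1 by lra.
have h := csumD (evP hc x1) (csumZ (-1) (evP hc x1')).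
rewrite -[- ev c x']mulN1r; apply: (csum_norm h) => n.
apply: (@le_trans _ _ (\sum_(i < n) `|c i| * nc (x - x'))).
  apply: ler_sum => i _.
  have -> : (c i)%:C * x ^+ i + -1 * ((c i)%:C * x' ^+ i) = (c i)%:C * (x ^+ i - x' ^+ i) by ring.
  by rewrite ncM ncR ler_wpM2l // pow_half_lip.
by rewrite -mulr_suml ler_wpM2r ?nc_ge0.
Qed.

End Contraction.

(** * From the bidisc to a ball in the hull *)

Section BallInHull.
Variable R : realType.
Implicit Types (z w W x : R[i]).

(** A root [u] of [u^2 - s u + p] with [|u| > 1] would give [|u|^2 <= |s| |u| + |p| < |u|^2]. *)
Lemma quadratic_roots (s p : R[i]) : nc s + nc p < 1 ->
  exists P N, [/\ P + N = s, P * N = p, nc P <= 1 & nc N <= 1].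
Proof.
move=> h; pose d := sqrtC (s ^+ 2 - 4 * p).
have hd : d ^+ 2 = s ^+ 2 - 4 * p by exact: sqrtCK.
have small (u : R[i]) : u ^+ 2 = s * u - p -> nc u <= 1.
  move=> e; rewrite leNgt; apply/negP => u1.
  have : nc u ^+ 2 <= nc s * nc u + nc p by rewrite -ncX e -ncM ncB.
  have := nc_ge0 s; have := nc_ge0 p; nra.
have n2 : (2 : R[i]) != 0 by rewrite pnatr_eq0.
exists ((s + d) / 2), ((s - d) / 2).
have e1 : (s + d) / 2 * ((s - d) / 2) = p.
  have -> : (s + d) / 2 * ((s - d) / 2) = (s ^+ 2 - d ^+ 2) / 4 by field.
  by rewrite hd; field.
split=> //; first by field.
- by apply: small; rewrite -e1; field.
- by apply: small; rewrite -e1; field.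
Qed.

Variables (t r : R) (g y : nat -> R).
Hypotheses (t0 : 0 < t) (r0 : 0 < r) (r1 : r < 1).
Hypotheses (lg : l1 g) (ly : l1 y) (g00 : 0 < g 0%N) (y00 : 0 < y 0%N).
Hypothesis cube : forall x, nc x = 1 ->
  (x * ev y x - t%:C * ev y x^*) ^+ 3 = x ^+ 2 * (x - r%:C) * ev g x ^+ 3.

(* [P] and [N] range over the torus; [m = P N (P + N)] satisfies [m^2 / (P N)^3 >= 0]
   there, while [m] and [m^3 / (P N)^3] are polynomials. *)
Definition zPN (l : R) (P N : R[i]) :=
  l%:C * ('i * (P * N * (P + N)) * ev y (P ^+ 3 * N ^+ 3)).
Definition WPN (l : R) (P N : R[i]) :=
  l%:C ^+ 3 * (- 'i * (P + N) ^+ 3 * (P ^+ 3 * N ^+ 3 - r%:C) * ev g (P ^+ 3 * N ^+ 3) ^+ 3).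

Lemma iC3 : ('i : R[i]) ^+ 3 = - 'i.
Proof. by rewrite exprS sqrCi mulrN1. Qed.

Lemma iCconj : ('i : R[i])^* = - 'i.
Proof. exact: conjCi. Qed.

(** On the torus conjugation inverts [P] and [N], so with [X = (P N)^3] the coefficient
    [P N (P + N)] equals [X] times its conjugate [(P + N) / (P N)^2]. Taking this conjugate out
    leaves the bracket of [cube], and [(P N)^6] cancels [X^2]. *)
Lemma torus_in_S l P N : nc P = 1 -> nc N = 1 ->
  WPN l P N = (zPN l P N + t%:C * (zPN l P N)^*) ^+ 3.
Proof.
move=> hP hN; set X := P ^+ 3 * N ^+ 3.
have hX : nc X = 1 by rewrite ncM !ncX hP hN !expr1n mulr1.
have cP := circle_conj hP; have cN := circle_conj hN.
have P0 : P != 0 by rewrite -nc_gt0 hP.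
have N0 : N != 0 by rewrite -nc_gt0 hN.
have eP : P^* = P^-1 by apply: (mulfI P0); rewrite cP divff.
have eN : N^* = N^-1 by apply: (mulfI N0); rewrite cN divff.
have eX : ev y X^* = (ev y X)^* by apply: ev_conj => //; rewrite hX.
rewrite /WPN /zPN -/X !rmorphM rmorphD /= eP eN iCconj conjR -eX.
have -> : l%:C * ('i * (P * N * (P + N)) * ev y X) +
   t%:C * (l%:C * (- 'i * (P^-1 * N^-1 * (P^-1 + N^-1)) * ev y X^*)) =
   l%:C * 'i * ((P + N) / (P * N) ^+ 2) * (X * ev y X - t%:C * ev y X^*).
  by move: (ev y X) (ev y X^*) => a b; rewrite /X; field; rewrite P0 N0.
rewrite !exprMn cube // iC3 /X; field.
by rewrite P0 N0.
Qed.

Variable (d : R).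
Hypothesis d0 : 0 < d.
Let K : set 'rV[R[i]]_2 := S_ t `&` closed_eball 0 d.

Lemma dalg_ev_comp c (f : R[i] -> R[i]) : l1 c -> dalg f ->
  (forall x, nc x <= 1 -> nc (f x) <= 1) -> dalg (fun x => ev c (f x)).
Proof.
move=> hc hf hf1 e e0; have e2 : 0 < e / 2 by rewrite divr_gt0.
have [q hq] := dalg_ev hc e2.
have [q' hq'] : exists q' : {poly R[i]}, forall x, nc x <= 1 -> nc (q.[f x] - q'.[x]) <= e / 2.
  have : dalg (fun x => \sum_(i < size q) q`_i * f x ^+ i).
    by apply: dalg_sum => i; apply: dalgM; [exact: dalg_cst|exact: dalgX].
  by move=> /(_ _ e2) [q' h]; exists q' => x hx; rewrite horner_coef; exact: h.
exists q' => x hx; apply: (le_trans (nc_triangle _ q.[f x] _)).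
by rewrite [leRHS](splitr e) lerD ?hq' // hq // hf1.
Qed.

Lemma dalg_zW l N : nc N <= 1 -> dalg (fun P => zPN l P N) /\ dalg (fun P => WPN l P N).
Proof.
move=> hN.
have dX : dalg (fun P : R[i] => P ^+ 3 * N ^+ 3).
  by apply: dalgM; [apply: dalgX; exact: dalg_id|exact: dalg_cst].
have X1 P : nc P <= 1 -> nc (P ^+ 3 * N ^+ 3) <= 1.
  move=> hP; rewrite ncM !ncX; apply: mulr_ile1; rewrite ?exprn_ge0 ?nc_ge0 //;
  by rewrite exprn_ile1 ?nc_ge0.
have dS : dalg (fun P : R[i] => P + N) by apply: dalgD; [exact: dalg_id|exact: dalg_cst].
split.
  apply: dalgM; first exact: dalg_cst.
  apply: dalgM; last exact: dalg_ev_comp.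
  apply: dalgM; first exact: dalg_cst.
  by apply: dalgM => //; apply: dalgM; [exact: dalg_id|exact: dalg_cst].
apply: dalgM; first exact: dalg_cst.
apply: dalgM; last by apply: dalgX; exact: dalg_ev_comp.
apply: dalgM; last by apply: dalgB => //; exact: dalg_cst.
by apply: dalgM; [exact: dalg_cst|exact: dalgX].
Qed.

Lemma PN_sym l P N : zPN l P N = zPN l N P /\ WPN l P N = WPN l N P.
Proof.
by rewrite /zPN /WPN [N ^+ 3 * _]mulrC [N + P]addrC [N * P]mulrC.
Qed.

Lemma bidisc_in_hull : exists2 l : R, 0 < l & forall P N, nc P <= 1 -> nc N <= 1 ->
  poly_hull K (pt t (zPN l P N) (WPN l P N)).
Proof.
have [e e0 he] := enorm_pt_small t0 d0.
have [By By0 hBy] := dalg_bounded (dalg_ev ly).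
have [Bg Bg0 hBg] := dalg_bounded (dalg_ev lg).
pose B := 2 * By + 16 * Bg ^+ 3 + 1.
have B0 : 0 < B by rewrite ltr_wpDl // addr_ge0 // mulr_ge0 // exprn_ge0.
pose l := Num.min 1 (e / B).
have l0 : 0 < l by rewrite lt_min ltr01 divr_gt0.
have l1 : l <= 1 by rewrite /l ge_min lexx.
have le : l * B <= e by rewrite -ler_pdivlMr // /l ge_min lexx orbT.
have l3 : l ^+ 3 <= l by rewrite exprS ler_piMr ?exprn_ile1 // ltW.
have torus P N : nc P = 1 -> nc N = 1 -> K (pt t (zPN l P N) (WPN l P N)).
  move=> hP hN; split.
    by apply/S_pt; [rewrite gt_eqF|exact: torus_in_S].
  have hX : nc (P ^+ 3 * N ^+ 3) <= 1 by rewrite ncM !ncX hP hN !expr1n mulr1.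
  have hs : nc (P + N) <= 2 by apply: (le_trans (ncD _ _)); rewrite hP hN.
  have s0 := nc_ge0 (P + N).
  have nc4 (a b c v : R[i]) : nc (a * (- 'i * b * c * v)) = nc a * (nc b * nc c * nc v).
    by rewrite !ncM ncN nc_i mul1r.
  apply: he.
    rewrite /zPN 5!ncM nc_i ncR (gtr0_norm l0) hP hN !mul1r.
    apply: le_trans le; rewrite ler_wpM2l ?(ltW l0) //.
    apply: (@le_trans _ _ (2 * By)); last by rewrite /B -addrA lerDl addr_ge0 // mulr_ge0 // exprn_ge0.
    by apply: ler_pM; rewrite ?nc_ge0 ?hBy.
  rewrite /WPN nc4 !ncX ncR (gtr0_norm l0); apply: le_trans le; apply: ler_pM => //; first by rewrite exprn_ge0 // ltW.
    by do !(apply: mulr_ge0); rewrite ?exprn_ge0 ?nc_ge0.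
  apply: (@le_trans _ _ (16 * Bg ^+ 3)); last first.
    rewrite /B addrAC lerDr addr_ge0 // mulr_ge0 //.
  apply: ler_pM; rewrite ?exprn_ge0 ?mulr_ge0 ?exprn_ge0 ?nc_ge0 //; last first.
    by rewrite lerXn2r ?nnegrE ?nc_ge0 ?hBg.
  have h8 : nc (P + N) ^+ 3 <= 8.
    by rewrite (_ : 8 = 2 ^+ 3) ?lerXn2r ?nnegrE // -natrX.
  have hr : nc (P ^+ 3 * N ^+ 3 - r%:C) <= 2.
    by apply: (le_trans (ncB _ _)); rewrite ncR (gtr0_norm r0); apply: lerD => //; exact: ltW.
  have -> : 16 = 8 * 2 :> R by rewrite -natrM.
  by apply: ler_pM; rewrite ?exprn_ge0 ?nc_ge0.
exists l => //.
have step1 P N : nc P <= 1 -> nc N = 1 -> poly_hull K (pt t (zPN l P N) (WPN l P N)).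
  move=> hP hN; have [dz dW] := @dalg_zW l N (ltac:(by rewrite hN)).
  apply: (hull_disc_pt dz dW) hP => u hu; apply: S_sub_hull; exact: torus.
(* The second family of discs runs in [N] and has its boundary in the hull by [step1]; symmetry in
   [P] and [N] lets one disc lemma serve both variables. *)
move=> P N hP hN; have [dz dW] := dalg_zW l hP.
have [-> ->] := PN_sym l P N.
apply: (hull_disc_pt dz dW) hN => u hu.
have [-> ->] := PN_sym l u P; exact: step1.
Qed.

Lemma symmetric_in_hull : exists2 l : R, 0 < l & forall s p : R[i], nc s + nc p < 1 ->
  poly_hull K (pt t (l%:C * ('i * (p * s) * ev y (p ^+ 3)))
    (l%:C ^+ 3 * (- 'i * s ^+ 3 * (p ^+ 3 - r%:C) * ev g (p ^+ 3) ^+ 3))).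
Proof.
have [l l0 h] := bidisc_in_hull; exists l => // s p hsp.
have [P [N [e1 e2 hP hN]]] := quadratic_roots hsp.
by have := h P N hP hN; rewrite /zPN /WPN -exprMn e1 e2.
Qed.

Lemma subr_mul_shift (x x' b a a' : R[i]) :
  (x - b) * a - (x' - b) * a' = (x - x') * a + (x' - b) * (a - a').
Proof. by ring. Qed.

(* Inverts the meromorphic function [W / z^3] of the discs near its pole. *)
Lemma quotient_inverse (rho : R) : 0 < rho -> exists2 k : R, 0 < k &
  forall q : R[i], nc q <= k -> exists2 X, nc X <= rho &
    X * ev y X ^+ 3 = q * ((X - r%:C) * ev g X ^+ 3).
Proof.
move=> rho0.
have [Ly Ly0 hLy] := ev_half_lip ly; have [Lg Lg0 hLg] := ev_half_lip lg.
have [By By0 hBy] := dalg_bounded (dalg_ev ly).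
have [Bg Bg0 hBg] := dalg_bounded (dalg_ev lg).
have cube_lip (a b : R[i]) (B L D : R) : 0 <= B -> nc a <= B -> nc b <= B ->
    nc (a - b) <= L * D -> 0 <= L * D -> nc (a ^+ 3 - b ^+ 3) <= 3 * B ^+ 2 * L * D.
  move=> B0 ha hb hab LD0.
  have -> : a ^+ 3 - b ^+ 3 = (a - b) * (a ^+ 2 + a * b + b ^+ 2) by ring.
  rewrite ncM mulrC -mulrA; apply: ler_pM; rewrite ?nc_ge0 //.
  apply: (le_trans (ncD _ _)); apply: (@le_trans _ _ (B ^+ 2 + B ^+ 2 + B ^+ 2)); last lra.
  apply: lerD; last by rewrite ncX lerXn2r ?nnegrE ?nc_ge0.
  apply: (le_trans (ncD _ _)); apply: lerD; first by rewrite ncX lerXn2r ?nnegrE ?nc_ge0.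
  by rewrite ncM expr2 ler_pM ?nc_ge0.
pose Lv := 3 * By ^+ 2 * Ly.
have Lv0 : 0 <= Lv by rewrite !mulr_ge0 ?sqr_ge0.
pose Lu := Bg ^+ 3 + 2 * (3 * Bg ^+ 2 * Lg).
have Lu0 : 0 <= Lu by rewrite addr_ge0 ?exprn_ge0 // !mulr_ge0 ?sqr_ge0.
pose Bu := 2 * Bg ^+ 3.
have Bu0 : 0 <= Bu by rewrite mulr_ge0 ?exprn_ge0.
pose c := y 0%N ^+ 3.
have c0 : 0 < c by rewrite exprn_gt0.
pose s := Num.min (Num.min rho (1/2)) (c / (8 * (Lv + 1))).
have s0 : 0 < s.
  rewrite !lt_min rho0 /=; apply/andP; split; first lra.
  by rewrite divr_gt0 // mulr_gt0 // ltr_wpDl.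
have sr : s <= rho by rewrite /s !ge_min lexx.
have sh : s <= 1/2 by rewrite /s !ge_min lexx orbT.
have sL : s * Lv <= c / 8.
  have : s <= c / (8 * (Lv + 1)) by rewrite /s ge_min lexx orbT.
  rewrite ler_pdivlMr; last by rewrite mulr_gt0 // ltr_wpDl.
  nra.
pose k := Num.min (c / (4 * (Lu + 1))) (s * c / (2 * (Bu + 1))).
have k0 : 0 < k.
  by rewrite lt_min; apply/andP; split; rewrite divr_gt0 ?mulr_gt0 // ltr_wpDl.
exists k => // q hq.
have qL : nc q * Lu <= c / 4.
  have : nc q <= c / (4 * (Lu + 1)) by apply: (le_trans hq); rewrite /k ge_min lexx.
  rewrite ler_pdivlMr; last by rewrite mulr_gt0 // ltr_wpDl.
  have := nc_ge0 q; nra.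
have qB : nc q * Bu <= s * (c / 2).
  have : nc q <= s * c / (2 * (Bu + 1)) by apply: (le_trans hq); rewrite /k ge_min lexx orbT.
  rewrite ler_pdivlMr; last by rewrite mulr_gt0 // ltr_wpDl.
  have := nc_ge0 q; nra.
pose u X := (X - r%:C) * ev g X ^+ 3.
pose v X := ev y X ^+ 3 - c%:C.
(* Writing [y(X)^3 = c + v(X)] with [v(0) = 0], the equation becomes [c X = q u(X) - X v(X)]. For
   small [q] and [X] the right side divided by [c] is a contraction. *)
pose T X := (q * u X - X * v X) / c%:C.
have ncc : nc (c%:C)^-1 = c^-1 by rewrite ncV ncR gtr0_norm.
have small X : nc X <= s -> [/\ nc X <= 1/2, nc X <= 1 & nc X <= s].
  by move=> h; split=> //; lra.
have hv X X' : nc X <= s -> nc X' <= s -> nc (v X - v X') <= Lv * nc (X - X').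
  move=> /small [h1 h2 _] /small [h1' h2' _]; rewrite /v opprB addrA subrK.
  by apply: cube_lip; rewrite ?hBy ?hLy ?mulr_ge0 ?nc_ge0.
have hv0 X : nc X <= s -> nc (v X) <= Lv * nc X.
  have e0 : v 0 = 0 by rewrite /v ev0 // /c rmorphXn subrr.
  move=> h; have := hv X 0 h; rewrite nc0 (ltW s0) e0 !subr0; exact.
have hu X X' : nc X <= s -> nc X' <= s -> nc (u X - u X') <= Lu * nc (X - X').
  move=> /small [h1 h2 _] /small [h1' h2' _].
  rewrite [u X - u X']subr_mul_shift.
  apply: (le_trans (ncD _ _)); rewrite [nc (_ * ev g X ^+ 3)]ncM [nc ((X' - _) * _)]ncM /Lu mulrDl; apply: lerD.
    by rewrite mulrC ler_wpM2r ?nc_ge0 // ncX lerXn2r ?nnegrE ?nc_ge0 ?hBg.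
  rewrite -mulrA; apply: ler_pM; rewrite ?nc_ge0 //.
    by apply: (le_trans (ncB _ _)); rewrite ncR (gtr0_norm r0); apply: lerD => //; exact: ltW.
  by apply: cube_lip; rewrite ?hBg ?hLg ?mulr_ge0 ?nc_ge0.
have hub X : nc X <= s -> nc (u X) <= Bu.
  move=> /small [h1 h2 _]; rewrite /u ncM; apply: ler_pM; rewrite ?nc_ge0 //.
    by apply: (le_trans (ncB _ _)); rewrite ncR (gtr0_norm r0); apply: lerD => //; exact: ltW.
  by rewrite ncX lerXn2r ?nnegrE ?nc_ge0 ?hBg.
have [X hX TX] : exists2 X, nc X <= s & T X = X.
  apply: complex_fixpoint => // [X hX|X X' hX hX'].
    rewrite /T ncM ncc ler_pdivrMr //; apply: (le_trans (ncB _ _)); rewrite (ncM q) (ncM X).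
    have h1 := ler_wpM2l (nc_ge0 q) (hub X hX).
    have h2 := ler_pM (nc_ge0 X) (nc_ge0 _) hX (hv0 X hX).
    have h3 : s * (Lv * nc X) <= s * (c / 8).
      rewrite ler_wpM2l ?(ltW s0) //; apply: le_trans sL; rewrite mulrC ler_wpM2r //.
    have : 0 < s * c by rewrite mulr_gt0.
    lra.
  rewrite /T -mulrBl ncM ncc ler_pdivrMr //.
  have -> : q * u X - X * v X - (q * u X' - X' * v X') =
     q * (u X - u X') - ((X - X') * v X + X' * (v X - v X')).
    by move: (u X) (u X') (v X) (v X') => a a' b b'; ring.
  apply: (le_trans (ncB _ _)); have D0 := nc_ge0 (X - X').
  have h1 : nc (q * (u X - u X')) <= c / 4 * nc (X - X').
    rewrite ncM; apply: (le_trans (ler_wpM2l (nc_ge0 q) (hu X X' hX hX'))).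
    by rewrite mulrA ler_wpM2r.
  have h2 : nc ((X - X') * v X) <= c / 8 * nc (X - X').
    rewrite ncM mulrC ler_wpM2r //; apply: (le_trans (hv0 X hX)); apply: le_trans sL.
    by rewrite mulrC ler_wpM2r.
  have h3 : nc (X' * (v X - v X')) <= c / 8 * nc (X - X').
    rewrite ncM; apply: (le_trans (ler_pM (nc_ge0 _) (nc_ge0 _) hX' (hv X X' hX hX'))).
    by rewrite mulrA ler_wpM2r.
  have := ncD ((X - X') * v X) (X' * (v X - v X')); lra.
exists X; first exact: le_trans sr.
have cC : c%:C != 0 :> R[i] by rewrite realC_neq0 gt_eqF.
have e : q * u X - X * v X = X * c%:C by rewrite -[in RHS]TX /T divfK.
rewrite -/(u X); have -> : q * u X = X * c%:C + X * v X by rewrite -e subrK.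
by rewrite /v; move: (ev y X ^+ 3) => a; ring.
Qed.

Lemma cube_root (w : R[i]) : exists v, v ^+ 3 = w.
Proof. by exists (3.-root w); apply: rootCK. Qed.

Lemma nc_lt_of_cube (w : R[i]) (b : R) : 0 <= b -> nc w ^+ 3 <= b ^+ 3 -> nc w <= b.
Proof. by move=> b0; rewrite ler_pXn2r ?nnegrE ?nc_ge0. Qed.

(** Inverts the map from [(s, p)] to [(z, W)]: with [X = p^3] the quotient
    [z^3 / W = X y(X)^3 / ((X - r) g(X)^3)] depends on [X] alone. After [X] is found, a cube root
    gives [p], and [s] is read off from [z]. *)
Lemma bicylinder_in_hull : exists k c : R, [/\ 0 < k, 0 < c &
  forall z W, nc z ^+ 3 <= k * nc W -> nc W <= c -> poly_hull K (pt t z W)].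
Proof.
have [l l0 hl] := symmetric_in_hull.
have [Ly Ly0 hLy] := ev_half_lip ly; have [Lg Lg0 hLg] := ev_half_lip lg.
(* The value [1/64] makes [|p| <= 1/4], [r / 2] keeps [X] away from [r], and the last two keep the
   moduli of [y(X)] and [g(X)] above half of their values at 0. *)
pose rho := Num.min (Num.min (1/64%:R) (r / 2))
  (Num.min (y 0%N / (2 * (Ly + 1))) (g 0%N / (2 * (Lg + 1)))).
have pos L : 0 <= L -> 0 < 2 * (L + 1) by move=> h; rewrite mulr_gt0 // ltr_wpDl.
have rho0 : 0 < rho.
  by rewrite !lt_min !divr_gt0 ?pos.
have rho1 : rho <= 1/64%:R by rewrite /rho !ge_min lexx.
have rho2 : rho <= r / 2 by rewrite /rho !ge_min lexx orbT.
have rho3 : rho * Ly <= y 0%N / 2.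
  have : rho <= y 0%N / (2 * (Ly + 1)) by rewrite /rho !ge_min lexx !orbT.
  rewrite ler_pdivlMr ?pos //; nra.
have rho4 : rho * Lg <= g 0%N / 2.
  have : rho <= g 0%N / (2 * (Lg + 1)) by rewrite /rho !ge_min lexx !orbT.
  rewrite ler_pdivlMr ?pos //; nra.
have evlow (c : nat -> R) L X : l1 c -> 0 < c 0%N -> (forall x x', nc x <= 1/2 -> nc x' <= 1/2 ->
     nc (ev c x - ev c x') <= L * nc (x - x')) -> 0 <= L -> rho * L <= c 0%N / 2 -> nc X <= rho ->
     c 0%N / 2 <= nc (ev c X).
  move=> hc c00 hL L0 hrL hX.
  have h0 : nc (0 : R[i]) <= 1/2 by rewrite nc0; lra.
  have := hL X 0 (ltac:(lra)) h0; rewrite subr0 ev0 // => h.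
  have : nc (c 0%N)%:C <= nc (ev c X) + nc (ev c X - (c 0%N)%:C).
    by rewrite ncBC; have := ncD (ev c X) ((c 0%N)%:C - ev c X); rewrite addrC subrK.
  rewrite ncR gtr0_norm //; have : L * nc X <= rho * L by rewrite mulrC ler_wpM2r.
  lra.
have [k k0 hk] := quotient_inverse rho0.
(* Since [|W| >= l^3 |s|^3 (r/2) (g_0/2)^3], the bound [|W| <= c] forces [|s| <= 1/4]. *)
pose c := (1/4 * l) ^+ 3 * (r / 2 * (g 0%N / 2) ^+ 3).
have c0 : 0 < c by rewrite !mulr_gt0 ?exprn_gt0 ?mulr_gt0 ?divr_gt0.
exists k, c; split=> // z W hzW hWc.
have lC : l%:C != 0 :> R[i] by rewrite realC_neq0 gt_eqF.
have iC : 'i != 0 :> R[i] by rewrite -nc_gt0 nc_i.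
have [X hX eX] : exists2 X, nc X <= rho & z ^+ 3 * ((X - r%:C) * ev g X ^+ 3) = W * (X * ev y X ^+ 3).
  have [W0|W0] := eqVneq W 0.
    have z0 : z = 0.
      apply/eqP; rewrite -nc_eq0 -[_ == 0](@expf_eq0 _ _ 3) eq_le exprn_ge0 ?nc_ge0 // andbT.
      by apply: (le_trans hzW); rewrite W0 nc0 mulr0.
    by exists 0; rewrite ?nc0 ?(ltW rho0) // W0 z0 expr0n !mul0r.
  have [X hX e] := hk (z ^+ 3 / W) (ltac:(by rewrite ncM ncV ncX ler_pdivrMr ?nc_gt0)).
  by exists X => //; rewrite e; field.
have [p hp] := cube_root X.
have hyX := evlow y Ly X ly y00 hLy Ly0 rho3 hX.
have hgX := evlow g Lg X lg g00 hLg Lg0 rho4 hX.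
have Y0 : ev y X != 0 by rewrite -nc_gt0; apply: lt_le_trans hyX; rewrite divr_gt0.
have G0 : ev g X != 0 by rewrite -nc_gt0; apply: lt_le_trans hgX; rewrite divr_gt0.
have hXr : r / 2 <= nc (X - r%:C).
  have : nc r%:C <= nc X + nc (X - r%:C).
    by rewrite ncBC; have := ncD X (r%:C - X); rewrite addrC subrK.
  rewrite ncR gtr0_norm //; lra.
have Xr0 : X - r%:C != 0 by rewrite -nc_gt0; apply: lt_le_trans hXr; rewrite divr_gt0.
have cub0 (u : R[i]) : u ^+ 3 = 0 -> u == 0 by move=> /eqP; rewrite expf_eq0.
have [s [es ez]] : exists s, l%:C ^+ 3 * (- 'i * s ^+ 3 * (X - r%:C) * ev g X ^+ 3) = W /\
    l%:C * ('i * (p * s) * ev y X) = z.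
  have [z0|z0] := eqVneq z 0.
    (* When [z = 0], [s] cannot be read off from [z] and is taken from [W] instead; as [W X = 0],
       either [s] or [p] vanishes, so [p s = 0] as required. *)
    have WX : W * X = 0.
      apply: (mulIf (expf_neq0 3 Y0)); rewrite mul0r -mulrA -eX z0.
      by rewrite expr0n mul0r.
    have [s hs] := cube_root (W / (l%:C ^+ 3 * (- 'i * (X - r%:C) * ev g X ^+ 3))).
    have es : l%:C ^+ 3 * (- 'i * s ^+ 3 * (X - r%:C) * ev g X ^+ 3) = W.
      by rewrite hs; field; rewrite lC iC Xr0 G0.
    exists s; split=> //; rewrite z0; apply/eqP; rewrite !mulf_eq0 (negbTE lC) (negbTE iC) (negbTE Y0) /= orbF.
    move/eqP: WX; rewrite mulf_eq0 => /orP[] /eqP h0.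
      by rewrite [s == 0]cub0 ?orbT // hs h0 mul0r.
    by rewrite cub0 // hp.
  have X0 : X != 0.
    apply: contra_neq z0 => X0; apply/eqP/cub0/eqP.
    have := eX; rewrite {3}X0 mul0r mulr0 => /eqP; rewrite mulf_eq0 => /orP[// |].
    by rewrite mulf_eq0 (negbTE Xr0) expf_eq0 /= (negbTE G0).
  have p0 : p != 0 by apply: contra_neq X0 => p0; rewrite -hp p0 expr0n.
  exists (z / (l%:C * 'i * p * ev y X)); split; last by field; rewrite lC iC p0 Y0.
  apply: (mulIf (mulf_neq0 X0 (expf_neq0 3 Y0))); rewrite -eX.
  have -> : (z / (l%:C * 'i * p * ev y X)) ^+ 3 = z ^+ 3 / (l%:C ^+ 3 * (- 'i) * X * ev y X ^+ 3).
    by rewrite expr_div_n !exprMn iC3 hp.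
  by field; rewrite lC iC X0 Y0.
have hs4 : nc s <= 1/4.
  apply: nc_lt_of_cube; first lra.
  have nc4 (a b u v : R[i]) : nc (a * (- 'i * b * u * v)) = nc a * (nc b * nc u * nc v).
    by rewrite !ncM ncN nc_i mul1r.
  have := hWc; rewrite -es nc4 !ncX ncR (gtr0_norm l0).
  have l3 : 0 < l ^+ 3 by rewrite exprn_gt0.
  have q0 : 0 < r / 2 * (g 0%N / 2) ^+ 3 by rewrite mulr_gt0 ?exprn_gt0 ?divr_gt0.
  have -> : c = l ^+ 3 * ((1/4) ^+ 3 * (r / 2 * (g 0%N / 2) ^+ 3)).
    rewrite /c [(1/4 * l) ^+ 3]exprMn; move: (r / 2 * _) ((1/4) ^+ 3) (l ^+ 3) => Q a b; by rewrite mulrA [b * a]mulrC.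
  rewrite (ler_pM2l l3) -mulrA => h.
  have h2 : r / 2 * (g 0%N / 2) ^+ 3 <= nc (X - r%:C) * nc (ev g X) ^+ 3.
    apply: ler_pM => //; rewrite ?exprn_ge0 ?divr_ge0 ?(ltW r0) ?(ltW g00) //.
    by rewrite lerXn2r ?nnegrE ?nc_ge0 // divr_ge0 // ltW.
  rewrite -(ler_pM2r q0); apply: (le_trans _ h); rewrite ler_wpM2l ?exprn_ge0 ?nc_ge0 //.
have hp4 : nc p <= 1/4.
  apply: nc_lt_of_cube; first lra.
  rewrite -ncX hp; apply: (le_trans hX); apply: (le_trans rho1).
  rewrite (_ : (1/4) ^+ 3 = 1/64%:R) //; by field.
have hsp : nc s + nc p < 1 by move: (nc s) (nc p) hs4 hp4 => a b; lra.
by have := hl s p hsp; rewrite hp es ez.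
Qed.

(** Where [|z|^3 > k |W|], the vertical disc over [z] of radius [|z|^3 / k] passes through the point
    and has its boundary in the region already covered. *)
Lemma ball_in_hull : exists2 b : R, 0 < b & eball 0 b `<=` poly_hull K.
Proof.
have [k [c [k0 c0 h]]] := bicylinder_in_hull.
have full z W : nc z ^+ 3 <= k * c -> nc W <= c -> poly_hull K (pt t z W).
  move=> hz hW; case: (leP (nc z ^+ 3) (k * nc W)) => hzW; first exact: h.
  pose s := nc z ^+ 3 / k.
  have sk : k * s = nc z ^+ 3 by rewrite mulrCA divff ?mulr1 // gt_eqF.
  have Ws : nc W < s by rewrite -(ltr_pM2l k0) sk.
  have s0 : 0 < s by apply: le_lt_trans Ws; exact: nc_ge0.
  have sC : s%:C != 0 :> R[i] by rewrite realC_neq0 gt_eqF.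
  have -> : W = s%:C * (W / s%:C) by rewrite mulrC divfK.
  apply: (@hull_disc_pt _ K t (fun _ => z) (fun x => s%:C * x)).
  - exact: dalg_cst.
  - by apply: dalgM; [exact: dalg_cst|exact: dalg_id].
  - move=> u hu; apply: h; rewrite ncM hu mulr1 ncR gtr0_norm ?sk //.
    by rewrite -(ler_pM2l k0) sk.
  - by rewrite ncM ncV ncR gtr0_norm // ler_pdivrMr // mul1r ltW.
(* The last bound controls [W = 3 t w + z^3] by [c]; the first two give [|z|^3 <= |z| <= k c]. *)
pose b := Num.min 1 (Num.min (k * c) (c / (3 * t + 1))).
have t3 : 0 < 3 * t + 1 by rewrite ltr_wpDl // mulr_ge0 // ltW.
have b0 : 0 < b by rewrite !lt_min ltr01 mulr_gt0 // divr_gt0.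
have b1 : b <= 1 by rewrite /b !ge_min lexx.
have bk : b <= k * c by rewrite /b !ge_min lexx orbT.
have bc : b * (3 * t + 1) <= c by rewrite -ler_pdivlMr // /b !ge_min lexx !orbT.
exists b => // u; rewrite /eball /= subr0 => hu.
have h0 : nc (u 0 0) <= b by apply: (le_trans (nc_le_enorm _ _)); exact: ltW.
have h1 : nc (u 0 1) <= b by apply: (le_trans (nc_le_enorm _ _)); exact: ltW.
have h3 : nc (u 0 0) ^+ 3 <= b.
  apply: (le_trans _ h0); rewrite exprS ler_piMr ?nc_ge0 // exprn_ile1 ?nc_ge0 //.
  exact: le_trans b1.
rewrite (@ptE _ t u) ?gt_eqF //; apply: full; first exact: le_trans bk.
apply: (le_trans (ncD _ _)); rewrite ncX !ncM -(rmorph_nat (real_complex R)) !ncR normr_nat (gtr0_norm t0).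
apply: le_trans bc; have : 3 * t * nc (u 0 1) <= 3 * t * b.
  by rewrite ler_wpM2l // mulr_ge0 // ltW.
lra.
Qed.

End BallInHull.

Section PartTwo.
Variable R : realType.

Lemma part_two (t : R) : 0 < t -> t < Num.sqrt 3 / 2 -> forall d : R, 0 < d ->
  exists2 b : R, 0 < b & eball 0 b `<=` poly_hull (S_ t `&` closed_eball 0 d).
Proof.
move=> t0 ts d d0.
have [r [g [/andP[r0 r1] g0 gr hg]]] := hankel_eigenvector t0 ts.
have [y hy] := wiener_hopf_pair t0 r0 r1 g0 gr hg.
have hy1 k := proj1 (hy k); have hy2 k := proj2 (hy k).
apply: (@ball_in_hull _ t r g y) => //.
- exact: (l1_g r0 r1 g0 gr).
- exact: (l1_y t0 r0 r1 g0 gr hy2).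
- exact: (y_gt0 t0 r0 g0 hy2).
- exact: (circle_cube t0 r0 r1 g0 gr hy1 hy2).
Qed.

End PartTwo.

(** * A Fuchsian system and its power series solutions *)

Section Lyapunov.
Variable R : realType.
Implicit Types (e h p s W : R).

Lemma normM_le (a b A B : R) : `|a| <= A -> `|b| <= B -> `|a * b| <= A * B.
Proof. by move=> ha hb; rewrite normrM ler_pM. Qed.

(* Lyapunov function for [p' = - (p / 3 + e s)], [s' = p], the limit for large [n] of the
   recursion in the time [ln n], with [s = (n + c) F_n] and [p = (n + c - 1/3) g_n]. *)
Definition lyap e p s : R := p ^+ 2 + e / 4 * (s * p) + e * s ^+ 2.

Lemma lyap_le e p s : 0 < e <= 1 -> lyap e p s <= (`|p| + `|s|) ^+ 2.
Proof.
move=> /andP[e0 e1]; rewrite /lyap sqrrD !real_normK ?num_real //.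
have h1 : e / 4 * (s * p) <= `|p| * `|s|.
  apply: (le_trans (ler_norm _)); rewrite normrM [`|s * p|]normrM [`|s| * _]mulrC ler_piMl ?mulr_ge0 //.
  by rewrite ger0_norm; lra.
have h2 : e * s ^+ 2 <= s ^+ 2 by rewrite ler_piMl ?sqr_ge0.
have := mulr_ge0 (normr_ge0 p) (normr_ge0 s); lra.
Qed.

Lemma lyap_ge e p s : 0 < e <= 1 -> e / 4 * (`|p| + `|s|) ^+ 2 <= lyap e p s.
Proof.
move=> /andP[e0 e1]; rewrite /lyap.
have h : (`|p| + `|s|) ^+ 2 <= 2 * p ^+ 2 + 2 * s ^+ 2.
  rewrite -(real_normK (num_real p)) -(real_normK (num_real s)).
  have := sqr_ge0 (`|p| - `|s|); lra.
have h2 := ler_wpM2l (ltW e0) h.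
have h3 : 0 <= e * (p + s) ^+ 2 by rewrite mulr_ge0 ?sqr_ge0 // ltW.
have h4 : 0 <= e * s ^+ 2 by rewrite mulr_ge0 ?sqr_ge0 // ltW.
have h5 : e * p ^+ 2 <= p ^+ 2 by rewrite ler_piMl ?sqr_ge0.
have := sqr_ge0 p; lra.
Qed.

(** One Euler step of length [h]. The damping acts on [p] only, and the cross term of [lyap] passes
    it on to [s], giving a first-order loss of [e^2 / 16] times [W^2]. The second-order terms total
    at most [111 h^2 W^2], and the bound on [h] lets them use up half of that loss. *)
Lemma lyap_decay e p s p' s' h : 0 < e <= 1 -> 0 < h -> h <= e ^+ 2 / (32%:R * 111%:R) ->
  let W := `|p| + `|s| in
  `|p' - p + h * (p / 3 + e * s)| <= 2 * h ^+ 2 * W ->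
  `|s' - s - h * p| <= 7%:R * h ^+ 2 * W ->
  lyap e p' s' <= (1 - h * (e ^+ 2 / 32%:R)) * lyap e p s.
Proof.
move=> he h0 hh W; have /andP[e0 e1] := he.
set E1 := p' - p + _; set E2 := s' - s - _ => hE1 hE2.
have W0 : 0 <= W by rewrite addr_ge0.
have ee : e ^+ 2 <= 1 by rewrite expr_le1 // ltW.
have h1 : h <= 1 by lra.
have hp : `|p| <= W by rewrite lerDl.
have hs : `|s| <= W by rewrite lerDr.
have hW2 : h ^+ 2 * W <= h * W.
  by rewrite expr2 -mulrA; apply: ler_piMl => //; rewrite mulr_ge0 // ltW.
have hd1 : `|E1 - h * (p / 3 + e * s)| <= 3 * (h * W).
  apply: (le_trans (ler_normB _ _)); have : `|h * (p / 3 + e * s)| <= h * W.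
    rewrite normrM gtr0_norm // ler_wpM2l ?(ltW h0) //; apply: (le_trans (ler_normD _ _)).
    have a1 : `|p / 3| <= `|p| by rewrite normrM [`|3^-1|]ger0_norm ?ler_piMr //; lra.
    have a2 : `|e * s| <= `|s| by rewrite normrM (gtr0_norm e0) ler_piMl.
    exact: lerD.
  lra.
have hd2 : `|E2 + h * p| <= 8%:R * (h * W).
  apply: (le_trans (ler_normD _ _)); have : `|h * p| <= h * W.
    by rewrite normrM gtr0_norm // ler_wpM2l // ltW.
  lra.
set d1 := E1 - _ in hd1; set d2 := E2 + _ in hd2.
have ep : p' = p + d1 by rewrite /d1 /E1; ring.
have es : s' = s + d2 by rewrite /d2 /E2; ring.
pose k := h ^+ 2 * W ^+ 2; have k0 : 0 <= k by rewrite mulr_ge0 ?sqr_ge0.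
have kE1 (a : R) : `|a| <= W -> `|a * E1| <= 2 * k.
  by move=> ha; apply: (le_trans (normM_le ha hE1)); rewrite /k le_eqVlt; apply/orP; left; apply/eqP; ring.
have kE2 (a : R) : `|a| <= W -> `|a * E2| <= 7%:R * k.
  by move=> ha; apply: (le_trans (normM_le ha hE2)); rewrite /k le_eqVlt; apply/orP; left; apply/eqP; ring.
have q11 : `|d1 * d1| <= 9%:R * k.
  by apply: (le_trans (normM_le hd1 hd1)); rewrite /k le_eqVlt; apply/orP; left; apply/eqP; ring.
have q12 : `|d1 * d2| <= 24%:R * k.
  by apply: (le_trans (normM_le hd1 hd2)); rewrite /k le_eqVlt; apply/orP; left; apply/eqP; ring.
have q22 : `|d2 * d2| <= 64%:R * k.
  by apply: (le_trans (normM_le hd2 hd2)); rewrite /k le_eqVlt; apply/orP; left; apply/eqP; ring.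
have en (a B : R) : `|a| <= B -> e * a <= B.
  move=> ha; apply: (le_trans (ler_norm _)); rewrite normrM (gtr0_norm e0).
  by apply: le_trans ha; rewrite ler_piMl.
have id : lyap e p' s' - lyap e p s =
    - h * ((2/3 - e / 4) * p ^+ 2 + e / 12%:R * (s * p) + e ^+ 2 / 4 * s ^+ 2) +
    (2 * (p * E1) + (e * (s * E1) + e * (p * E2)) / 4 + 2 * (e * (s * E2)) + d1 * d1 +
     e * (d1 * d2) / 4 + e * (d2 * d2)).
  by rewrite /lyap ep es /d1 /d2; field.
have rest : 2 * (p * E1) + (e * (s * E1) + e * (p * E2)) / 4 + 2 * (e * (s * E2)) + d1 * d1 +
     e * (d1 * d2) / 4 + e * (d2 * d2) <= 111%:R * k.
  have a1 := le_trans (ler_norm _) (kE1 _ hp).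
  have a2 := en _ _ (kE1 _ hs).
  have a3 := en _ _ (kE2 _ hp).
  have a4 := en _ _ (kE2 _ hs).
  have a5 := le_trans (ler_norm _) q11.
  have a6 := en _ _ q12.
  have a7 := en _ _ q22.
  lra.
have main : e ^+ 2 / 16%:R * W ^+ 2 <=
    (2/3 - e / 4) * p ^+ 2 + e / 12%:R * (s * p) + e ^+ 2 / 4 * s ^+ 2.
  have hW : W ^+ 2 <= 2 * p ^+ 2 + 2 * s ^+ 2.
    rewrite /W -(real_normK (num_real p)) -(real_normK (num_real s)).
    have := sqr_ge0 (`|p| - `|s|); lra.
  have b1 := ler_wpM2l (sqr_ge0 e) hW.
  have b2 : e ^+ 2 * p ^+ 2 <= p ^+ 2 by rewrite ler_piMl ?sqr_ge0.
  have b3 : e * p ^+ 2 <= p ^+ 2 by rewrite ler_piMl ?sqr_ge0.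
  have b4 := sqr_ge0 (p + e * s).
  have b5 : 0 <= e ^+ 2 * s ^+ 2 by rewrite mulr_ge0 ?sqr_ge0.
  have b6 := sqr_ge0 p.
  have -> : e / 12%:R * (s * p) = ((p + e * s) ^+ 2 - p ^+ 2 - e ^+ 2 * s ^+ 2) / 24%:R by field.
  lra.
have W2 : 0 <= h * W ^+ 2 by rewrite mulr_ge0 ?sqr_ge0 // ltW.
have kh : 111%:R * k <= h * (e ^+ 2 / 32%:R * W ^+ 2).
  have := ler_wpM2r W2 hh; rewrite /k; lra.
have hm := ler_wpM2l (ltW h0) main.
have hl := ler_wpM2l (ltW h0) (ler_wpM2l (sqr_ge0 e) (lyap_le p s he)).
rewrite -/W in hl; lra.
Qed.

End Lyapunov.

Section StepErrors.
Variable R : realType.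

Lemma inv_shift_le (n b B : R) : 0 < n + 1 -> n + 1 <= B * b -> 0 < b ->
  `|(n + 1)^-1 - b^-1| <= B * `|b - (n + 1)| * (n + 1)^-1 ^+ 2.
Proof.
move=> n1 hB b0; have b0' : b != 0 by rewrite gt_eqF.
have n0' : n + 1 != 0 :> R by rewrite gt_eqF.
set h := (n + 1)^-1; have h0 : 0 < h by rewrite invr_gt0.
have -> : h - b^-1 = (b - (n + 1)) * h * b^-1 by rewrite /h; field; rewrite ?n0' ?b0'.
rewrite !normrM (gtr0_norm h0) [`|b^-1|]gtr0_norm ?invr_gt0 //.
have bB : b^-1 <= B * h by rewrite /h ler_pdivlMr // mulrC ler_pdivrMr.
have -> : B * `|b - (n + 1)| * h ^+ 2 = `|b - (n + 1)| * h * (B * h) by ring.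
by rewrite ler_wpM2l // mulr_ge0 // ltW.
Qed.

(** The recursion is an Euler step except that [1 / (n + c - 1/3)], [1 / (n + c)] and
    [1 / (n + 1 + c - 1/3)] stand where [h = 1 / (n + 1)] should; each replacement costs
    [O(h^2)]. *)
Lemma step_errors (n c e F g F' g' : R) : 1 <= n -> 0 <= c -> c <= 1/3 -> 0 < e -> e <= 1 ->
  (n + 1)^-1 <= 1/(32%:R * 111%:R) ->
  (n + 1 + c - 1/3) * g' = (n + 1 + c - 5/3) * g - e * F ->
  (n + 1 + c) * F' = (n + c) * F + g' ->
  let h := (n + 1)^-1 in let p := (n + c - 1/3) * g in let s := (n + c) * F in
  let p' := (n + 1 + c - 1/3) * g' in let s' := (n + 1 + c) * F' in
  let W := `|p| + `|s| in
  `|p' - p + h * (p / 3 + e * s)| <= 2 * h ^+ 2 * W /\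
  `|s' - s - h * p| <= 7%:R * h ^+ 2 * W.
Proof.
move=> n1 c0 c1 e0 e1 h1 hg hF h p s p' s' W.
have n0 : 0 < n + 1 by move: n1; clear; lra.
have h0 : 0 < h by rewrite invr_gt0.
have n13 : 0 < n + c - 1/3 by move: n1 c0; clear; lra.
have nc : 0 < n + c by move: n1 c0; clear; lra.
have n23 : 0 < n + 1 + c - 1/3 by move: n1 c0; clear; lra.
have W0 : 0 <= W by rewrite addr_ge0.
have hp : `|p| <= W by rewrite lerDl.
have hs : `|s| <= W by rewrite lerDr.
have gE : g = p * (n + c - 1/3)^-1 by rewrite /p mulrC mulKf // gt_eqF.
have FE : F = s * (n + c)^-1 by rewrite /s mulrC mulKf // gt_eqF.
have gE' : g' = p' * (n + 1 + c - 1/3)^-1 by rewrite /p' mulrC mulKf // gt_eqF.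
have pE : p' - p = - (1/3) * g - e * F by rewrite /p' hg /p; field.
have sE : s' - s = g' by rewrite /s' hF /s; ring.
have q1 : `|h - (n + c - 1/3)^-1| <= 4 * h ^+ 2.
  apply: (le_trans (@inv_shift_le _ _ 3 n0 _ n13)); first by move: n1 c0; clear; lra.
  rewrite ler_wpM2r ?sqr_ge0 // ler0_norm; first by move: c0; clear; lra.
  by move: c1; clear; lra.
have q2 : `|h - (n + c)^-1| <= 2 * h ^+ 2.
  apply: (le_trans (@inv_shift_le _ _ 2 n0 _ nc)); first by move: n1 c0; clear; lra.
  rewrite ler_wpM2r ?sqr_ge0 // ler0_norm; first by move: c0; clear; lra.
  by move: c1; clear; lra.
have q3 : `|h - (n + 1 + c - 1/3)^-1| <= h ^+ 2.
  apply: (le_trans (@inv_shift_le _ _ 2 n0 _ n23)); first by move: n1 c0; clear; lra.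
  rewrite -[leRHS]mul1r ler_wpM2r ?sqr_ge0 // ler0_norm; first by move: c0; clear; lra.
  by move: c1; clear; lra.
rewrite -/h in h1; clearbody p s p' s' h.
have E1 : `|p' - p + h * (p / 3 + e * s)| <= 2 * h ^+ 2 * W.
  have -> : p' - p + h * (p / 3 + e * s) =
     1/3 * (p * (h - (n + c - 1/3)^-1)) + e * (s * (h - (n + c)^-1)).
    by rewrite pE gE FE; ring.
  have r1 := normM_le (lexx `|p|) q1; have r2 := normM_le (lexx `|s|) q2.
  apply: (le_trans (ler_normD _ _)).
  have r3 : `|e * (s * (h - (n + c)^-1))| <= `|s| * (2 * h ^+ 2).
    by rewrite normrM (gtr0_norm e0); apply: le_trans r2; rewrite ler_piMl.
  have r4 : `|1/3 * (p * (h - (n + c - 1/3)^-1))| <= 1/3 * (`|p| * (4 * h ^+ 2)).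
    have t0 : 0 <= 1/3 :> R by clear; lra.
    by rewrite normrM (ger0_norm t0); exact: ler_wpM2l.
  have k0 : 0 <= `|p| * h ^+ 2 by rewrite mulr_ge0 ?sqr_ge0.
  by rewrite /W; move: r3 r4 k0; clear; lra.
split=> //.
have d1 : `|p' - p| <= 3 * (h * W).
  have hW2 : h ^+ 2 * W <= h * W.
    by rewrite expr2 -mulrA; apply: ler_piMl; [rewrite mulr_ge0 // ltW|move: h1; clear; lra].
  have -> : p' - p = (p' - p + h * (p / 3 + e * s)) - h * (p / 3 + e * s) by ring.
  apply: (le_trans (ler_normB _ _)).
  have : `|h * (p / 3 + e * s)| <= h * W.
    rewrite normrM gtr0_norm // ler_wpM2l ?(ltW h0) //; apply: (le_trans (ler_normD _ _)).
    have a1 : `|p / 3| <= `|p| by rewrite normrM [`|3^-1|]ger0_norm ?ler_piMr //; clear; lra.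
    have a2 : `|e * s| <= `|s| by rewrite normrM (gtr0_norm e0) ler_piMl.
    exact: lerD.
  by move: E1 hW2; clear; lra.
have -> : s' - s - h * p = - (p' * (h - (n + 1 + c - 1/3)^-1)) + h * (p' - p).
  by rewrite sE gE'; ring.
have hp' : `|p'| <= 4 * W.
  have -> : p' = p + (p' - p) by ring.
  apply: (le_trans (ler_normD _ _)).
  have : h * W <= W by rewrite ler_piMl //; move: h1; clear; lra.
  by move: hp d1; clear; lra.
apply: (le_trans (ler_normD _ _)); rewrite normrN normrM [`|h * _|]normrM (gtr0_norm h0).
have r1 : `|p'| * `|h - (n + 1 + c - 1/3)^-1| <= 4 * W * h ^+ 2 by apply: ler_pM.
have r2 := ler_wpM2l (ltW h0) d1.
by move: r1 r2; clear; lra.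
Qed.

Lemma denom_neq0 (m : nat) (c : R) : 0 <= c ->
  (m.+1%:R + c - 1/3 != 0) * (m.+1%:R + c != 0).
Proof.
have m1 : 1 <= m.+1%:R :> R by rewrite ler1n.
by move=> c0; split; rewrite gt_eqF //; move: m1 c0; clear; lra.
Qed.

End StepErrors.

(** * Decay and summability of the Taylor coefficients *)

Section Recursion.
Variables (R : realType) (e c : R).

(* Taylor coefficients [(F, g)] of the solution of [(1 - x) (x F' + c F) = g] and
   [(1 - x) (x g' + c g) = (1/3) g - (2/3) x g - e x F]. *)
Fixpoint FGrec (n : nat) : R * R :=
  if n is m.+1 then
    let G' := ((m.+1%:R + c - 5/3) * (FGrec m).2 - e * (FGrec m).1) / (m.+1%:R + c - 1/3) in
    (((m%:R + c) * (FGrec m).1 + G') / (m.+1%:R + c), G')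
  else (1, c).

Definition Fs n := (FGrec n).1.
Definition Gs n := (FGrec n).2.

Hypotheses (he : 0 < e <= 1) (hc : 0 <= c <= 1/3) (hcc : c * (c - 1/3) = 0).

Let c0 : 0 <= c. Proof. by case/andP: hc. Qed.
Let c1 : c <= 1/3. Proof. by case/andP: hc. Qed.
Let e0 : 0 < e. Proof. by case/andP: he. Qed.

Lemma GsS m : (m.+1%:R + c - 1/3) * Gs m.+1 = (m.+1%:R + c - 5/3) * Gs m - e * Fs m.
Proof.
by rewrite {1}/Gs /= -/(Gs m) -/(Fs m) mulrC divfK // (denom_neq0 m c0).1.
Qed.

Lemma FsS m : (m.+1%:R + c) * Fs m.+1 = (m%:R + c) * Fs m + Gs m.+1.
Proof.
by rewrite {1}/Fs /= -/(Gs m.+1) -/(Fs m) mulrC divfK // (denom_neq0 m c0).2.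
Qed.

Let s n := (n%:R + c) * Fs n.
Let p n := (n%:R + c - 1/3) * Gs n.

(* Together with [sum_FsGs], this makes both sums vanish, since the right-hand sides tend to 0. *)
Lemma sum_Gs n : \sum_(i < n.+1) Gs i = (n%:R + c) * Fs n.
Proof.
elim: n => [|n IH]; first by rewrite big_ord1 /Fs /Gs /= add0r mulr1.
by rewrite big_ord_recr /= IH FsS.
Qed.

Lemma sum_FsGs n : \sum_(i < n) (e * Fs i + 1/3 * Gs i) = - ((n%:R + c - 1/3) * Gs n).
Proof.
elim: n => [|n IH]; first by rewrite big_ord0 /Gs /= add0r mulrC hcc oppr0.
by rewrite big_ord_recr /= IH GsS -[n.+1%:R]natr1; field.
Qed.

Let w n := `|p n| + `|s n|.

Lemma decay_step n : (0 < n)%N -> n.+1%:R^-1 <= e ^+ 2 / (32%:R * 111%:R) ->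
  lyap e (p n.+1) (s n.+1) <= (1 - n.+1%:R^-1 * (e ^+ 2 / 32%:R)) * lyap e (p n) (s n).
Proof.
move=> n0 hn; have n1 : 1 <= n%:R :> R by rewrite ler1n.
have e1 : e <= 1 by case/andP: he.
have ee : e ^+ 2 <= 1 by rewrite expr_le1 // ltW.
have hs : (n%:R + 1)^-1 <= 1/(32%:R * 111%:R) :> R by rewrite natr1; apply: (le_trans hn); lra.
have /= := step_errors n1 c0 c1 e0 e1 hs; rewrite natr1 => /(_ _ _ _ _ (GsS n) (FsS n)) [E1 E2].
by apply: lyap_decay => //; rewrite invr_gt0 ltr0n.
Qed.

Lemma bdd_unshiftn (u : nat -> R) m : bdd (fun i => u (i + m)%N) -> bdd u.
Proof.
elim: m u => [|m IH] u h.
  by apply: bdd_le h => i; rewrite addn0.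
apply: bdd_unshift; apply: IH; apply: bdd_le h => i; by rewrite addnS.
Qed.

Let S n := Num.sqrt (lyap e (p n) (s n)).
Let eta := e ^+ 2 / 64%:R.

Let V_ge0 n : 0 <= lyap e (p n) (s n).
Proof.
apply: le_trans (lyap_ge _ _ he); rewrite mulr_ge0 ?sqr_ge0 // ltW // divr_gt0 //.
Qed.

(** Passing to square roots halves the rate, as [1 - 2 h eta <= (1 - h eta)^2]. In this linear form
    the inequality telescopes, which yields the summability of [S n / (n + 1)] and with it that of
    the coefficients. *)
Let S_step : exists n0, forall n, (n0 <= n)%N -> n.+1%:R^-1 * eta * S n <= S n - S n.+1.
Proof.
have ee : 0 < e ^+ 2 by rewrite exprn_gt0.
have e1 : e ^+ 2 <= 1 by case/andP: he => ? ?; rewrite expr_le1 // ltW.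
have e2 : 0 < e ^+ 2 / (32%:R * 111%:R) by rewrite divr_gt0.
have [N] := ltr_add_invr e2; rewrite add0r => hN.
exists N.+1 => n Nn; have n0 : (0 < n)%N by apply: leq_trans Nn.
have hn : n.+1%:R^-1 <= e ^+ 2 / (32%:R * 111%:R).
  by apply: le_trans (ltW hN); rewrite lef_pV2 ?posrE ?ltr0n // ler_nat ltnW.
have h1 := decay_step n0 hn; have h0 : 0 < n.+1%:R^-1 :> R by rewrite invr_gt0 ltr0n.
move: n.+1%:R^-1 hn h1 h0 => h hn h1 h0.
have q0 : 0 <= 1 - h * eta.
  have : h * eta <= 1 * 1 by apply: ler_pM; rewrite /eta; lra.
  lra.
have : S n.+1 <= (1 - h * eta) * S n.
  have -> : (1 - h * eta) * S n = Num.sqrt ((1 - h * eta) ^+ 2 * lyap e (p n) (s n)).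
    by rewrite sqrtrM ?sqr_ge0 // sqrtr_sqr ger0_norm.
  apply: ler_wsqrtr; apply: (le_trans h1); rewrite ler_wpM2r //.
  have := sqr_ge0 (h * eta); rewrite /eta; lra.
lra.
Qed.

Let S_ge0 n : 0 <= S n. Proof. exact: sqrtr_ge0. Qed.

Let eta0 : 0 < eta. Proof. by rewrite divr_gt0 ?exprn_gt0. Qed.

Let S_bdd : bdd (fun n => n.+1%:R^-1 * S n).
Proof.
have [n0 h] := S_step; apply: (@bdd_unshiftn _ n0); exists (S n0 / eta) => N.
rewrite ler_pdivlMr // mulr_suml.
have : \sum_(i < N) ((i + n0).+1%:R^-1 * S (i + n0) * eta) <= \sum_(i < N) (S (i + n0) - S (i.+1 + n0)).
  by apply: ler_sum => i _; rewrite mulrAC addSn; apply: h; rewrite leq_addl.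
move/le_trans; apply.
rewrite -(big_mkord xpredT (fun i => S (i + n0) - S (i.+1 + n0))).
under eq_bigr do rewrite -opprB.
by rewrite sumrN (telescope_sumr (fun i => S (i + n0))) // add0n opprB gerBl.
Qed.

(** If [S] stayed above [d], the bounded sums of [S n / (n + 1)] would dominate [d] times the
    harmonic series. *)
Let S_small (d : R) : 0 < d -> exists N, forall n, (N <= n)%N -> S n <= d.
Proof.
move=> d0; have [n0 h] := S_step.
have Sni n : (n0 <= n)%N -> S n.+1 <= S n.
  move=> nn; rewrite -subr_ge0; apply: le_trans (h n nn).
  by rewrite !mulr_ge0 ?invr_ge0 // ltW.
suff [N /andP[nN hN]] : exists N, (n0 <= N)%N && (S N <= d).
  exists N => n /subnK <-; elim: (n - N)%N => [//|k IH].
  by rewrite addSn; apply: le_trans IH; apply: Sni; rewrite (leq_trans nN) ?leq_addl.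
apply: contrapT => /forallNP hn.
have hS n : (n0 <= n)%N -> d <= S n.
  by move=> nn; rewrite leNgt; apply/negP => lt; apply: (hn n); rewrite nn ltW.
have [M hM] := S_bdd.
have [N hN] := @harmonic_unbounded R ((M + 1) / d + \sum_(j < n0) j.+1%:R^-1).
have dN : d * \sum_(n0 <= j < n0 + N) j.+1%:R^-1 <= M.
  apply: le_trans (hM (n0 + N)%N); rewrite -(big_mkord xpredT (fun j => j.+1%:R^-1 * S j)).
  rewrite [leRHS](big_cat_nat (n := n0)) ?leq_addr //= mulr_sumr.
  apply: (@le_trans _ _ (\sum_(n0 <= j < n0 + N) j.+1%:R^-1 * S j)).
    apply: ler_sum_nat => j /andP[nj _].
    by rewrite mulrC ler_wpM2l ?invr_ge0 // hS.
  by rewrite lerDr sumr_ge0 // => j _; rewrite mulr_ge0 ?invr_ge0.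
have hle : \sum_(j < N) j.+1%:R^-1 <= \sum_(j < n0) j.+1%:R^-1 + \sum_(n0 <= j < n0 + N) j.+1%:R^-1 :> R.
  rewrite -!(big_mkord xpredT (fun j => j.+1%:R^-1)) -big_cat_nat ?leq_addr //=.
  rewrite [leRHS](big_cat_nat (n := N)) ?leq_addl //= lerDl sumr_ge0 //.
have : (M + 1) / d <= \sum_(n0 <= j < n0 + N) j.+1%:R^-1 by have := le_trans hN hle; rewrite addrC lerD2l.
rewrite ler_pdivrMr // mulrC; lra.
Qed.

Let w_le n : w n <= 2 / Num.sqrt e * S n.
Proof.
have W0 : 0 <= w n by rewrite addr_ge0.
have se : 0 < Num.sqrt e by rewrite sqrtr_gt0.
rewrite mulrAC ler_pdivlMr // -[w n](ger0_norm W0) -sqrtr_sqr -sqrtrM ?sqr_ge0 //.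
have -> : 2 * S n = Num.sqrt (4 * lyap e (p n) (s n)).
  by rewrite sqrtrM // (_ : 4 = 2 ^+ 2) ?sqrtr_sqr ?ger0_norm // -natrX.
apply: ler_wsqrtr; have := lyap_ge (p n) (s n) he; rewrite -/(w n); lra.
Qed.

Lemma pole_decay (d : R) : 0 < d ->
  exists N, forall n, (N <= n)%N -> `|p n| <= d /\ `|s n| <= d.
Proof.
move=> d0; have se : 0 < Num.sqrt e by rewrite sqrtr_gt0.
have [N hN] := @S_small (d / (2 / Num.sqrt e)) (ltac:(by rewrite !divr_gt0)).
exists N => n Nn; have wd : w n <= d.
  by apply: (le_trans (w_le n)); rewrite mulrC -ler_pdivlMr ?divr_gt0 // hN.
by split; apply: le_trans wd; rewrite ?lerDl ?lerDr.
Qed.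

Let w_bdd : bdd (fun n => n.+1%:R^-1 * w n).
Proof.
have se : 0 <= 2 / Num.sqrt e by rewrite divr_ge0 // sqrtr_ge0.
apply: bdd_le (bddZ se S_bdd) => n; rewrite mulrCA ler_wpM2l ?invr_ge0 //.
Qed.

Lemma Fs_bound n : (0 < n)%N -> `|Fs n| <= 2 * (n.+1%:R^-1 * w n).
Proof.
move=> n0; have n1 : 1 <= n%:R :> R by rewrite ler1n.
have c0' := c0; have nc : 0 < n%:R + c by lra.
rewrite mulrCA mulrC ler_pdivlMr // -[n.+1%:R]natr1.
apply: (@le_trans _ _ (2 * `|s n|)); last by rewrite ler_wpM2l // lerDr.
rewrite normrM gtr0_norm // mulrA mulrC ler_wpM2r //; lra.
Qed.

Lemma Gs_bound n : (0 < n)%N -> `|Gs n| <= 3 * (n.+1%:R^-1 * w n).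
Proof.
move=> n0; have n1 : 1 <= n%:R :> R by rewrite ler1n.
have c0' := c0; have nc : 0 < n%:R + c - 1/3 by lra.
rewrite mulrCA mulrC ler_pdivlMr // -[n.+1%:R]natr1.
apply: (@le_trans _ _ (3 * `|p n|)); last by rewrite ler_wpM2l // lerDl.
rewrite normrM gtr0_norm // mulrA mulrC ler_wpM2r //; lra.
Qed.

Let tail_bdd (u : nat -> R) (K : R) : 0 <= K ->
  (forall n, (0 < n)%N -> `|u n| <= K * (n.+1%:R^-1 * w n)) -> l1 u.
Proof.
move=> K0 h; apply: bdd_unshift; apply: (@bdd_le _ _ (fun n => K * (n.+2%:R^-1 * w n.+1))).
  by move=> n; exact: h.
apply: bddZ K0 (@bdd_shift _ (fun n => n.+1%:R^-1 * w n) _ w_bdd) => n.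
by rewrite mulr_ge0 ?invr_ge0 // addr_ge0.
Qed.

Lemma l1_Fs : l1 Fs. Proof. exact: tail_bdd Fs_bound. Qed.

Lemma l1_Gs : l1 Gs. Proof. exact: tail_bdd Gs_bound. Qed.

Lemma Gs_sum0 : rsum Gs 0.
Proof.
move=> d d0; have [N hN] := pole_decay d0; exists N.+1 => -[//|n] Nn.
by rewrite sum_Gs sub0r normrN; have [] := hN n Nn.
Qed.

Lemma Fs_sum0 : rsum Fs 0.
Proof.
have [l hl] := rsum_exists (fun n => lexx `|Fs n|) l1_Fs.
have h1 := rsumD (rsumZ e hl) (rsumZ (1/3) Gs_sum0).
have h0 : rsum (fun i => e * Fs i + 1/3 * Gs i) 0.
  move=> d d0; have [N hN] := pole_decay d0; exists N => n Nn.
  by rewrite sum_FsGs sub0r opprK; have [] := hN n Nn.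
have := rsum_uniq h1 h0; rewrite mulr0 addr0 => /eqP.
by rewrite mulf_eq0 gt_eqF //= => /eqP <-.
Qed.

End Recursion.

(** * Values at -1 *)

Section EulerTransform.
Variables (R : realType) (c : R).
Implicit Types (f : nat -> R) (k j : nat).

Lemma po_shift (s : R) i : s * po (s + 1) i = i.+1%:R * po s i.+1.
Proof.
elim: i => [|i IH]; first by rewrite po0 poS po0 !mulr1 addr0.
apply: (mulfI (x := i.+1%:R)); first by rewrite pnatr_eq0.
have h1 := poS (s + 1) i; have h2 := poS s i.+1.
rewrite mulrCA h1 h2 mulrCA IH -!natr1; ring.
Qed.

Lemma po_pascal (s : R) i : po (s + 1) i.+1 - po (s + 1) i = po s i.+1.
Proof.
rewrite -!(conv_po s 1) /conv big_ord_recr /= subnn po0 mulr1.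
under eq_bigr do rewrite po_1; under [X in _ - X]eq_bigr do rewrite po_1.
by rewrite addrAC subrr add0r.
Qed.

(* [x^(j+c)] expanded in powers of [y = x / (x - 1)]:
   [x^(j+c) = (-1)^(j+c) y^(j+c) (1 - y)^(-j-c)]. *)
Definition eulm k j : R := if (j <= k)%N then (-1) ^+ j * po (j%:R + c) (k - j) else 0.

Definition euler f k : R := \sum_(j < k.+1) eulm k j * f j.

Lemma eulm_gt k j : (k < j)%N -> eulm k j = 0.
Proof. by move=> h; rewrite /eulm leqNgt h. Qed.

(** Coefficient form of [y d/dy = (1 - x) x d/dx] for [y = x / (x - 1)], applied to [x^(j+c)]. *)
Lemma eulm_theta k j : (j%:R + c) * (eulm k j - eulm k j.+1) = (k%:R + c) * eulm k j.
Proof.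
case: (ltngtP j k) => jk; last first.
- by rewrite jk [eulm k k.+1]eulm_gt // subr0.
- by rewrite !eulm_gt // ?subr0 ?mulr0 // leqW.
have [i ki] : exists i, (k - j = i.+1)%N by exists (k - j).-1; rewrite prednK // subn_gt0.
have ki' : (k - j.+1 = i)%N by rewrite subnS ki.
have kE : k%:R = j%:R + i.+1%:R :> R by rewrite -natrD -ki subnKC // ltnW.
rewrite /eulm jk (ltnW jk) ki ki' exprS -[j.+1%:R]natr1 kE.
have h := po_shift (j%:R + c) i; have -> : j%:R + 1 + c = j%:R + c + 1 by ring.
have -> : (j%:R + c) * ((-1) ^+ j * po (j%:R + c) i.+1 - -1 * (-1) ^+ j * po (j%:R + c + 1) i) =
  (-1) ^+ j * ((j%:R + c) * po (j%:R + c) i.+1 + (j%:R + c) * po (j%:R + c + 1) i) by ring.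
rewrite h; ring.
Qed.

(** Coefficient form of [(1 - y) x = - y]: how multiplication by [x] acts on expansions in [y]. *)
Lemma eulm_shift k j : eulm k.+1 j.+1 - eulm k j.+1 = - eulm k j.
Proof.
case: (ltngtP j k) => jk; last first.
- by rewrite jk [eulm k k.+1]eulm_gt // subr0 /eulm !leqnn !subnn !po0 exprS; ring.
- by rewrite !eulm_gt ?subrr ?oppr0 // leqW.
have [i ki] : exists i, (k - j = i.+1)%N by exists (k - j).-1; rewrite prednK // subn_gt0.
have ki' : (k - j.+1 = i)%N by rewrite subnS ki.
rewrite /eulm jk (ltnW jk) ltnS (ltnW jk) subSS ki ki' exprS -[j.+1%:R]natr1.
have -> : j%:R + 1 + c = j%:R + c + 1 by ring.
rewrite -(po_pascal (j%:R + c)); ring.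
Qed.

Lemma euler_theta f k :
  euler (fun j => if j is i.+1 then (i.+1%:R + c) * f i.+1 - (i%:R + c) * f i else c * f 0%N) k =
  (k%:R + c) * euler f k.
Proof.
rewrite /euler mulr_sumr.
under [RHS]eq_bigr do rewrite mulrA -eulm_theta mulrBr mulrBl.
rewrite sumrB big_ord_recl /= [X in _ = X - _]big_ord_recl /= add0r.
rewrite [X in _ = _ - X]big_ord_recr /= [eulm k k.+1]eulm_gt // mulr0 mul0r addr0.
rewrite -[RHS]addrA -sumrB; congr (_ + _); first by ring.
by apply: eq_bigr => i _; rewrite /bump /= add1n; ring.
Qed.

Definition delay f j : R := if j is i.+1 then f i else 0.

Lemma euler_delay f k : euler (delay f) k.+1 - euler (delay f) k = - euler f k.
Proof.
have e m : euler (delay f) m = \sum_(j < m) eulm m j.+1 * f j.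
  by rewrite /euler big_ord_recl mulr0 add0r; apply: eq_bigr => i _; rewrite lift0.
rewrite !e /euler -[RHS]sumrN.
have -> : \sum_(j < k) eulm k j.+1 * f j = \sum_(j < k.+1) eulm k j.+1 * f j.
  by rewrite [RHS]big_ord_recr /= eulm_gt // mul0r addr0.
by rewrite -sumrB; apply: eq_bigr => i _; rewrite -mulrBl eulm_shift mulNr.
Qed.

Lemma eulerD f g a b k : euler (fun j => a * f j + b * g j) k = a * euler f k + b * euler g k.
Proof.
by rewrite /euler !mulr_sumr -big_split; apply: eq_bigr => i _ /=; ring.
Qed.

Lemma eq_euler f g k : f =1 g -> euler f k = euler g k.
Proof. by move=> h; apply: eq_bigr => i _; rewrite h. Qed.

Variable e : R.
Hypotheses (hc : 0 <= c <= 1/3) (hcc : c * (c - 1/3) = 0).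

Let c0 : 0 <= c. Proof. by case/andP: hc. Qed.

Lemma euler_Gs k : euler (Gs e c) k = (k%:R + c) * euler (Fs e c) k.
Proof.
rewrite -euler_theta; apply: eq_euler => -[|i].
  by rewrite /Gs /Fs /= mulr1.
by rewrite FsS // addrAC subrr add0r.
Qed.

Lemma euler_GsS k : (k.+1%:R + c - 1/3) * euler (Gs e c) k.+1 =
  (k%:R + c + 1/3) * euler (Gs e c) k + e * euler (Fs e c) k.
Proof.
have main m : (m%:R + c - 1/3) * euler (Gs e c) m =
    - (2/3) * euler (delay (Gs e c)) m + (- e) * euler (delay (Fs e c)) m.
  rewrite mulrBl -euler_theta -eulerD -[_ / _ * _]addr0 -(mul0r (euler (Gs e c) m)) -eulerD -mulN1r.
  rewrite -[X in X + _]mul1r -eulerD; apply: eq_euler => -[|i] /=.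
    rewrite /Gs /=; have := hcc; lra.
  have := GsS e hc i; rewrite -[i.+1%:R]natr1; lra.
have h1 := main k.+1; have h2 := main k.
have h3 := euler_delay (Gs e c) k; have h4 := euler_delay (Fs e c) k.
have {}h4 : e * euler (delay (Fs e c)) k.+1 = e * euler (delay (Fs e c)) k - e * euler (Fs e c) k.
  by rewrite -mulrBr -h4; ring.
have e1 : (k.+1%:R + c - 1/3) * euler (Gs e c) k.+1 =
  (k%:R + c - 1/3) * euler (Gs e c) k + (2/3) * euler (Gs e c) k + e * euler (Fs e c) k by lra.
by rewrite e1; field.
Qed.

(* The Taylor coefficients of the same functions in the variable [y]; all of
   them are positive, and [x = -1] corresponds to [y = 1/2]. *)
Fixpoint ph (k : nat) : R :=
  if k is m.+1 then
    ((m%:R + c + 1/3) * (m%:R + c) + e) / ((m%:R + c + 2/3) * (m%:R + c + 1)) * ph m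
  else 1.

(** In the variable [y] the two first-order equations combine into a hypergeometric recursion with
    two terms, whose ratios are positive for [e > 0]. *)
Lemma euler_Fs k : euler (Fs e c) k = ph k.
Proof.
elim: k => [|k IH].
  by rewrite /euler big_ord1 /eulm /= ?subnn ?po0 ?expr0 /Fs /= ?mulr1.
have k0 : 0 <= k%:R :> R by [].
have h1 : k%:R + c + 2/3 != 0 by rewrite gt_eqF //; have := c0; lra.
have h2 : k%:R + c + 1 != 0 by rewrite gt_eqF //; have := c0; lra.
have := euler_GsS k; rewrite !euler_Gs IH -[k.+1%:R]natr1 => h.
apply: (mulfI (mulf_neq0 h1 h2)); rewrite [ph k.+1]/= mulrA [X in _ = X * _]mulrC divfK ?mulf_neq0 //.
move: (euler _ k.+1) h => E' h.
have -> : (k%:R + c + 2/3) * (k%:R + c + 1) * E' = (k%:R + 1 + c - 1/3) * ((k%:R + 1 + c) * E') by field.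
by rewrite h; ring.
Qed.

End EulerTransform.

Arguments po : simpl never.

(** * Summation at [y = 1/2] *)

Section HalfSums.
Variable R : realType.
Implicit Types (s c e : R).

Lemma po_ge0 s n : 0 <= s -> 0 <= po s n.
Proof.
move=> s0; elim: n => [|n IH]; first by rewrite po0.
by rewrite poE divr_ge0 // mulr_ge0 // addr_ge0.
Qed.

Lemma half_gt0 n : 0 < 2 ^+ n :> R. Proof. by rewrite exprn_gt0. Qed.

(** Says that [(1 - y)^(-s-1)] is twice [(1 - y)^(-s)] at [y = 1/2]. Real powers are avoided:
    Pascal's rule gives [L = L / 2 + l] for the two sums. *)
Lemma po_half_step s l : 0 <= s -> rsum (fun i => po s i / 2 ^+ i) l ->
  rsum (fun i => po (s + 1) i / 2 ^+ i) (2 * l).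
Proof.
move=> s0 hl.
have p0 i : 0 <= po s i / 2 ^+ i by rewrite divr_ge0 ?po_ge0 // ltW ?half_gt0.
have q0 i : 0 <= po (s + 1) i / 2 ^+ i.
  by rewrite divr_ge0 ?po_ge0 ?addr_ge0 // ltW ?half_gt0.
have step n : \sum_(i < n.+1) po (s + 1) i / 2 ^+ i =
    (\sum_(i < n) po (s + 1) i / 2 ^+ i) / 2 + \sum_(i < n.+1) po s i / 2 ^+ i.
  rewrite big_ord_recl [X in _ = _ + X]big_ord_recl !po0 addrCA; congr (_ + _).
  rewrite mulr_suml -big_split; apply: eq_bigr => i _.
  rewrite !lift0 /= -(po_pascal s) exprS invfM; ring.
have bd n : \sum_(i < n) po (s + 1) i / 2 ^+ i <= 2 * l.
  have h1 : \sum_(i < n) po (s + 1) i / 2 ^+ i <= \sum_(i < n.+1) po (s + 1) i / 2 ^+ i.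
    by rewrite [leRHS]big_ord_recr lerDl.
  have h2 := rsum_ge_part n.+1 p0 hl; rewrite step in h1; lra.
have [L hL] : exists L, rsum (fun i => po (s + 1) i / 2 ^+ i) L.
  apply: (@rsum_exists _ _ (fun i => po (s + 1) i / 2 ^+ i)); last by exists (2 * l).
  by move=> i; rewrite ger0_norm.
suff -> : 2 * l = L by [].
have h1 := rsumD hL (rsumZ (-1) hl).
have h2 : rsum (fun i => po (s + 1) i / 2 ^+ i + -1 * (po s i / 2 ^+ i)) (L / 2).
  move=> d d0; have [N hN] := hL d d0; exists N.+1 => -[//|n] Nn.
  rewrite big_split /= -mulr_sumr step.
  set U := \sum_(i < n) _; set u := \sum_(i < n.+1) _.
  have -> : L / 2 - (U / 2 + u + -1 * u) = (L - U) / 2 by field.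
  rewrite normrM [`|2^-1|]ger0_norm //; have := hN n Nn; rewrite -/U => h.
  have := normr_ge0 (L - U); lra.
have := rsum_uniq h1 h2; lra.
Qed.

Lemma po_half_sum_exists c : 0 <= c <= 1 -> exists2 C : R, 0 < C &
  forall j, rsum (fun i => po (j%:R + c) i / 2 ^+ i) (2 ^+ j * C).
Proof.
move=> /andP[c0 c1].
have p0 i : 0 <= po c i / 2 ^+ i by rewrite divr_ge0 ?po_ge0 // ltW ?half_gt0.
have p1 i : po c i <= 1.
  have [->|cn0] := eqVneq c 0; first by case: i => [|i]; rewrite ?po0 // po_0S.
  by rewrite po_le1 // lt0r cn0 c0.
have [C hC] : exists C, rsum (fun i => po c i / 2 ^+ i) C.
  apply: (@rsum_exists _ _ (fun i => (1/2) ^+ i)); last by apply: bdd_geom; lra.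
  move=> i; rewrite ger0_norm // expr_div_n expr1n ler_wpM2r // invr_ge0 ltW ?half_gt0.
exists C.
  by have := rsum_ge_part 1 p0 hC; rewrite big_ord1 po0 expr0 divr1; apply: lt_le_trans.
elim=> [|j IH]; first by rewrite expr0 mul1r; apply: eq_rsum hC => i; rewrite add0r.
rewrite exprS -mulrA; apply: eq_rsum (po_half_step _ IH) => [i|]; last by rewrite addr_ge0.
by rewrite (_ : j.+1%:R + c = j%:R + c + 1) // -[j.+1%:R]natr1; ring.
Qed.

(** Fubini from Tonelli: the latter is applied to [|a|] and to [a + |a|], both nonnegative, and the
    results are subtracted. *)
Lemma rsum_exchange_signed (a : nat -> nat -> R) (s w s' w' : nat -> R) (l W : R) :
  (forall i, rsum (a i) (s i)) -> (forall i, rsum (fun j => `|a i j|) (w i)) ->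
  (forall j, rsum (a ^~ j) (s' j)) -> (forall j, rsum (fun i => `|a i j|) (w' j)) ->
  rsum s l -> rsum w W -> rsum s' l.
Proof.
move=> h1 h2 h3 h4 hl hW.
have e1 := rsum_exchange (fun i j => normr_ge0 (a i j)) h2 h4 hW.
have p i j : 0 <= a i j + `|a i j| by rewrite addrC -lerBlDr sub0r -normrN ler_norm.
have e2 := rsum_exchange p (fun i => rsumD (h1 i) (h2 i)) (fun j => rsumD (h3 j) (h4 j)) (rsumD hl hW).
have := rsumD e2 (rsumZ (-1) e1); rewrite mulN1r addrK.
by apply: eq_rsum => j /=; rewrite mulN1r addrK.
Qed.

(** For each fixed [j] the sum of [|eulm k j| / 2^k] over [k] is the same [C], so absolute
    summability of [f] is all that the interchange needs. The signed sum is [(-1)^j C], that is, [C]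
    times [x^j] at [x = -1]. *)
Lemma euler_half_sum c (C : R) (f : nat -> R) (v : R) : 0 <= c ->
  (forall j, rsum (fun i => po (j%:R + c) i / 2 ^+ i) (2 ^+ j * C)) ->
  l1 f -> rsum (fun j => (-1) ^+ j * f j) v -> rsum (fun k => euler c f k / 2 ^+ k) (C * v).
Proof.
move=> c0 hC hf hv.
have m0 k j : `|eulm c k j| = (-1) ^+ j * eulm c k j.
  rewrite /eulm; case: ifP => _; last by rewrite normr0 mulr0.
  rewrite normrM normrX normrN1 expr1n mul1r mulrA -exprMn mulrNN mul1r expr1n mul1r ger0_norm //.
  by rewrite po_ge0 // addr_ge0.
have row j : rsum (fun k => eulm c k j / 2 ^+ k) ((-1) ^+ j * C).
  have h : rsum (fun i => (-1) ^+ j * po (j%:R + c) ((i + j) - j)%N / 2 ^+ (i + j)) ((-1) ^+ j * C).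
    have -> : (-1) ^+ j * C = ((-1) ^+ j / 2 ^+ j) * (2 ^+ j * C).
      by rewrite mulrA divfK // gt_eqF ?half_gt0.
    apply: eq_rsum (rsumZ _ (hC j)) => i; rewrite addnK exprD invfM; ring.
  apply: eq_rsum (rsum_shiftn (c := fun k => (-1) ^+ j * po (j%:R + c) (k - j)%N / 2 ^+ k) h) => k.
  by rewrite /eulm ltnNge; case: (j <= k)%N => //=; rewrite mul0r.
have [W hW] : exists W, rsum (fun j => `|f j|) W by apply: rsum_exists hf => i; rewrite normr_id.
apply: (@rsum_exchange_signed (fun j k => f j * (eulm c k j / 2 ^+ k)) (fun j => f j * ((-1) ^+ j * C))
  (fun j => `|f j| * C) _ (fun k => \sum_(j < k.+1) `|f j * (eulm c k j / 2 ^+ k)|) _ (W * C)).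
- by move=> j; exact: rsumZ.
- move=> j; have -> : `|f j| * C = `|f j| * ((-1) ^+ j * ((-1) ^+ j * C)).
    by rewrite [(-1) ^+ j * _]mulrA -exprMn mulrNN mul1r expr1n mul1r.
  apply: eq_rsum (rsumZ _ (rsumZ _ (row j))) => k.
  by rewrite normrM [`|_ / _|]normrM m0 [`|(2 ^+ k)^-1|]ger0_norm ?mulrA // invr_ge0 ltW ?half_gt0.
- move=> k; have -> : euler c f k / 2 ^+ k = \sum_(j < k.+1) f j * (eulm c k j / 2 ^+ k).
    by rewrite /euler mulr_suml; apply: eq_bigr => j _; ring.
  by apply: rsum_finite => j kj; rewrite eulm_gt // mul0r mulr0.
- by move=> k; apply: rsum_finite => j kj; rewrite eulm_gt // mul0r mulr0 normr0.
- by apply: eq_rsum (rsumZ C hv) => j; ring.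
- by rewrite mulrC; apply: eq_rsum (rsumZ C hW) => j; rewrite mulrC.
Qed.

Lemma ev_real (f : nat -> R) (x : R) : l1 f -> `|x| <= 1 ->
  exists2 v, rsum (fun j => x ^+ j * f j) v & ev f x%:C = v%:C.
Proof.
move=> hf hx.
have [v hv] : exists v, rsum (fun j => x ^+ j * f j) v.
  apply: rsum_exists hf => i; rewrite normrM normrX ler_piMl //; exact: exprn_ile1.
exists v => //; apply: ev_uniq; rewrite ?ncR // => d d0; have [N hN] := hv d d0.
exists N => n Nn; have := hN n Nn.
have -> : \sum_(i < n) (f i)%:C * x%:C ^+ i = (\sum_(i < n) x ^+ i * f i)%:C.
  rewrite rmorph_sum; apply: eq_bigr => i _ /=; rewrite realCM mulrC; congr (_ * _).
  by rewrite rmorphXn.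
by rewrite -(rmorphB (real_complex R)) ncR.
Qed.

End HalfSums.

Section HalfWeights.
Variable R : realType.

Lemma sqr_half_bdd : bdd (fun k => k.+1%:R ^+ 2 / 2 ^+ k : R).
Proof.
have h k : k.+1%:R <= 4 * (5/4) ^+ k :> R.
  elim: k => [|k IH]; first by rewrite expr0 mulr1 ler_nat.
  have : 1 <= (5/4) ^+ k :> R by rewrite exprn_ege1 //; lra.
  by rewrite exprS -[k.+2%:R]natr1; move: ((5/4) ^+ k) IH => q; lra.
apply: (@bdd_le _ _ (fun k => 16%:R * (25%:R / 32%:R) ^+ k)).
  move=> k; rewrite ler_pdivrMr ?exprn_gt0 //.
  have -> : 16%:R * (25%:R / 32%:R) ^+ k * 2 ^+ k = (4 * (5/4) ^+ k) ^+ 2 :> R.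
    have e : (5/4) ^+ k ^+ 2 = (25%:R / 32%:R) ^+ k * 2 ^+ k :> R.
      by rewrite -exprMn -exprM mulnC exprM; congr (_ ^+ _); field.
    by rewrite -mulrA -e; ring.
  by rewrite lerXn2r ?nnegrE // mulr_ge0 ?exprn_ge0.
by apply: bddZ => //; apply: bdd_geom; lra.
Qed.

Lemma half_sum_le n : \sum_(k < n) 1 / 2 ^+ k <= 2 :> R.
Proof.
have -> : \sum_(k < n) 1 / 2 ^+ k = 2 - 2 / 2 ^+ n :> R.
  elim: n => [|n IH]; first by rewrite big_ord0 expr0 divr1 subrr.
  by rewrite big_ord_recr /= IH exprS; field.
by rewrite gerBl divr_ge0 ?exprn_ge0.
Qed.

Lemma nat_half_sum_le n : \sum_(k < n) k%:R / 2 ^+ k <= 2 :> R.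
Proof.
have -> : \sum_(k < n) k%:R / 2 ^+ k = 2 - 2 * (n%:R + 1) / 2 ^+ n :> R.
  elim: n => [|n IH]; first by rewrite big_ord0 expr0 divr1 add0r mulr1 subrr.
  by rewrite big_ord_recr /= IH exprS -[n.+1%:R]natr1; field.
by rewrite gerBl divr_ge0 ?exprn_ge0 // mulr_ge0 // addr_ge0.
Qed.

End HalfWeights.

Section HalfValues.
Variables (R : realType) (c : R).
Hypothesis hc : 0 <= c <= 1/3.
Implicit Types (e : R) (k : nat).

Let c0 : 0 <= c. Proof. by case/andP: hc. Qed.
Let c1 : c <= 1/3. Proof. by case/andP: hc. Qed.
Let kc0 k : 0 <= k%:R + c. Proof. by rewrite addr_ge0. Qed.

Let den k := (k%:R + c + 2/3) * (k%:R + c + 1).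

Let den_ge k : 2/3 <= den k.
Proof. by have := kc0 k; rewrite /den; move: (k%:R + c) => x x0; nra. Qed.

Let phS e k : ph c e k.+1 = ((k%:R + c + 1/3) * (k%:R + c) + e) / den k * ph c e k.
Proof. by []. Qed.

Lemma ph_ge0 e k : 0 <= e -> 0 <= ph c e k.
Proof.
move=> e0; elim: k => [|k IH]; first exact: ler01.
rewrite phS mulr_ge0 // divr_ge0 //; last by apply: le_trans (den_ge k); rewrite divr_ge0.
by rewrite addr_ge0 // mulr_ge0 // addr_ge0.
Qed.

(** Index 0 is excluded because the ratio there is [3 e / 2] for [c = 0], which can exceed 1. *)
Let ratio_le e k : 0 <= e <= 1 -> (0 < k)%N ->
  0 <= ((k%:R + c + 1/3) * (k%:R + c) + e) / den k <= 1.
Proof.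
move=> /andP[e0 e1] k0; have d0 : 0 < den k by apply: lt_le_trans (den_ge k); rewrite divr_gt0.
rewrite ler_pdivrMr // mul1r divr_ge0 ?(ltW d0) //=; last by rewrite addr_ge0 // mulr_ge0 // addr_ge0.
have k1 : 1 <= k%:R :> R by rewrite ler1n.
have kc1 : 1 <= k%:R + c by have := c0; lra.
by rewrite /den; move: (k%:R + c) kc1 => x x1; lra.
Qed.

Lemma ph_ni e k : 0 <= e <= 1 -> ph c e k.+2 <= ph c e k.+1.
Proof.
move=> he; have /andP[e0 _] := he; have /andP[h0 h1] := @ratio_le e k.+1 he isT.
by rewrite phS ler_piMl // ph_ge0.
Qed.

Lemma ph_le_1 e k : 0 <= e <= 1 -> ph c e k.+1 <= ph c e 1.
Proof. by move=> he; elim: k => [//|k IH]; apply: le_trans (ph_ni k he) IH. Qed.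

Lemma ph_le2 e k : 0 <= e <= 1 -> ph c e k <= 2.
Proof.
move=> he; case: k => [|k]; first by rewrite /= ler1n.
apply: (le_trans (ph_le_1 k he)); rewrite phS mulr1 ler_pdivrMr; last first.
  by apply: lt_le_trans (den_ge 0); rewrite divr_gt0.
case/andP: he => e0 e1; rewrite /den add0r; have := c0; have := c1; nra.
Qed.

Lemma ph_lip e e' k : 0 <= e <= 1 -> 0 <= e' <= 1 ->
  `|ph c e k - ph c e' k| <= 3 * k%:R * `|e - e'|.
Proof.
move=> he he'; elim: k => [|k IH]; first by rewrite subrr normr0 mulr0 mul0r.
have d0 : 0 < den k by apply: lt_le_trans (den_ge k); rewrite divr_gt0.
have dn : den k != 0 by rewrite gt_eqF.
rewrite !phS.
set q := ((k%:R + c + 1/3) * (k%:R + c) + e) / den k.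
have -> : q * ph c e k - ((k%:R + c + 1/3) * (k%:R + c) + e') / den k * ph c e' k =
   q * (ph c e k - ph c e' k) + (e - e') * (ph c e' k / den k).
  by rewrite /q; field.
apply: (le_trans (ler_normD _ _)); have -> : 3 * k.+1%:R * `|e - e'| = 3 * k%:R * `|e - e'| + 3 * `|e - e'|.
  by rewrite -[k.+1%:R]natr1; ring.
apply: lerD.
  case: k IH d0 dn @q => [|k] IH d0 dn q; first by rewrite subrr mulr0 normr0 mulr0 mul0r.
  have /andP[q0 q1] := @ratio_le e k.+1 he isT.
  by apply: le_trans IH; rewrite normrM ger0_norm // ler_piMl.
rewrite normrM mulrC ler_wpM2r // ger0_norm; last first.
  by rewrite divr_ge0 ?ph_ge0 ?(ltW d0) //; case/andP: he'.
rewrite ler_pdivrMr //; have := ph_le2 k he'; have := den_ge k; lra.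
Qed.

Lemma ph_half_rsum e (a : nat -> R) : 0 <= e <= 1 -> (forall k, 0 <= a k <= k.+1%:R) ->
  exists A, rsum (fun k => a k * ph c e k / 2 ^+ k) A.
Proof.
move=> he ha; apply: (@rsum_exists _ _ (fun k => 2 * (k.+1%:R ^+ 2 / 2 ^+ k))); last first.
  by apply: bddZ => //; exact: sqr_half_bdd.
move=> k; have /andP[a0 a1] := ha k; have /andP[e0 _] := he; have p0 := @ph_ge0 e k e0.
rewrite ger0_norm ?divr_ge0 ?mulr_ge0 ?exprn_ge0 //.
rewrite mulrA ler_wpM2r ?invr_ge0 ?exprn_ge0 // mulrC; apply: ler_pM => //; first exact: ph_le2.
by apply: (le_trans a1); rewrite expr2 ler_peMl // ler1n.
Qed.

(** With weights [1] and [k + c] these are, up to a common positive constant, the values at [x = -1]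
    of the two components of the solution, the second because [euler_Gs] is [y d/dy + c] on
    coefficients. *)
Definition phA (a : nat -> R) e : R := xget 0 (rsum (fun k => a k * ph c e k / 2 ^+ k)).

Lemma phAP a e : 0 <= e <= 1 -> (forall k, 0 <= a k <= k.+1%:R) ->
  rsum (fun k => a k * ph c e k / 2 ^+ k) (phA a e).
Proof. by move=> he ha; have [A hA] := ph_half_rsum he ha; apply: (xgetI _ hA). Qed.

Lemma phA_lip a : (forall k, 0 <= a k <= k.+1%:R) -> exists2 L : R, 0 <= L &
  forall e e', 0 <= e <= 1 -> 0 <= e' <= 1 -> `|phA a e - phA a e'| <= L * `|e - e'|.
Proof.
move=> ha; have [M hM] : exists M, rsum (fun k => k.+1%:R ^+ 2 / 2 ^+ k : R) M.
  apply: (@rsum_exists _ _ (fun k => k.+1%:R ^+ 2 / 2 ^+ k)); last exact: sqr_half_bdd.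
  by move=> k; rewrite ger0_norm // divr_ge0 ?exprn_ge0.
exists (3 * M).
  by rewrite mulr_ge0 //; apply: rsum_ge0 hM => k; rewrite divr_ge0 ?exprn_ge0.
move=> e e' he he'; have h := rsumD (phAP he ha) (rsumZ (-1) (phAP he' ha)).
rewrite mulN1r in h; rewrite mulrAC.
apply: (rsum_norm_le _ h (rsumZ (3 * `|e - e'|) hM)) => k.
have -> : a k * ph c e k / 2 ^+ k + -1 * (a k * ph c e' k / 2 ^+ k) =
  a k * (ph c e k - ph c e' k) / 2 ^+ k by ring.
have /andP[a0 a1] := ha k.
rewrite normrM [`|_^-1|]ger0_norm ?invr_ge0 ?exprn_ge0 // mulrA ler_wpM2r ?invr_ge0 ?exprn_ge0 //.
rewrite normrM (ger0_norm a0).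
apply: (le_trans (ler_pM a0 (normr_ge0 _) a1 (ph_lip k he he'))).
have -> : k.+1%:R * (3 * k%:R * `|e - e'|) = 3 * `|e - e'| * (k.+1%:R * k%:R) by ring.
by rewrite ler_wpM2l ?mulr_ge0 // expr2 ler_wpM2l // ler_nat.
Qed.

Lemma phA_continuous a : (forall k, 0 <= a k <= k.+1%:R) ->
  continuous (fun e => phA a (clamp 1 e)).
Proof.
move=> ha x; have [L L0 hL] := phA_lip ha; apply/cvgrPdist_le => d d0.
have L1 : 0 < L + 1 by rewrite ltr_wpDl.
have d1 : 0 < d / (L + 1) by rewrite divr_gt0.
have /cvgrPdist_le/(_ _ d1) := @clamp_continuous _ 1 x.
apply: filterS => y hy; apply: (le_trans (hL _ _ (clampP ler01 x) (clampP ler01 y))).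
apply: (le_trans (ler_wpM2l L0 hy)); rewrite mulrC; by apply: div1_le => //; exact: ltW.
Qed.

End HalfValues.

(** * Choice of the parameter [e] by the intermediate value theorem *)

Section Matching.
Variable R : realType.
Implicit Types (e t c : R).

(* The constant [C] is the value of [(1 - y)^(-c)] at [y = 1/2]; it cancels in ratios. *)
Lemma half_connection c : 0 <= c <= 1/3 -> c * (c - 1/3) = 0 ->
  exists2 C : R, 0 < C & forall e, 0 < e <= 1 ->
    C%:C * ev (Fs e c) (-1) = (phA c (fun=> 1) e)%:C /\
    C%:C * ev (Gs e c) (-1) = (phA c (fun k => k%:R + c) e)%:C.
Proof.
move=> hc hcc; have /andP[c0 c1] := hc.
have [C C0 hC] := @po_half_sum_exists R c (ltac:(lra)); exists C => // e he.
have n1 : `|-1| <= 1 :> R by rewrite normrN1.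
have e01 : 0 <= e <= 1 by case/andP: he => /ltW -> ->.
have m1 : -1 = (-1)%:C :> R[i] by rewrite (rmorphN1 (real_complex R)).
have [vF hF eF] := ev_real (l1_Fs he hc) n1.
have [vG hG eG] := ev_real (l1_Gs he hc) n1.
rewrite m1 eF eG -!realCM; split; congr (_%:C).
  apply: (rsum_uniq (euler_half_sum c0 hC (l1_Fs he hc) hF)).
  apply: eq_rsum (phAP hc e01 _) => k; first by rewrite mul1r euler_Fs.
  by rewrite ler01 ler1n.
apply: (rsum_uniq (euler_half_sum c0 hC (l1_Gs he hc) hG)).
apply: eq_rsum (phAP hc e01 _) => k; first by rewrite euler_Gs // euler_Fs.
rewrite addr_ge0 //= -natr1 lerD2l; lra.
Qed.

Let third : 0 <= (1/3 : R) <= 1/3. Proof. lra. Qed.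
Let zero_third : 0 <= (0 : R) <= 1/3. Proof. lra. Qed.

Let one_weight k : 0 <= (1 : R) <= k.+1%:R. Proof. by rewrite ler01 ler1n. Qed.
Let shift_weight c k : 0 <= c <= 1/3 -> 0 <= k%:R + c <= k.+1%:R.
Proof. by move=> /andP[c0 c1]; rewrite addr_ge0 //= -natr1 lerD2l; lra. Qed.

Let A0 := phA 0 (fun=> 1 : R).
Let B0 := phA 0 (fun k => k%:R + 0 : R).
Let A1 := phA (1/3) (fun=> 1 : R).
Let B1 := phA (1/3) (fun k => k%:R + 1/3 : R).

Let hA0 e he := @phAP R 0 zero_third (fun=> 1) e he one_weight.
Let hB0 e he := @phAP R 0 zero_third _ e he (fun k => shift_weight k zero_third).
Let hA1 e he := @phAP R (1/3) third (fun=> 1) e he one_weight.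
Let hB1 e he := @phAP R (1/3) third _ e he (fun k => shift_weight k third).

Let term_ge0 c (a : nat -> R) e k : 0 <= c <= 1/3 -> 0 <= e <= 1 -> 0 <= a k -> 0 <= a k * ph c e k / 2 ^+ k.
Proof.
move=> hc /andP[e0 _] ak; rewrite divr_ge0 ?exprn_ge0 // mulr_ge0 //; exact: ph_ge0.
Qed.

Let A_ge1 c e : 0 <= c <= 1/3 -> 0 <= e <= 1 -> 1 <= phA c (fun=> 1) e.
Proof.
move=> hc he.
have := rsum_ge_part 1 (fun k => @term_ge0 c (fun=> 1) e k hc he ler01) (phAP hc he one_weight).
by rewrite big_ord1 /= expr0 divr1 mulr1.
Qed.

Let B1_ge e : 0 <= e <= 1 -> 1/3 * A1 e <= B1 e.
Proof.
move=> he; apply: rsum_le (rsumZ (1/3) (hA1 he)) (hB1 he) => k /=.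
have /andP[e0 _] := he.
rewrite [1 * ph _ _ _]mul1r mulrA ler_wpM2r ?invr_ge0 ?exprn_ge0 // ler_wpM2r ?(ph_ge0 third) //.
by rewrite lerDr.
Qed.

Let ph0_1 e : ph 0 e 1 = 3/2 * e.
Proof. by rewrite /=; field. Qed.

Let ph1_1 e : e <= 1 -> ph (1/3) e 1 <= 1.
Proof. by move=> e1; rewrite /= mulr1 ler_pdivrMr; lra. Qed.

Let B0_le e : 0 <= e <= 1 -> B0 e <= 3 * e.
Proof.
move=> he; apply: rsum_le_bound (hB0 he) => n.
apply: (@le_trans _ _ (3/2 * e * \sum_(k < n) k%:R / 2 ^+ k)); last first.
  have /andP[e0 _] := he; have := ler_wpM2l e0 (@nat_half_sum_le R n); lra.
rewrite mulr_sumr; apply: ler_sum => -[[|k] _] _ /=.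
  by rewrite addr0 !mul0r mulr0.
rewrite addr0 [leRHS]mulrA ler_wpM2r ?invr_ge0 ?exprn_ge0 // mulrC ler_wpM2r //.
by rewrite -ph0_1; exact: ph_le_1.
Qed.

Let A0_le : A0 1 <= 5/2.
Proof.
have he : 0 <= (1 : R) <= 1 by rewrite ler01 lexx.
apply: rsum_le_bound (hA0 he) => -[|n]; first by rewrite big_ord0; lra.
rewrite big_ord_recl /= expr0 divr1 mul1r.
have : \sum_(i < n) 1 * ph 0 1 (lift ord0 i) / 2 ^+ lift ord0 i <= 3/4 * \sum_(i < n) 1 / 2 ^+ i :> R.
  rewrite mulr_sumr; apply: ler_sum => i _; rewrite lift0 exprS invfM mul1r.
  have h := @ph_le_1 R 0 zero_third 1 i he; rewrite ph0_1 mulr1 in h.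
  have q0 : 0 <= (2 ^+ i)^-1 :> R by rewrite invr_ge0 exprn_ge0.
  by move: (ph _ _ _) h => p h; move: (_ ^-1) q0 => q q0; nra.
have := @half_sum_le R n; lra.
Qed.

Let B1_le : B1 1 <= 8%:R / 3.
Proof.
have he : 0 <= (1 : R) <= 1 by rewrite ler01 lexx.
apply: rsum_le_bound (hB1 he) => n.
have p1 k : ph (1/3) 1 k <= 1 :> R.
  by case: k => [|k] //; apply: (le_trans (ph_le_1 third k he)); exact: ph1_1.
apply: (@le_trans _ _ (\sum_(k < n) k%:R / 2 ^+ k + 1/3 * \sum_(k < n) 1 / 2 ^+ k)).
  rewrite mulr_sumr -big_split; apply: ler_sum => k _ /=.
  rewrite mulrA -mulrDl ler_wpM2r ?invr_ge0 ?exprn_ge0 // mulr1 ler_piMr // addr_ge0 //; lra.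
have := @half_sum_le R n; have := @nat_half_sum_le R n; lra.
Qed.

Let B0_ge : 3/4 <= B0 1.
Proof.
have he : 0 <= (1 : R) <= 1 by rewrite ler01 lexx.
have := rsum_ge_part 2 (fun k => @term_ge0 0 (fun k => k%:R + 0) 1 k zero_third he
  (proj1 (andP (shift_weight k zero_third)))) (hB0 he).
rewrite !big_ord_recl big_ord0 lift0 ph0_1 /= !addr0 !mul0r add0r expr1; rewrite -/B0; lra.
Qed.

(** The constant [k] is eliminated from the two conditions, which leaves the single equation
    [L e = 0]. Near [e = 0] the function [L] is nonnegative because [B0] is [O(e)]; at [e = 1]
    explicit bounds make it nonpositive. *)
Lemma matching t : 4/5 <= t -> t < 1 -> exists e k : R, [/\ 0 < e <= 1,
  (1 - t)%:C * ev (Fs e 0) (-1) = k%:C * ev (Fs e (1/3)) (-1) &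
  (1 + t)%:C * ev (Gs e 0) (-1) = k%:C * ev (Gs e (1/3)) (-1)].
Proof.
move=> t1 t2; have t3 : 0 < 1 - t by lra.
pose L e := (1 - t) * (B1 e * A0 e) - (1 + t) * (A1 e * B0 e).
(* Chosen so that [(1 + t) 3 e1 = (1 - t) / 3], which balances the bounds [B0 <= 3 e] and
   [B1 >= A1 / 3]. *)
pose e1 := (1 - t) / (9%:R * (1 + t)).
have e10 : 0 < e1 by rewrite divr_gt0 // mulr_gt0 //; lra.
have e11 : e1 <= 1 by rewrite ler_pdivrMr ?mulr_gt0 //; lra.
have he1 : 0 <= e1 <= 1 by rewrite (ltW e10).
have h1 : 0 <= (1 : R) <= 1 by rewrite ler01 lexx.
have L1 : 0 <= L e1.
  have a := A_ge1 zero_third he1; have b := A_ge1 third he1; rewrite -/A0 in a; rewrite -/A1 in b.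
  have q1 := B1_ge he1; have q2 := B0_le he1.
  have q3 : B1 e1 <= B1 e1 * A0 e1 by rewrite ler_peMr //; lra.
  have q4 : A1 e1 * B0 e1 <= A1 e1 * (3 * e1) by rewrite ler_wpM2l //; lra.
  have q5 : (1 + t) * (A1 e1 * (3 * e1)) = (1 - t) * (1/3 * A1 e1) by rewrite /e1; field; lra.
  have q6 := ler_wpM2l (ltW t3) (le_trans q1 q3).
  have q7 : (1 + t) * (A1 e1 * B0 e1) <= (1 + t) * (A1 e1 * (3 * e1)) by rewrite ler_wpM2l //; lra.
  by rewrite /L; lra.
(* Here [4/5 <= t] enters: the bounds reduce the claim to [(1 - t) 20/3 <= (1 + t) 3/4]. *)
have L2 : L 1 <= 0.
  have a := A_ge1 zero_third h1; have b := A_ge1 third h1; rewrite -/A0 in a; rewrite -/A1 in b.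
  have q1 : B1 1 * A0 1 <= 8%:R / 3 * (5/2).
    by apply: ler_pM; rewrite ?A0_le ?B1_le //; have := B1_ge h1; lra.
  have q2 : B0 1 <= A1 1 * B0 1 by rewrite ler_peMl //; have := B0_ge; lra.
  have q3 := ler_wpM2l (ltW t3) q1.
  have q4 : (1 + t) * (3/4) <= (1 + t) * (A1 1 * B0 1).
    have t4 : 0 <= 1 + t by lra.
    by apply: ler_wpM2l => //; apply: le_trans q2; exact: B0_ge.
  by rewrite /L; lra.
have cL : continuous (fun e => L (clamp 1 e)).
  move=> x; rewrite /L.
  have k0 := @phA_continuous R _ zero_third _ one_weight x.
  have k1 := @phA_continuous R _ zero_third _ (fun k => shift_weight k zero_third) x.
  have k2 := @phA_continuous R _ third _ one_weight x.
  have k3 := @phA_continuous R _ third _ (fun k => shift_weight k third) x.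
  by apply: cvgB; (apply: cvgM; first exact: cvg_cst); exact: cvgM.
have [e he Le] : exists2 e, e \in `[e1, 1] & L (clamp 1 e) = 0.
  apply: IVT => //; first exact: continuous_subspaceT.
  by rewrite !clamp_id // ge_min le_max L1 L2 orbT.
move: he; rewrite in_itv /= => /andP[le1 lee].
have e0 : 0 < e by apply: lt_le_trans le1.
have he : 0 < e <= 1 by rewrite e0.
have he' : 0 <= e <= 1 by rewrite ltW.
rewrite clamp_id // in Le.
have [C0 C0p /(_ e he) [F0 G0]] := half_connection zero_third (mul0r (0 - 1/3)).
have [C1 C1p /(_ e he) [F1 G1]] := half_connection third (ltac:(by rewrite subrr mulr0)).
rewrite -/A0 in F0; rewrite -/B0 in G0; rewrite -/A1 in F1; rewrite -/B1 in G1.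
have A1p : 0 < A1 e by have := A_ge1 third he'; rewrite -/A1; lra.
have solve (C : R) (z : R[i]) (v : R) : 0 < C -> C%:C * z = v%:C -> z = (v / C)%:C.
  move=> Cp h; have Cn : C%:C != 0 :> R[i] by rewrite realC_neq0 gt_eqF.
  by apply: (mulfI Cn); rewrite h -realCM mulrCA divff ?mulr1 // gt_eqF.
have C0n : C0 != 0 by rewrite gt_eqF. have C1n : C1 != 0 by rewrite gt_eqF.
have A1n : A1 e != 0 by rewrite gt_eqF.
exists e, ((1 - t) * A0 e * C1 / (C0 * A1 e)); split=> //.
all: rewrite ?(solve _ _ _ C0p F0) ?(solve _ _ _ C0p G0) ?(solve _ _ _ C1p F1) ?(solve _ _ _ C1p G1).
all: rewrite -!realCM; congr (_%:C).
  by field; rewrite C0n C1n A1n.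
have eB : (1 + t) * B0 e = (1 - t) * A0 e * B1 e / A1 e.
  apply: (mulIf A1n); rewrite divfK //; move: Le; rewrite /L => /eqP; rewrite subr_eq0 => /eqP h.
  have -> : (1 + t) * B0 e * A1 e = (1 + t) * (A1 e * B0 e) by ring.
  by rewrite -h; ring.
by rewrite mulrA eB; field; rewrite C0n C1n A1n.
Qed.

End Matching.

(** * The system on the unit circle *)

Section PowerSeriesDerivative.
Variable R : realType.
Implicit Types (c f g : nat -> R) (x h : R[i]).

Lemma realCD (a b : R) : (a + b)%:C = a%:C + b%:C :> R[i]. Proof. exact: rmorphD. Qed.

Lemma realCB (a b : R) : (a - b)%:C = a%:C - b%:C :> R[i]. Proof. exact: rmorphB. Qed.

Definition dcoef c n : R := n.+1%:R * c n.+1.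

Lemma l1_dcoef c : l1 (dcoef c) -> l1 c.
Proof.
move=> h; apply: bdd_unshift; apply: bdd_le h => n.
by rewrite normrM normr_nat ler_peMl // ler1n.
Qed.

Lemma pow_sub_le x x' n : nc x <= 1 -> nc x' <= 1 ->
  nc (x' ^+ n.+1 - x ^+ n.+1) <= n.+1%:R * nc (x' - x).
Proof.
move=> hx hx'; rewrite subrXX ncM mulrC ler_wpM2r ?nc_ge0 //.
apply: (le_trans (nc_sum _ _ _)); rewrite -[n.+1%:R]mulr1 -sum_cst; apply: ler_sum => i _.
by rewrite ncM !ncX; apply: mulr_ile1; rewrite ?exprn_ge0 ?nc_ge0 // exprn_ile1 ?nc_ge0.
Qed.

Lemma pow_taylor x x' n : nc x <= 1 -> nc x' <= 1 ->
  nc (x' ^+ n.+1 - x ^+ n.+1 - (x' - x) * (n.+1%:R * x ^+ n)) <= n.+1%:R ^+ 2 * nc (x' - x) ^+ 2.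
Proof.
move=> hx hx'; elim: n => [|n IH].
  by rewrite expr0 !mulr1 !expr1 subrr nc0 mulr_ge0 ?sqr_ge0.
have -> : x' ^+ n.+2 - x ^+ n.+2 - (x' - x) * (n.+2%:R * x ^+ n.+1) =
  x' * (x' ^+ n.+1 - x ^+ n.+1 - (x' - x) * (n.+1%:R * x ^+ n)) +
  n.+1%:R * ((x' - x) ^+ 2 * x ^+ n).
  rewrite -[n.+2%:R]natr1 !exprS; ring.
apply: (le_trans (ncD _ _)).
apply: (@le_trans _ _ (n.+1%:R ^+ 2 * nc (x' - x) ^+ 2 + n.+1%:R * nc (x' - x) ^+ 2)).
  apply: lerD; first by rewrite ncM; apply: le_trans IH; rewrite ler_piMl ?nc_ge0.
  rewrite ncM -(rmorph_nat (real_complex R)) ncR normr_nat ler_wpM2l // ncM !ncX.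
  by rewrite ler_piMr ?sqr_ge0 // exprn_ile1 ?nc_ge0.
rewrite -mulrDl ler_wpM2r ?sqr_ge0 // -[n.+2%:R]natr1.
have : 0 <= n.+1%:R :> R by []. 
by move: (n.+1%:R) => m m0; nra.
Qed.

(** Differentiability relative to the closed disc, boundary included, with a step size uniform in
    the point. The first [N] terms are handled by Taylor's formula, the tail by the Lipschitz bound
    of each power. *)
Lemma ev_diff c : l1 (dcoef c) -> forall e : R, 0 < e -> exists2 d : R, 0 < d &
  forall x x', nc x <= 1 -> nc x' <= 1 -> nc (x' - x) <= d ->
    nc (ev c x' - ev c x - (x' - x) * ev (dcoef c) x) <= e * nc (x' - x).
Proof.
move=> hd e e0; have hc := l1_dcoef hd.
have e4 : 0 < e / 4 by rewrite divr_gt0.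
have [N hN] := bdd_tail (fun i => normr_ge0 (dcoef c i)) hd e4.
pose K := \sum_(i < N) `|c i.+1| * i.+1%:R ^+ 2.
have K0 : 0 <= K by rewrite sumr_ge0 // => i _; rewrite mulr_ge0 ?sqr_ge0.
have K1 : 0 < K + 1 by rewrite ltr_wpDl.
exists (e / 2 / (K + 1)); first by rewrite !divr_gt0.
move=> x x' hx hx' hh; set h := nc (x' - x) in hh *.
have h0 : 0 <= h by exact: nc_ge0.
have hKh : K * h <= e / 2.
  rewrite mulrC; apply: (le_trans (ler_wpM2r K0 hh)); apply: div1_le => //; exact: ltW (divr_gt0 e0 _).
pose T n := (c n.+1)%:C * (x' ^+ n.+1 - x ^+ n.+1 - (x' - x) * (n.+1%:R * x ^+ n)).
have hT : csum T (ev c x' - ev c x - (x' - x) * ev (dcoef c) x).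
  have a1 := csum_shift (evP hc hx'); have a2 := csum_shift (evP hc hx).
  have := csumD (csumD a1 (csumZ (-1) a2)) (csumZ (- (x' - x)) (evP hd hx)).
  have -> : ev c x' - (c 0%N)%:C * x' ^+ 0 + -1 * (ev c x - (c 0%N)%:C * x ^+ 0) +
    - (x' - x) * ev (dcoef c) x = ev c x' - ev c x - (x' - x) * ev (dcoef c) x.
    rewrite !expr0; move: (ev c x') (ev c x) (ev _ _) (_%:C) => p q r u; ring.
  apply: eq_csum => n; rewrite /T /dcoef realCM (rmorph_nat (real_complex R)); ring.
have small n : nc (T n) <= `|c n.+1| * n.+1%:R ^+ 2 * h ^+ 2.
  by rewrite ncM ncR -mulrA ler_wpM2l // pow_taylor.
have large n : nc (T n) <= 2 * h * `|dcoef c n|.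
  rewrite ncM ncR /dcoef normrM normr_nat.
  have -> : 2 * h * (n.+1%:R * `|c n.+1|) = `|c n.+1| * (n.+1%:R * h + h * n.+1%:R) by ring.
  rewrite ler_wpM2l //; apply: (le_trans (ncB _ _)); apply: lerD; first exact: pow_sub_le.
  rewrite ncM ler_wpM2l // ncM -(rmorph_nat (real_complex R)) ncR normr_nat ler_piMr //.
  by rewrite ncX exprn_ile1 ?nc_ge0.
apply: (csum_norm hT) => n.
apply: (@le_trans _ _ (\sum_(i < N + n) nc (T i))).
  rewrite -!(big_mkord xpredT (fun i => nc (T i))) [leRHS](big_cat_nat (n := n)) ?leq_addl //=.
  by rewrite lerDl sumr_ge0 // => i _; exact: nc_ge0.
rewrite -(big_mkord xpredT (fun i => nc (T i))) (big_cat_nat (n := N)) ?leq_addr //= big_mkord.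
have s1 : \sum_(i < N) nc (T i) <= K * h * h.
  rewrite -mulrA -expr2 /K mulr_suml; exact: ler_sum.
have s2 : \sum_(N <= i < N + n) nc (T i) <= 2 * h * (e / 4).
  apply: (@le_trans _ _ (2 * h * \sum_(N <= i < N + n) `|dcoef c i|)).
    by rewrite mulr_sumr; apply: ler_sum => i _; exact: large.
  by rewrite ler_wpM2l ?mulr_ge0 // hN.
have s3 := ler_wpM2r h0 hKh; lra.
Qed.

Lemma ev_lin f g a b x : l1 f -> l1 g -> nc x <= 1 ->
  ev (fun n => a * f n + b * g n) x = a%:C * ev f x + b%:C * ev g x.
Proof.
move=> hf hg hx; apply: ev_uniq => //.
  apply: (@bdd_le _ _ (fun n => `|a| * `|f n| + `|b| * `|g n|)); last by apply: bddD; exact: bddZ.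
  by move=> n; rewrite -!normrM ler_normD.
apply: eq_csum (csumD (csumZ a%:C (evP hf hx)) (csumZ b%:C (evP hg hx))) => n.
by rewrite realCD !realCM; ring.
Qed.

Lemma l1_lin f g a b : l1 f -> l1 g -> l1 (fun n => a * f n + b * g n).
Proof.
move=> hf hg; apply: (@bdd_le _ _ (fun n => `|a| * `|f n| + `|b| * `|g n|)); last by apply: bddD; exact: bddZ.
by move=> n; rewrite -!normrM ler_normD.
Qed.

Lemma l1_delay f : l1 f -> l1 (delay f).
Proof. by move=> hf; apply: bdd_unshift. Qed.

Lemma ev_delay f x : l1 f -> nc x <= 1 -> ev (delay f) x = x * ev f x.
Proof.
move=> hf hx; apply: ev_uniq => //; first exact: l1_delay.
have : csum (fun i => (delay f i.+1)%:C * x ^+ i.+1) (x * ev f x).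
  by apply: eq_csum (csumZ x (evP hf hx)) => n; rewrite exprS mulrCA.
move/(csum_unshift (c := fun i => (delay f i)%:C * x ^+ i)).
by rewrite /= mul0r add0r.
Qed.

Lemma ev_tailS f x : l1 f -> nc x <= 1 -> x * ev (fun n => f n.+1) x = ev f x - (f 0%N)%:C.
Proof.
move=> hf hx; have hs : l1 (fun n => f n.+1).
  exact: (@bdd_shift _ (fun n => `|f n|) (fun n => normr_ge0 _) hf).
have := csum_shift (evP hf hx); rewrite expr0 mulr1.
have := csumZ x (evP hs hx); move=> h1 h2; apply: csum_uniq h1 _.
by apply: eq_csum h2 => n; rewrite exprS; ring.
Qed.

End PowerSeriesDerivative.

(** * Complex-valued functions of the angle *)

Section RealDerivative.
Variable R : realType.
Implicit Types (th a b : R) (f g : R -> R[i]).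

Lemma is_derive_eps (f : R -> R) (x d : R) : is_derive x 1 f d ->
  forall e : R, 0 < e -> exists2 r : R, 0 < r &
    forall h, `|h| <= r -> `|f (x + h) - f x - h * d| <= e * `|h|.
Proof.
move=> [/cvg_ex [l hl] hd] e e0.
have el : l = d by rewrite -hd; apply/esym/cvg_lim.
move: hl => /cvgrPdist_le /(_ e e0); rewrite el /dnbhs near_withinE => /nbhs_ballP [r /= r0 hr].
exists (r / 2); first by rewrite divr_gt0.
move=> h hh; have [->|h0] := eqVneq h 0; first by rewrite addr0 subrr mul0r subrr normr0 mulr0.
have := hr h; rewrite /ball /= sub0r normrN => /(_ (ltac:(lra))) /(_ h0).
rewrite /GRing.scale /= mulr1 [h + x]addrC => hq.
have -> : f (x + h) - f x - h * d = - (h * (d - h^-1 * (f (x + h) - f x))) by field.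
by rewrite normrN normrM mulrC ler_wpM2r.
Qed.

Lemma eps_is_derive (f : R -> R) (x d : R) :
  (forall e : R, 0 < e -> exists2 r : R, 0 < r &
    forall h, `|h| <= r -> `|f (x + h) - f x - h * d| <= e * `|h|) -> is_derive x 1 f d.
Proof.
move=> H.
have hl : (fun h : R => h^-1 *: (f (h *: 1 + x) - f x)) @ 0^' --> d.
  apply/cvgrPdist_le => e e0; have [r r0 hr] := H e e0.
  rewrite /dnbhs near_withinE; apply/nbhs_ballP; exists r => //= h.
  rewrite /ball /= sub0r normrN => hh h0.
  have := hr h (ltW hh); rewrite /GRing.scale /= mulr1 [h + x]addrC => hq.
  have -> : d - h^-1 * (f (x + h) - f x) = - (h^-1 * (f (x + h) - f x - h * d)) by field.
  rewrite normrN normrM normfV mulrC ler_pdivrMr ?normr_gt0 //.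
by split; [apply/cvg_ex; exists d|exact: cvg_lim].
Qed.

Definition cder f th (d : R[i]) := forall e : R, 0 < e -> exists2 r : R, 0 < r &
  forall h, `|h| <= r -> nc (f (th + h) - f th - h%:C * d) <= e * `|h|.

Lemma cder_part (part : R[i] -> R) f th d : (forall z, `|part z| <= nc z) ->
  (forall x y, part (x - y) = part x - part y) -> (forall a z, part (a%:C * z) = a * part z) ->
  cder f th d -> is_derive th 1 (fun s => part (f s)) (part d).
Proof.
move=> pn pB pZ hf; apply: eps_is_derive => e e0; have [r r0 hr] := hf e e0.
exists r => // h hh; rewrite -pZ -!pB; exact: le_trans (pn _) (hr h hh).
Qed.

Lemma cderM f g th df dg : cder f th df -> cder g th dg ->
  cder (fun s => f s * g s) th (df * g th + f th * dg).
Proof.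
move=> hf hg e e0.
have G0 := nc_ge0 (g th); have F0 := nc_ge0 (f th); have DF := nc_ge0 df; have DG := nc_ge0 dg.
pose e1 := e / 3 / (nc (g th) + nc dg + 2).
have e10 : 0 < e1 by rewrite !divr_gt0 //; lra.
pose e2 := e / 3 / (nc (f th) + 1).
have e20 : 0 < e2 by rewrite !divr_gt0 //; lra.
have [r1 r10 h1] := hf _ e10; have [r2 r20 h2] := hg _ e20; have [r3 r30 h3] := hg _ ltr01.
pose e3 := e / 3 / ((nc df + 1) * (nc dg + 1)).
have p0 : 0 < (nc df + 1) * (nc dg + 1) by rewrite mulr_gt0 //; lra.
have e30 : 0 < e3 by rewrite !divr_gt0 //; lra.
pose r := Num.min (Num.min 1 e3) (Num.min r1 (Num.min r2 r3)).
exists r; first by rewrite !lt_min ltr01 e30 r10 r20 r30.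
move=> h; rewrite !le_min => /andP[/andP[hh1 hh3] /and3P[k1 k2 k3]].
have {}h1 := h1 h k1; have {}h2 := h2 h k2; have {}h3 := h3 h k3.
have H0 := normr_ge0 h.
set E1 := f (th + h) - f th - h%:C * df in h1; set E2 := g (th + h) - g th - h%:C * dg in h2 h3.
have hD : nc (g (th + h) - g th) <= `|h| * (nc dg + 1).
  have -> : g (th + h) - g th = E2 + h%:C * dg by rewrite /E2; ring.
  apply: (le_trans (ncD _ _)); rewrite ncM ncR; lra.
have hG : nc (g (th + h)) <= nc (g th) + nc dg + 2.
  have -> : g (th + h) = g th + (g (th + h) - g th) by ring.
  apply: (le_trans (ncD _ _)); have : `|h| * (nc dg + 1) <= 1 * (nc dg + 1).
    by rewrite ler_wpM2r //; lra.
  lra.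
have -> : f (th + h) * g (th + h) - f th * g th - h%:C * (df * g th + f th * dg) =
   E1 * g (th + h) + f th * E2 + h%:C * df * (g (th + h) - g th).
  rewrite /E1 /E2; move: (f _) (f _) (g _) (g _) (_%:C) => a b c d k; ring.
have b1 : nc (E1 * g (th + h)) <= e / 3 * `|h|.
  rewrite ncM; apply: (le_trans (ler_pM (nc_ge0 _) (nc_ge0 _) h1 hG)).
  by rewrite mulrAC /e1 divfK // gt_eqF //; lra.
have b2 : nc (f th * E2) <= e / 3 * `|h|.
  rewrite ncM; apply: (le_trans (ler_wpM2l F0 h2)).
  rewrite mulrA ler_wpM2r // mulrC /e2; apply: div1_le => //; lra.
have b3 : nc (h%:C * df * (g (th + h) - g th)) <= e / 3 * `|h|.
  rewrite !ncM ncR.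
  have q1 : `|h| * nc df * nc (g (th + h) - g th) <= `|h| * nc df * (`|h| * (nc dg + 1)).
    by rewrite ler_wpM2l // mulr_ge0.
  have q2 : `|h| * (nc df * (nc dg + 1)) <= e / 3.
    apply: (@le_trans _ _ (`|h| * ((nc df + 1) * (nc dg + 1)))).
      rewrite ler_wpM2l // ler_wpM2r; lra.
    by rewrite -ler_pdivlMr.
  have q3 := ler_wpM2r H0 q2; lra.
apply: (le_trans (ncD _ _)); have := ncD (E1 * g (th + h)) (f th * E2); lra.
Qed.

Lemma eq_cder f g th d : f =1 g -> cder f th d -> cder g th d.
Proof.
by move=> h hf e e0; have [r r0 hr] := hf e e0; exists r => // k hk; rewrite -!h; exact: hr.
Qed.

Definition expi th : R[i] := (cos th)%:C + 'i * (sin th)%:C.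

Lemma expi0 : expi 0 = 1.
Proof. by rewrite /expi cos0 sin0 mulr0 addr0. Qed.

Lemma expiD a b : expi (a + b) = expi a * expi b.
Proof.
rewrite /expi cosD sinD realCB realCD !realCM.
have i2 : 'i * 'i = -1 :> R[i] by rewrite -expr2 sqrCi.
move: (cos a)%:C (cos b)%:C (sin a)%:C (sin b)%:C => ca cb sa sb.
have -> : (ca + 'i * sa) * (cb + 'i * sb) = ca * cb + ('i * 'i) * (sa * sb) + 'i * (sa * cb + ca * sb) by ring.
by rewrite i2 mulN1r.
Qed.

Lemma nc_expi a : nc (expi a) = 1.
Proof.
have e : complex.Re (expi a) = cos a /\ complex.Im (expi a) = sin a.
  by rewrite /expi /=; split; ring.
by rewrite ncE e.1 e.2 cos2Dsin2 sqrtr1.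
Qed.

Lemma expi_neq0 a : expi a != 0. Proof. by rewrite -nc_gt0 nc_expi. Qed.

Lemma expi_conj a : (expi a)^* = (expi a)^-1.
Proof.
apply: (mulfI (expi_neq0 a)); rewrite divff ?expi_neq0 //; exact: circle_conj (nc_expi a).
Qed.

Lemma expipi : expi pi = -1.
Proof. by rewrite /expi cospi sinpi mulr0 addr0 (rmorphN1 (real_complex R)). Qed.

Lemma expi_sin a : (2 * sin a)%:C = - 'i * (expi a - (expi a)^-1).
Proof.
rewrite -expi_conj /expi rmorphD rmorphM /= !conjR conjCi realCM (rmorph_nat (real_complex R)).
have i2 : 'i * 'i = -1 :> R[i] by rewrite -expr2 sqrCi.
move: (cos a)%:C (sin a)%:C => c s.
have -> : - 'i * (c + 'i * s - (c + - 'i * s)) = - ('i * 'i) * (2 * s) by ring.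
by rewrite i2 opprK mul1r.
Qed.

Lemma expi_cos a : (2 * cos a)%:C = expi a + (expi a)^-1.
Proof.
rewrite -expi_conj /expi rmorphD rmorphM /= !conjR conjCi realCM (rmorph_nat (real_complex R)); ring.
Qed.

Lemma cder_expi a b th : cder (fun s => expi (a * s + b)) th ('i * a%:C * expi (a * th + b)).
Proof.
have dc : is_derive th 1 (fun s : R => cos (a * s + b)) (- sin (a * th + b) * a).
  apply: is_derive_eq; rewrite /GRing.scale /=; ring.
have ds : is_derive th 1 (fun s : R => sin (a * s + b)) (cos (a * th + b) * a).
  apply: is_derive_eq; rewrite /GRing.scale /=; ring.
move=> e e0; have e2 : 0 < e / 2 by rewrite divr_gt0.
have [r1 r10 h1] := is_derive_eps dc e2; have [r2 r20 h2] := is_derive_eps ds e2.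
exists (Num.min r1 r2); first by rewrite lt_min r10.
move=> h; rewrite le_min => /andP[k1 k2]; have {}h1 := h1 h k1; have {}h2 := h2 h k2.
apply: (le_trans (nc_ReIm _)).
have -> : complex.Re (expi (a * (th + h) + b) - expi (a * th + b) - h%:C * ('i * a%:C * expi (a * th + b))) =
  cos (a * (th + h) + b) - cos (a * th + b) - h * (- sin (a * th + b) * a).
  by rewrite /expi /=; ring.
have -> : complex.Im (expi (a * (th + h) + b) - expi (a * th + b) - h%:C * ('i * a%:C * expi (a * th + b))) =
  sin (a * (th + h) + b) - sin (a * th + b) - h * (cos (a * th + b) * a).
  by rewrite /expi /=; ring.
lra.
Qed.

Lemma cder_ev (c : nat -> R) th : l1 (dcoef c) ->
  cder (fun s => ev c (expi s)) th ('i * expi th * ev (dcoef c) (expi th)).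
Proof.
move=> hd.
have hx s : nc (expi s) <= 1 by rewrite nc_expi.
set D := ev (dcoef c) (expi th).
have D0 := nc_ge0 D.
move=> e e0.
have he : cder (fun s => expi s) th ('i * expi th).
  have := @cder_expi 1 0 th; rewrite mulr1 mul1r addr0.
  by apply: eq_cder => s; rewrite mul1r addr0.
have e4 : 0 < e / 4 by rewrite divr_gt0.
have [r1 r10 h1] := ev_diff hd e4.
have eD : 0 < e / 2 / (nc D + 1) by rewrite !divr_gt0 // ltr_wpDl.
have [r2 r20 h2] := he _ eD; have [r3 r30 h3] := he _ ltr01.
have r120 : 0 < r1 / 2 by rewrite divr_gt0.
exists (Num.min (r1 / 2) (Num.min r2 r3)); first by rewrite !lt_min r20 r30 r120.
move=> h; rewrite !le_min => /and3P[k1 k2 k3]; have {}h2 := h2 h k2; have {}h3 := h3 h k3.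
have hx2 : nc (expi (th + h) - expi th) <= 2 * `|h|.
  rewrite -[expi (th + h) - expi th](subrK (h%:C * ('i * expi th))).
  apply: (le_trans (ncD _ _)); rewrite [nc (h%:C * _)]ncM ncR [nc ('i * _)]ncM nc_i nc_expi; lra.
have hr : 2 * `|h| <= r1 by lra.
have {}h1 := h1 _ _ (hx th) (hx (th + h)) (le_trans hx2 hr).
have -> : ev c (expi (th + h)) - ev c (expi th) - h%:C * ('i * expi th * D) =
  (ev c (expi (th + h)) - ev c (expi th) - (expi (th + h) - expi th) * D) +
  (expi (th + h) - expi th - h%:C * ('i * expi th)) * D.
  by move: (ev c _) (ev c _) => p q; ring.
apply: (le_trans (ncD _ _)); rewrite [nc (_ * D)]ncM.
have q1 : nc (ev c (expi (th + h)) - ev c (expi th) - (expi (th + h) - expi th) * D) <= e / 2 * `|h|.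
  apply: (le_trans h1); have := ler_wpM2l (ltW e4) hx2; lra.
have q2 := ler_wpM2r D0 h2.
have q3 : e / 2 / (nc D + 1) * `|h| * nc D <= e / 2 * `|h|.
  rewrite mulrAC ler_wpM2r //; apply: div1_le => //; lra.
lra.
Qed.

End RealDerivative.

Section Uniqueness.
Variable R : realType.

(* Energy argument: [e u^2 + v^2] increases up to [pi] and decreases afterwards. *)
Lemma singular_ode_unique (e : R) (u v u' v' : R -> R) : 0 < e ->
  (forall x : R, 0 < x < 2 * pi -> is_derive x 1 u (u' x)) ->
  (forall x : R, 0 < x < 2 * pi -> is_derive x 1 v (v' x)) ->
  (forall x : R, 2 * sin (x / 2) * u' x = cos (x / 2) * u x - v x) ->
  (forall x : R, 2 * sin (x / 2) * v' x = 4/3 * (cos (x / 2) * v x) + e * u x) ->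
  u pi = 0 -> v pi = 0 -> forall x : R, 0 < x < 2 * pi -> u x = 0.
Proof.
move=> e0 hu hv eu ev upi vpi.
have pi0 := pi_gt0 R.
pose E x := e * u x ^+ 2 + v x ^+ 2.
pose dE x := 2 * e * (u x * u' x) + 2 * (v x * v' x).
have hE x : 0 < x < 2 * pi -> is_derive x 1 E (dE x).
  move=> hx; have d1 := hu x hx; have d2 := hv x hx.
  apply: is_derive_eq; rewrite /dE /GRing.scale /=; ring.
have sE x : sin (x / 2) * dE x = cos (x / 2) * (e * u x ^+ 2 + 4/3 * v x ^+ 2).
  have -> : sin (x / 2) * dE x = e * u x * (2 * sin (x / 2) * u' x) + v x * (2 * sin (x / 2) * v' x).
    by rewrite /dE; ring.
  by rewrite eu ev; ring.
have Epi : E pi = 0 by rewrite /E upi vpi expr0n mulr0 addr0.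
have q0 x : 0 <= e * u x ^+ 2 + 4/3 * v x ^+ 2.
  by rewrite addr_ge0 // mulr_ge0 ?sqr_ge0 // ltW.
have s0 x : 0 < x < 2 * pi -> 0 < sin (x / 2) by move=> hx; apply: sin_gt0_pi; lra.
suff Ele x : 0 < x < 2 * pi -> E x <= 0.
  move=> x hx; have := Ele x hx; rewrite /E => h.
  have h1 : 0 <= e * u x ^+ 2 by rewrite mulr_ge0 ?sqr_ge0 // ltW.
  have /eqP : e * u x ^+ 2 = 0 by have := sqr_ge0 (v x); lra.
  by rewrite mulf_eq0 gt_eqF //= sqrf_eq0 => /eqP.
have mvt a b : 0 < a -> a < b -> b < 2 * pi -> exists2 z, a < z < b & E b - E a = dE z * (b - a).
  move=> a0 ab b2.
  have cf : {within `[a, b], continuous E}.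
    apply: derivable_within_continuous => y; rewrite in_itv /= => /andP[h1 h2].
    by case: (hE y (ltac:(lra))).
  have hd (y : R) : y \in `]a, b[ -> is_derive y 1 E (dE y).
    by rewrite in_itv /= => /andP[h1 h2]; apply: hE; lra.
  have [z] := MVT ab hd cf.
  by rewrite in_itv /= => hz ez; exists z.
move=> hx; case: (ltgtP x pi) => [xp|px|->]; last by rewrite Epi.
  have [z hz ez] := mvt x pi (ltac:(lra)) xp (ltac:(lra)).
  have hz2 : 0 < z < 2 * pi by lra.
  have c0 : 0 <= cos (z / 2) by apply: cos_ge0_pihalf; lra.
  have : 0 <= sin (z / 2) * dE z by rewrite sE mulr_ge0.
  rewrite pmulr_rge0 ?s0 // => dz; have : 0 <= dE z * (pi - x) by rewrite mulr_ge0 //; lra.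
  lra.
have [z hz ez] := mvt pi x (ltac:(lra)) px (ltac:(lra)).
have hz2 : 0 < z < 2 * pi by lra.
have c0 : cos (z / 2) <= 0.
  have -> : z / 2 = (z / 2 - pi / 2) + pi / 2 by ring.
  by rewrite cosDpihalf oppr_le0 sin_ge0_pi //; lra.
have : sin (z / 2) * dE z <= 0 by rewrite sE mulr_le0_ge0.
rewrite pmulr_rle0 ?s0 // => dz; have : dE z * (x - pi) <= 0 by rewrite mulr_le0_ge0 //; lra.
lra.
Qed.

End Uniqueness.

Section CircleSystem.
Variable R : realType.
Variables (e c : R).
Hypotheses (he : 0 < e <= 1) (hc : 0 <= c <= 1/3) (hcc : c * (c - 1/3) = 0).
Implicit Types th : R.

Lemma expiN th : expi (- th) = (expi th)^-1.
Proof.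
apply: (mulfI (expi_neq0 th)); rewrite divff ?expi_neq0 //.
by rewrite -expiD subrr expi0.
Qed.

Lemma realCN (a : R) : (- a)%:C = - a%:C :> R[i]. Proof. exact: rmorphN. Qed.

Let F := Fs e c.
Let G := Gs e c.
Let lF : l1 F := l1_Fs he hc.
Let lG : l1 G := l1_Gs he hc.

(** Coefficients of [(1 - x) f(x)]. This factor tames the singularity at 1: the recursion expresses
    the differentiated series of the product through summable sequences, so it is differentiable
    along the circle. *)
Definition jump (f : nat -> R) n : R := 1 * f n + -1 * delay f n.

Lemma ev_jump (f : nat -> R) x : l1 f -> nc x <= 1 -> ev (jump f) x = (1 - x) * ev f x.
Proof.
move=> hf hx; rewrite ev_lin //; last exact: l1_delay.
by rewrite ev_delay // (rmorphN1 (real_complex R)) (rmorph1 (real_complex R)); ring.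
Qed.

Lemma l1_jump f : l1 f -> l1 (jump f).
Proof. by move=> hf; apply: l1_lin => //; exact: l1_delay. Qed.

Lemma l1_tailS (f : nat -> R) : l1 f -> l1 (fun n => f n.+1).
Proof. exact: (@bdd_shift _ (fun n => `|f n|) (fun n => normr_ge0 _)). Qed.

Let dF n : dcoef (jump F) n = 1 * (1 * G n.+1 + -1 * F n) + (- c) * jump F n.+1.
Proof.
rewrite /dcoef /jump /=; have := FsS e hc n; rewrite -/F -/G -[n.+1%:R]natr1; lra.
Qed.

Let dG n : dcoef (jump G) n = 1 * (- e * F n + - (4/3) * G n) + - (c - 1/3) * jump G n.+1.
Proof.
rewrite /dcoef /jump /=; have := GsS e hc n; rewrite -/F -/G -[n.+1%:R]natr1; lra.
Qed.

Let l1_dF : l1 (dcoef (jump F)).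
Proof.
have h := l1_lin 1 (- c) (l1_lin 1 (-1) (l1_tailS lG) lF) (l1_tailS (l1_jump lF)).
by apply: bdd_le h => n; rewrite dF.
Qed.

Let l1_dG : l1 (dcoef (jump G)).
Proof.
have h := l1_lin 1 (- (c - 1/3)) (l1_lin (- e) (- (4/3)) lF lG) (l1_tailS (l1_jump lG)).
by apply: bdd_le h => n; rewrite dG.
Qed.

Let ev_dF x : nc x <= 1 ->
  x * ev (dcoef (jump F)) x = ev G x - x * ev F x - c%:C * ((1 - x) * ev F x).
Proof.
move=> hx; rewrite (eq_ev _ dF) ev_lin //; [|exact: l1_lin (l1_tailS lG) lF|exact: l1_tailS (l1_jump lF)].
rewrite ev_lin //; last exact: l1_tailS.
have h1 := ev_tailS lG hx; have h2 := ev_tailS (l1_jump lF) hx.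
rewrite ev_jump // in h2.
have j0 : (jump F 0)%:C = 1 by rewrite /jump /F /Fs /= mulr0 addr0 mulr1.
have g0 : (G 0)%:C = c%:C by [].
rewrite j0 in h2; rewrite g0 in h1.
have alg (A J f g k : R[i]) : x * A = g - k -> x * J = (1 - x) * f - 1 ->
    x * (1 * (1 * A + -1 * f) + - k * J) = g - x * f - k * ((1 - x) * f).
  move=> eA eJ; have -> : x * (1 * (1 * A + -1 * f) + - k * J) = x * A - x * f - k * (x * J) by ring.
  by rewrite eA eJ; ring.
by rewrite (rmorphN1 (real_complex R)) (rmorph1 (real_complex R)) realCN; exact: alg.
Qed.

Let ev_dG x : nc x <= 1 ->
  x * ev (dcoef (jump G)) x =
  - (e%:C * (x * ev F x)) - 4/3 * (x * ev G x) - (c%:C - 1/3) * ((1 - x) * ev G x).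
Proof.
move=> hx; rewrite (eq_ev _ dG) ev_lin //; [|exact: l1_lin|exact: l1_tailS (l1_jump lG)].
rewrite ev_lin //.
have h2 := ev_tailS (l1_jump lG) hx; rewrite ev_jump // in h2.
have j0 : (jump G 0)%:C = c%:C by rewrite /jump /G /Gs /= mulr0 addr0 mul1r.
rewrite j0 in h2.
have third (a : R) : (a / 3)%:C = a%:C / 3 :> R[i].
  by rewrite realCM -(rmorph_nat (real_complex R)) -(fmorphV (real_complex R)).
have hc3 : (c%:C - 1/3) * c%:C = 0 :> R[i].
  by rewrite -[1]/((1 : R)%:C) -third -realCB -realCM mulrC hcc.
have alg (J f g k l : R[i]) : x * J = (1 - x) * g - k -> (k - 1/3) * k = 0 ->
    x * (1 * (- l * f + - (4/3) * g) + - (k - 1/3) * J) =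
    - (l * (x * f)) - 4/3 * (x * g) - (k - 1/3) * ((1 - x) * g).
  move=> eJ ek; have -> : x * (1 * (- l * f + - (4/3) * g) + - (k - 1/3) * J) =
     - (l * (x * f)) - 4/3 * (x * g) - (k - 1/3) * (x * J) by ring.
  by rewrite eJ mulrBr ek subr0.
rewrite !realCN realCB !third (rmorph1 (real_complex R)) (rmorph_nat (real_complex R)).
exact: alg.
Qed.

(* With [x = expi th], these are [x^c (1 - x) F / x^(1/2)] and [x^c (1 - x) g / x] up to a
   constant phase, chosen so that they satisfy a linear system with real coefficients. *)
Definition circU th := expi ((c - 1/2) * th + - (c * pi)) * ev (jump F) (expi th).
Definition circV th := expi ((c - 1) * th + - (c * pi)) * ev (jump G) (expi th).

Let phaseU th : expi ((c - 1/2) * th + - (c * pi)) = expi (c * (th - pi)) * (expi (th / 2))^-1.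
Proof. by rewrite -expiN -expiD; congr expi; field. Qed.

Let phaseV th : expi ((c - 1) * th + - (c * pi)) = expi (c * (th - pi)) * (expi (th / 2))^-1 * (expi (th / 2))^-1.
Proof. by rewrite -expiN -!expiD; congr expi; field. Qed.

Let expi_half th : expi th = expi (th / 2) * expi (th / 2).
Proof. by rewrite -expiD; congr expi; field. Qed.

Let cosC th : (cos (th / 2))%:C = (expi (th / 2) + (expi (th / 2))^-1) / 2.
Proof.
have n2 : 2 != 0 :> R[i] by rewrite pnatr_eq0.
by apply: (mulIf n2); rewrite divfK // -expi_cos realCM (rmorph_nat (real_complex R)) mulrC.
Qed.

Let algU (i w E f g k D : R[i]) : i * i = -1 -> w != 0 ->
  w * w * D = g - w * w * f - k * ((1 - w * w) * f) ->
  - i * (w - w^-1) * (i * (k - 1/2) * (E * w^-1) * ((1 - w * w) * f) + E * w^-1 * (i * (w * w) * D)) =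
  (w + w^-1) / 2 * (E * w^-1 * ((1 - w * w) * f)) - E * w^-1 * w^-1 * ((1 - w * w) * g).
Proof.
move=> i2 w0 eD.
have -> : - i * (w - w^-1) * (i * (k - 1/2) * (E * w^-1) * ((1 - w * w) * f) + E * w^-1 * (i * (w * w) * D)) =
  - (i * i) * ((w - w^-1) * (E * w^-1) * ((k - 1/2) * ((1 - w * w) * f) + w * w * D)) by ring.
by rewrite i2 eD; field.
Qed.

Let algV (i w E f g k l D : R[i]) : i * i = -1 -> w != 0 ->
  w * w * D = - (l * (w * w * f)) - 4/3 * (w * w * g) - (k - 1/3) * ((1 - w * w) * g) ->
  - i * (w - w^-1) * (i * (k - 1) * (E * w^-1 * w^-1) * ((1 - w * w) * g) +
     E * w^-1 * w^-1 * (i * (w * w) * D)) =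
  4/3 * ((w + w^-1) / 2 * (E * w^-1 * w^-1 * ((1 - w * w) * g))) + l * (E * w^-1 * ((1 - w * w) * f)).
Proof.
move=> i2 w0 eD.
have -> : - i * (w - w^-1) * (i * (k - 1) * (E * w^-1 * w^-1) * ((1 - w * w) * g) +
     E * w^-1 * w^-1 * (i * (w * w) * D)) =
  - (i * i) * ((w - w^-1) * (E * w^-1 * w^-1) * ((k - 1) * ((1 - w * w) * g) + w * w * D)) by ring.
by rewrite i2 eD; field.
Qed.

Let ii : 'i * 'i = -1 :> R[i]. Proof. by rewrite -expr2 sqrCi. Qed.

Let halfC : (1/2 : R)%:C = 1/2 :> R[i].
Proof. by rewrite realCM -(rmorph_nat (real_complex R)) -(fmorphV (real_complex R)). Qed.

(** With [w = expi (th / 2)] the singular factor is [1 - x = - 2 i w sin (th / 2)]; the half-angle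
    phases of [circU] and [circV] absorb [i] and [w], leaving real coefficients. *)
Lemma circU_der th : exists2 d, cder circU th d &
  (2 * sin (th / 2))%:C * d = (cos (th / 2))%:C * circU th - circV th.
Proof.
have hx : nc (expi th) <= 1 by rewrite nc_expi.
exists ('i * (c - 1/2)%:C * expi ((c - 1/2) * th + - (c * pi)) * ev (jump F) (expi th) +
  expi ((c - 1/2) * th + - (c * pi)) * ('i * expi th * ev (dcoef (jump F)) (expi th))).
  by apply: cderM; [exact: cder_expi|exact: cder_ev].
have := ev_dF hx; rewrite /circU /circV !ev_jump // expi_sin cosC phaseU phaseV realCB halfC expi_half.
exact: algU ii (expi_neq0 _).
Qed.

Lemma circV_der th : exists2 d, cder circV th d &
  (2 * sin (th / 2))%:C * d = 4/3 * ((cos (th / 2))%:C * circV th) + e%:C * circU th.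
Proof.
have hx : nc (expi th) <= 1 by rewrite nc_expi.
exists ('i * (c - 1)%:C * expi ((c - 1) * th + - (c * pi)) * ev (jump G) (expi th) +
  expi ((c - 1) * th + - (c * pi)) * ('i * expi th * ev (dcoef (jump G)) (expi th))).
  by apply: cderM; [exact: cder_expi|exact: cder_ev].
have := ev_dG hx; rewrite /circU /circV !ev_jump // expi_sin cosC phaseU phaseV realCB expi_half.
exact: algV ii (expi_neq0 _).
Qed.

Lemma circU_pi : circU pi = - 'i * (2 * ev F (-1)).
Proof.
have hx : nc (expi pi) <= 1 :> R by rewrite nc_expi.
have e0 : expi (c * (pi - pi)) = 1 :> R[i] by rewrite subrr mulr0 expi0.
rewrite /circU phaseU e0 mul1r (ev_jump lF hx) expipi.
have -> : expi (pi / 2) = 'i :> R[i] by rewrite /expi cos_pihalf sin_pihalf add0r mulr1.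
have -> : 'i^-1 = - 'i :> R[i].
  have i0 : 'i != 0 :> R[i] by rewrite -nc_gt0 nc_i.
  by apply: (mulfI i0); rewrite divff // mulrN ii opprK.
by rewrite opprK.
Qed.

Lemma circV_pi : circV pi = - (2 * ev G (-1)).
Proof.
have hx : nc (expi pi) <= 1 :> R by rewrite nc_expi.
have e0 : expi (c * (pi - pi)) = 1 :> R[i] by rewrite subrr mulr0 expi0.
rewrite /circV phaseV e0 mul1r (ev_jump lG hx) expipi -invfM.
have -> : expi (pi / 2) = 'i :> R[i] by rewrite /expi cos_pihalf sin_pihalf add0r mulr1.
by rewrite ii invrN1 opprK mulN1r.
Qed.

Lemma circU_E th : circU th = - 'i * (2 * sin (th / 2))%:C * (expi (c * (th - pi)) * ev F (expi th)).
Proof.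
have hx : nc (expi th) <= 1 by rewrite nc_expi.
have w0 := expi_neq0 (th / 2).
rewrite /circU phaseU ev_jump // expi_sin (expi_half th).
move: (ev _ _) => f; move: (expi (c * _)) (expi (th / 2)) w0 => E w w0.
have -> : - 'i * (- 'i * (w - w^-1)) * (E * f) = ('i * 'i) * ((w - w^-1) * (E * f)) by ring.
by rewrite ii; field.
Qed.

End CircleSystem.

Section CircleIdentity.
Variable R : realType.
Variables (t e k : R).
Hypotheses (he : 0 < e <= 1).
Hypothesis eF : (1 - t)%:C * ev (Fs e 0) (-1) = k%:C * ev (Fs e (1/3)) (-1).
Hypothesis eG : (1 + t)%:C * ev (Gs e 0) (-1) = k%:C * ev (Gs e (1/3)) (-1).

Let hc0 : 0 <= (0 : R) <= 1/3. Proof. lra. Qed.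
Let hcc0 : (0 : R) * (0 - 1/3) = 0. Proof. exact: mul0r. Qed.
Let hc1 : 0 <= (1/3 : R) <= 1/3. Proof. lra. Qed.
Let hcc1 : (1/3 : R) * (1/3 - 1/3) = 0. Proof. by rewrite subrr mulr0. Qed.

(* [part] is the real or the imaginary part, [a] the corresponding coefficient [1 + t] or [1 - t]. *)
Let agree (part : R[i] -> R) (a : R) : (forall z, `|part z| <= nc z) ->
  (forall x y, part (x - y) = part x - part y) -> (forall b z, part (b%:C * z) = b * part z) ->
  a * part (circU e 0 pi) = k * part (circU e (1/3) pi) ->
  a * part (circV e 0 pi) = k * part (circV e (1/3) pi) ->
  forall th : R, 0 < th < 2 * pi -> a * part (circU e 0 th) = k * part (circU e (1/3) th).
Proof.
move=> pn pB pZ hU hV th hth.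
have pN y : part (- y) = - part y by rewrite -sub0r pB -{1}(subrr 0) pB subrr sub0r.
have pD x y : part (x + y) = part x + part y by rewrite -{1}[y]opprK pB pN opprK.
have /choice [dU0 hdU0] : forall s, exists d, cder (circU e 0) s d /\
    (2 * sin (s / 2))%:C * d = (cos (s / 2))%:C * circU e 0 s - circV e 0 s.
  by move=> s; have [d h1 h2] := circU_der he hc0 s; exists d.
have /choice [dU1 hdU1] : forall s, exists d, cder (circU e (1/3)) s d /\
    (2 * sin (s / 2))%:C * d = (cos (s / 2))%:C * circU e (1/3) s - circV e (1/3) s.
  by move=> s; have [d h1 h2] := circU_der he hc1 s; exists d.
have /choice [dV0 hdV0] : forall s, exists d, cder (circV e 0) s d /\
    (2 * sin (s / 2))%:C * d = 4/3 * ((cos (s / 2))%:C * circV e 0 s) + e%:C * circU e 0 s.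
  by move=> s; have [d h1 h2] := circV_der he hc0 hcc0 s; exists d.
have /choice [dV1 hdV1] : forall s, exists d, cder (circV e (1/3)) s d /\
    (2 * sin (s / 2))%:C * d = 4/3 * ((cos (s / 2))%:C * circV e (1/3) s) + e%:C * circU e (1/3) s.
  by move=> s; have [d h1 h2] := circV_der he hc1 hcc1 s; exists d.
have c43 : 4/3 = (4/3)%:C :> R[i].
  by rewrite realCM -!(rmorph_nat (real_complex R)) -(fmorphV (real_complex R)).
pose comb (f g : R -> R[i]) s := a * part (f s) - k * part (g s).
have comb_der f g df dg s : cder f s df -> cder g s dg ->
    is_derive s 1 (comb f g) (a * part df - k * part dg).
  move=> hf hg; have h1 := cder_part pn pB pZ hf; have h2 := cder_part pn pB pZ hg.
  by apply: is_derive_eq.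
have e0 : 0 < e by case/andP: he.
suff : comb (circU e 0) (circU e (1/3)) th = 0 by move/eqP; rewrite subr_eq0 => /eqP.
apply: (@singular_ode_unique R e (comb (circU e 0) (circU e (1/3))) (comb (circV e 0) (circV e (1/3)))
  (comb dU0 dU1) (comb dV0 dV1)).
- exact: e0.
- by move=> s _; apply: comb_der; [case: (hdU0 s)|case: (hdU1 s)].
- by move=> s _; apply: comb_der; [case: (hdV0 s)|case: (hdV1 s)].
- move=> s; have h0 := congr1 part (hdU0 s).2; have h1 := congr1 part (hdU1 s).2.
  rewrite !(pZ, pB) in h0 h1.
  have -> : 2 * sin (s / 2) * comb dU0 dU1 s =
    a * (2 * sin (s / 2) * part (dU0 s)) - k * (2 * sin (s / 2) * part (dU1 s)) by rewrite /comb; ring.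
  by rewrite h0 h1 /comb; ring.
- move=> s; have h0 := congr1 part (hdV0 s).2; have h1 := congr1 part (hdV1 s).2.
  rewrite c43 !(pZ, pD) in h0 h1.
  have -> : 2 * sin (s / 2) * comb dV0 dV1 s =
    a * (2 * sin (s / 2) * part (dV0 s)) - k * (2 * sin (s / 2) * part (dV1 s)) by rewrite /comb; ring.
  by rewrite h0 h1 /comb; ring.
- by rewrite /comb hU subrr.
- by rewrite /comb hV subrr.
- exact: hth.
Qed.

Let ReZ (b : R) (z : R[i]) : complex.Re (b%:C * z) = b * complex.Re z.
Proof. by case: z => x y /=; rewrite mul0r subr0. Qed.

Let ImZ (b : R) (z : R[i]) : complex.Im (b%:C * z) = b * complex.Im z.
Proof. by case: z => x y /=; rewrite mul0r addr0. Qed.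

Let ReB (x y : R[i]) : complex.Re (x - y) = complex.Re x - complex.Re y.
Proof. exact: raddfB. Qed.

Let ImB (x y : R[i]) : complex.Im (x - y) = complex.Im x - complex.Im y.
Proof. exact: raddfB. Qed.

Let real_at_N1 f : l1 f -> exists v : R, ev f (-1) = v%:C.
Proof.
move=> hf; have n1 : `|-1| <= 1 :> R by rewrite normrN1.
have [v _] := ev_real hf n1; rewrite (rmorphN1 (real_complex R)) => ->; by exists v.
Qed.

(** At [pi] the values of [circU] are imaginary and those of [circV] real, so two of the four
    initial conditions are [0 = 0]. The others are [eF], with factor [1 - t] on imaginary parts, and
    [eG], with factor [1 + t] on real parts. *)
Lemma circle_relation (th : R) : 0 < th < 2 * pi ->
  ev (Fs e 0) (expi th) - t%:C * (ev (Fs e 0) (expi th))^* =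
  k%:C * (expi (1/3 * (th - pi)) * ev (Fs e (1/3)) (expi th)).
Proof.
move=> hth; have lF0 := l1_Fs he hc0; have lG0 := l1_Gs he hc0.
have lF1 := l1_Fs he hc1; have lG1 := l1_Gs he hc1.
have [f0 ef0] := real_at_N1 lF0; have [f1 ef1] := real_at_N1 lF1.
have [g0 eg0] := real_at_N1 lG0; have [g1 eg1] := real_at_N1 lG1.
have EF : (1 - t) * f0 = k * f1.
  by move: eF; rewrite ef0 ef1 -!realCM => /(congr1 (@complex.Re R)).
have EG : (1 + t) * g0 = k * g1.
  by move: eG; rewrite eg0 eg1 -!realCM => /(congr1 (@complex.Re R)).
have U0 : circU e 0 pi = - 'i * (2 * f0%:C) by rewrite circU_pi // ef0.
have U1 : circU e (1/3) pi = - 'i * (2 * f1%:C) by rewrite circU_pi // ef1.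
have V0 : circV e 0 pi = - (2 * g0%:C) by rewrite circV_pi // eg0.
have V1 : circV e (1/3) pi = - (2 * g1%:C) by rewrite circV_pi // eg1.
have n2 : 2 = (2 : R)%:C :> R[i] by rewrite (rmorph_nat (real_complex R)).
have rRe (b : R) : complex.Re (- 'i * (2 * b%:C)) = 0 by rewrite n2 /=; ring.
have rIm (b : R) : complex.Im (- 'i * (2 * b%:C)) = - (2 * b) by rewrite n2 /=; ring.
have sRe (b : R) : complex.Re (- (2 * b%:C)) = - (2 * b) by rewrite n2 /=; ring.
have sIm (b : R) : complex.Im (- (2 * b%:C)) = 0 by rewrite n2 /=; ring.
have hRe : (1 + t) * complex.Re (circU e 0 th) = k * complex.Re (circU e (1/3) th).
  apply: (agree (@nc_Re R) ReB ReZ) hth; first by rewrite U0 U1 !rRe !mulr0.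
  by rewrite V0 V1 !sRe; have := EG; lra.
have hIm : (1 - t) * complex.Im (circU e 0 th) = k * complex.Im (circU e (1/3) th).
  apply: (agree (@nc_Im R) ImB ImZ) hth; last by rewrite V0 V1 !sIm !mulr0.
  by rewrite U0 U1 !rIm; have := EF; lra.
(* The factors [1 + t] and [1 - t] on the two parts amount to adding [t] times the conjugate. As
   [circU] contains a factor [- i], the sign in front of the conjugate turns into the minus of the
   conclusion. *)
have main : k%:C * circU e (1/3) th = circU e 0 th + t%:C * (circU e 0 th)^*.
  case: (circU e 0 th) (circU e (1/3) th) hRe hIm => a b [a' b'] /= hRe hIm.
  apply/eqP; rewrite eq_complex /= !mul0r !subr0 !addr0; apply/andP; split; apply/eqP; lra.
have s0 : 0 < sin (th / 2) by apply: sin_gt0_pi; lra.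
move: main; rewrite !circU_E // [0 * (th - pi)]mul0r expi0 [1 * ev _ _]mul1r.
have csg : ((2 * sin (th / 2))%:C)^* = (2 * sin (th / 2))%:C :> R[i] by exact: conjR.
have sg0 : - 'i * (2 * sin (th / 2))%:C != 0 :> R[i].
  by rewrite mulf_neq0 // ?oppr_eq0 -?nc_gt0 ?nc_i // ncR normr_gt0 gt_eqF // mulr_gt0.
move: (2 * sin _)%:C csg sg0 => sg csg sg0.
rewrite 2!rmorphM rmorphN /= conjCi csg opprK.
move: (ev (Fs e 0) _) (ev (Fs e (1/3)) _) (expi (_ * _)) => f g E main.
apply: (mulfI sg0); have -> : - 'i * sg * (k%:C * (E * g)) = k%:C * (- 'i * sg * (E * g)) by ring.
by rewrite main; ring.
Qed.

End CircleIdentity.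

Section Parametrization.
Variable R : realType.

Lemma expi_surj (x : R[i]) : nc x = 1 -> x != 1 -> exists2 th : R, 0 < th < 2 * pi & x = expi th.
Proof.
case: x => a b; rewrite ncE /= => h x1.
have pi0 := pi_gt0 R.
have ab : a ^+ 2 + b ^+ 2 = 1.
  by rewrite -[LHS]sqr_sqrtr ?addr_ge0 ?sqr_ge0 // h expr1n.
have ha : -1 <= a <= 1.
  by have := sqr_ge0 b; move=> hb; apply/andP; split; nra.
have an1 : a != 1.
  apply: contra x1 => /eqP a1; have b0 : b = 0.
    by apply/eqP; rewrite -sqrf_eq0; apply/eqP; move: ab; rewrite a1 expr1n; lra.
  by rewrite a1 b0.
have hcos := acosK ha; have hsin := sin_acos ha.
have b2 : Num.sqrt (1 - a ^+ 2) = `|b| by rewrite -sqrtr_sqr; congr Num.sqrt; lra.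
have ac0 : 0 < acos a.
  rewrite lt0r acos_ge0 // andbT; apply: contra an1 => /eqP e.
  by rewrite -hcos e cos0.
have acpi := acos_lepi ha.
have mk (th : R) : cos th = a -> sin th = b -> (a +i* b) = expi th.
  move=> e1 e2; rewrite /expi e1 e2; apply/eqP; rewrite eq_complex /=.
  by apply/andP; split; apply/eqP; ring.
case: (leP 0 b) => hb.
  exists (acos a); first by apply/andP; split => //; lra.
  by apply: mk => //; rewrite hsin b2 ger0_norm.
exists (2 * pi - acos a); first by apply/andP; split; lra.
have e2 : 2 * pi - acos a = - acos a + pi *+ 2 by ring.
apply: mk; first by rewrite e2 cosD2pi cosN.
by rewrite e2 sinD2pi sinN hsin b2 ltr0_norm // opprK.
Qed.

End Parametrization.

Section BoundaryInS.
Variable R : realType.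
Variables (t e k : R).
Hypotheses (t0 : 0 < t) (he : 0 < e <= 1).
Hypothesis eF : (1 - t)%:C * ev (Fs e 0) (-1) = k%:C * ev (Fs e (1/3)) (-1).
Hypothesis eG : (1 + t)%:C * ev (Gs e 0) (-1) = k%:C * ev (Gs e (1/3)) (-1).

Let hc0 : 0 <= (0 : R) <= 1/3. Proof. lra. Qed.
Let hcc0 : (0 : R) * (0 - 1/3) = 0. Proof. exact: mul0r. Qed.
Let hc1 : 0 <= (1/3 : R) <= 1/3. Proof. lra. Qed.
Let hcc1 : (1/3 : R) * (1/3 - 1/3) = 0. Proof. by rewrite subrr mulr0. Qed.

Let F := Fs e 0.
Let G := Fs e (1/3).
Lemma l1_F0 : l1 F. Proof. exact: l1_Fs he hc0. Qed.
Lemma l1_F1 : l1 G. Proof. exact: l1_Fs he hc1. Qed.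

Lemma ev_one0 (f : nat -> R) : l1 f -> rsum f 0 -> ev f 1 = 0.
Proof.
move=> hf h; have n1 : `|1| <= 1 :> R by rewrite normr1.
have [v hv] := ev_real hf n1; rewrite (rmorph1 (real_complex R)) => ->.
have -> : v = 0; last by [].
by apply: (rsum_uniq _ h); apply: eq_rsum hv => i; rewrite expr1n mul1r.
Qed.

Lemma F_one : ev F 1 = 0.
Proof. exact: ev_one0 l1_F0 (Fs_sum0 he hc0 hcc0). Qed.

Lemma G_one : ev G 1 = 0.
Proof. exact: ev_one0 l1_F1 (Fs_sum0 he hc1 hcc1). Qed.

Lemma boundary_relation x : nc x = 1 ->
  'i * (k%:C ^+ 3 * (x * ev G x ^+ 3)) = ('i * ev F x + t%:C * ('i * ev F x)^*) ^+ 3.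
Proof.
(* The point 1 is excluded from [circle_relation], but both sides vanish there with the two
   series. *)
move=> hx; have [->|x1] := eqVneq x 1.
  by rewrite F_one G_one !(mulr0, expr0n) /= rmorph0 !(mulr0, addr0) expr0n.
have [th hth ->] := expi_surj hx x1.
have rel := circle_relation he eF eG hth; rewrite -/F -/G in rel.
have E3 : expi (1/3 * (th - pi)) ^+ 3 = - expi th :> R[i].
  rewrite !exprS expr0 mulr1 -!expiD.
  have -> : 1/3 * (th - pi) + (1/3 * (th - pi) + 1/3 * (th - pi)) = th + - pi by field.
  by rewrite expiD expiN expipi invrN1 mulrN1.
have i3 : 'i ^+ 3 = - 'i :> R[i] by rewrite exprS sqrCi mulrN1.
rewrite rmorphM /= conjCi.
move: E3 rel; move: (ev F _) (ev G _) (expi (1/3 * _)) => f g E; move: (expi th) => y E3 rel.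
have -> : 'i * f + t%:C * (- 'i * f^*) = 'i * (f - t%:C * f^*) by ring.
rewrite rel !exprMn i3 E3; ring.
Qed.

End BoundaryInS.

(** * The family of discs through the origin *)

Section Interior.
Variable R : realType.
Implicit Types (c : nat -> R) (x y : R[i]).

(** Rescaling to a radius [rho] between [|x|] and 1 makes the differentiated series summable, as
    [n rho^n <= 1 / (1 - rho)]; [ev_diff] then applies. *)
Lemma ev_diff_open c x : l1 c -> nc x < 1 -> exists d : R[i], forall e : R, 0 < e ->
  exists2 r : R, 0 < r & forall y, nc (y - x) <= r -> nc (ev c y - ev c x - (y - x) * d) <= e * nc (y - x).
Proof.
move=> hc hx; pose rho := (1 + nc x) / 2.
have x0 := nc_ge0 x.
have rho0 : 0 < rho by rewrite /rho; lra.
have rho1 : rho < 1 by rewrite /rho; lra.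
have xr : nc x < rho by rewrite /rho; lra.
have rC : rho%:C != 0 :> R[i] by rewrite realC_neq0 gt_eqF.
pose c' n := c n * rho ^+ n.
have nr n : n%:R * rho ^+ n <= (1 - rho)^-1.
  have hr : 0 <= rho < 1 by rewrite ltW.
  apply: le_trans (geom_sum_le n hr).
  rewrite -sum_cst; apply: ler_sum => i _; by apply: ler_wiXn2l; [exact: ltW|exact: ltW|exact: ltnW].
have hd : l1 (dcoef c').
  have q0 : 0 <= (1 - rho)^-1 by rewrite invr_ge0; lra.
  have := bddZ q0 (@bdd_shift _ (fun n => `|c n|) (fun n => normr_ge0 _) hc).
  apply: bdd_le => n; rewrite /dcoef /c' mulrCA normrM mulrC ler_wpM2r //.
  by rewrite ger0_norm ?nr // mulr_ge0 ?exprn_ge0 // ltW.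
have hc' : l1 c' by exact: l1_dcoef.
have evE y : nc y <= rho -> ev c y = ev c' (y / rho%:C).
  move=> hy; have y1 : nc y <= 1 by apply: le_trans hy _; exact: ltW.
  apply: ev_uniq => //; have yr : nc (y / rho%:C) <= 1.
    by rewrite ncM ncV ncR gtr0_norm // ler_pdivrMr // mul1r.
  apply: eq_csum (evP hc' yr) => n; rewrite /c' realCM rmorphXn /= expr_div_n.
  by rewrite -mulrA [_ * (y ^+ n / _)]mulrCA divff ?mulr1 // expf_neq0.
exists (ev (dcoef c') (x / rho%:C) / rho%:C) => e e0.
have er : 0 < e * rho by rewrite mulr_gt0.
have [r r0 hr] := ev_diff hd er.
exists (Num.min (rho - nc x) (r * rho)); first by rewrite lt_min mulr_gt0 // andbT subr_gt0.
move=> y; rewrite le_min => /andP[h1 h2].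
have hy : nc y <= rho.
  by rewrite -[y](subrK x); apply: (le_trans (ncD _ _)); lra.
have nd z : nc (z / rho%:C) = nc z / rho by rewrite ncM ncV ncR gtr0_norm.
have := hr (x / rho%:C) (y / rho%:C).
rewrite -mulrBl !nd !ler_pdivrMr // !mul1r => /(_ (ltW xr) hy h2).
rewrite -!evE ?(ltW xr) //.
have -> : (y - x) / rho%:C * ev (dcoef c') (x / rho%:C) = (y - x) * (ev (dcoef c') (x / rho%:C) / rho%:C) by ring.
move/le_trans; apply; rewrite -mulrA [rho * _]mulrC divfK // gt_eqF //.
Qed.

Lemma dalg_unif_cont (f : R[i] -> R[i]) : dalg f -> forall e : R, 0 < e ->
  exists2 d : R, 0 < d & forall x y, nc x <= 1 -> nc y <= 1 -> nc (y - x) <= d -> nc (f y - f x) <= e.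
Proof.
move=> hf e e0; have e3 : 0 < e / 3 by rewrite divr_gt0.
have [q hq] := hf _ e3.
pose L := \sum_(i < size q) nc q`_i * i%:R.
have L0 : 0 <= L by rewrite sumr_ge0 // => i _; rewrite mulr_ge0 ?nc_ge0.
have L1 : 0 < L + 1 by rewrite ltr_wpDl.
exists (e / 3 / (L + 1)); first by rewrite divr_gt0.
move=> x y hx hy hxy.
have hq2 : nc (q.[y] - q.[x]) <= e / 3.
  rewrite !horner_coef -sumrB; apply: (le_trans (nc_sum _ _ _)).
  apply: (@le_trans _ _ (L * nc (y - x))).
    rewrite /L mulr_suml; apply: ler_sum => i _; rewrite -mulrBr ncM -mulrA ler_wpM2l ?nc_ge0 //.
    by case: (i : nat) => [|j]; [rewrite !expr0 subrr nc0 mul0r|exact: pow_sub_le].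
  rewrite mulrC; apply: (le_trans (ler_wpM2r L0 hxy)); apply: div1_le => //; exact: ltW.
have -> : f y - f x = (f y - q.[y]) + (q.[y] - q.[x]) - (f x - q.[x]) by ring.
apply: (le_trans (ncB _ _)); have h1 := ncD (f y - q.[y]) (q.[y] - q.[x]).
have h2 := hq x hx; have h3 := hq y hy; lra.
Qed.

End Interior.

(** Iterating the step gives [b^n Z(x0) <= a^n B] for every [n], impossible if [b > a]. Boundedness
    replaces the attainment of a maximum. *)
Lemma scaling_le (R : realType) (Z : R[i] -> R) (a b B : R) (x0 : R[i]) : 0 < a -> 0 < b ->
  (forall x, nc x <= 1 -> Z x <= B) -> nc x0 <= 1 -> 0 < Z x0 ->
  (forall x, nc x <= 1 -> exists2 y, nc y <= 1 & b * Z x = a * Z y) -> b <= a.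
Proof.
move=> a0 b0 hB hx0 Z0 step.
have iter n x : nc x <= 1 -> b ^+ n * Z x <= a ^+ n * B.
  elim: n x => [|n IH] x hx; first by rewrite !expr0 !mul1r hB.
  have [y hy e1] := step x hx; rewrite exprSr -mulrA e1 mulrCA exprS -mulrA.
  by apply: ler_wpM2l; [exact: ltW|exact: IH].
have q0 : 0 <= b / a by rewrite divr_ge0 // ltW.
have : b / a <= 1.
  apply: (@exp_bounded_le1 _ _ (B / Z x0)) => // n.
  have hn := iter n x0 hx0.
  by rewrite expr_div_n ler_pdivrMr ?exprn_gt0 // mulrAC ler_pdivlMr // [B * _]mulrC.
by rewrite ler_pdivrMr // mul1r.
Qed.

Section ComplexTopology.
Variable R : realType.
Implicit Types (x : R[i]).

Lemma gt0_real (e : R[i]) : 0 < e -> exists2 r : R, 0 < r & e = r%:C.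
Proof.
by case: e => a b; rewrite ltcE /= => /andP[/eqP b0 a0]; exists a => //; rewrite b0.
Qed.

Lemma cvg_nc (T : Type) (F : set_system T) (FF : Filter F) (f : T -> R[i]) (l : R[i]) :
  (forall e : R, 0 < e -> \forall a \near F, nc (l - f a) <= e) -> f @ F --> l.
Proof.
move=> h; apply/cvgrPdist_le => e /gt0_real [r r0 ->].
by apply: filterS (h r r0) => x hx; rewrite norm_nc lecR.
Qed.

Lemma near_nc x (r : R) : 0 < r -> \forall y \near x, nc (y - x) <= r.
Proof.
move=> r0; have rC : 0 < r%:C :> R[i] by rewrite ltcR.
apply: filterS (nbhsx_ballx x _ rC) => y; rewrite /ball /= norm_nc ltcR ncBC => h.
exact: ltW.
Qed.

Lemma cvg_mx (T : Type) (F : set_system T) (FF : Filter F) m n (f : T -> 'M[R[i]]_(m, n)) (M : 'M[R[i]]_(m, n)) :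
  (forall i j, (fun a => f a i j) @ F --> M i j) -> f @ F --> M.
Proof.
move=> h A [P hP sPA]; rewrite /nbhs /=.
have : \forall a \near F, forall i j, P i j (f a i j).
  apply: filter_forall => i; apply: filter_forall => j; exact: h (hP i j).
by apply: filterS => x hx; apply: sPA.
Qed.

Lemma derivable_ev_disc m n (f : R[i] -> 'M[R[i]]_(m, n)) x :
  (forall i j, exists d : R[i], forall e : R, 0 < e -> exists2 r : R, 0 < r &
    forall y, nc (y - x) <= r -> nc (f y i j - f x i j - (y - x) * d) <= e * nc (y - x)) ->
  derivable f x 1.
Proof.
move=> h.
have /choice [D hD] : forall ij : 'I_m * 'I_n, exists d : R[i], forall e : R, 0 < e -> exists2 r : R, 0 < r &
    forall y, nc (y - x) <= r -> nc (f y ij.1 ij.2 - f x ij.1 ij.2 - (y - x) * d) <= e * nc (y - x).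
  by move=> ij; exact: h.
apply/cvg_ex; exists (\matrix_(i, j) D (i, j)).
apply: cvg_mx => i j; rewrite mxE; apply: cvg_nc => e e0.
have [r r0 hr] := hD (i, j) e e0.
rewrite /dnbhs near_withinE.
apply: filterS (near_nc 0 r0) => y hy y0; rewrite subr0 in hy.
rewrite !mxE; have := hr (y *: 1 + x).
rewrite /GRing.scale /= mulr1 addrK => /(_ hy) hq.
have y0' : y != 0 by [].
have -> : D (i, j) - y^-1 * (f (y + x) i j - f x i j) = - (y^-1 * (f (y + x) i j - f x i j - y * D (i, j))).
  by move: (f _ _ _) (f _ _ _) (D _) => a b c; field.
by rewrite ncN ncM ncV mulrC ler_pdivrMr // nc_gt0.
Qed.

Lemma continuous_entries (T : topologicalType) (A : set T) n (f : T -> 'rV[R[i]]_n) (g : 'I_n -> T -> R[i]) :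
  (forall j u, A u -> f u 0 j = g j u) ->
  (forall j u, A u -> forall e : R, 0 < e -> \forall v \near u, A v -> nc (g j u - g j v) <= e) ->
  {within A, continuous f}.
Proof.
move=> hfg hg; apply/subspace_continuousP => u Au.
apply: cvg_mx => i j; rewrite (ord1 i); apply: cvg_nc => e e0; rewrite near_withinE.
by apply: filterS (hg j u Au e e0) => v hv Av; rewrite !hfg //; exact: hv.
Qed.

Lemma derivable_entries n (f : R[i] -> 'rV[R[i]]_n) (g : 'I_n -> R[i] -> R[i]) x : nc x < 1 ->
  (forall j y, nc y <= 1 -> f y 0 j = g j y) ->
  (forall j, exists d : R[i], forall e : R, 0 < e -> exists2 r : R, 0 < r &
    forall y, nc (y - x) <= r -> nc (g j y - g j x - (y - x) * d) <= e * nc (y - x)) ->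
  derivable f x 1.
Proof.
move=> hx hfg hg; apply: derivable_ev_disc => i j; rewrite (ord1 i).
have [d hd] := hg j; exists d => e e0; have [r r0 hr] := hd e e0.
exists (Num.min r (1 - nc x)); first by rewrite lt_min r0 subr_gt0.
move=> y; rewrite le_min => /andP[h1 h2].
have ny : nc y <= 1 by rewrite -[y](subrK x); apply: (le_trans (ncD _ _)); lra.
by rewrite !hfg ?(ltW hx) //; exact: hr.
Qed.

End ComplexTopology.

Lemma closed_disc_nc (R : realType) (x : R[i]) : closed_disc x <-> nc x <= 1.
Proof. by rewrite /closed_disc /= norm_nc lecR. Qed.

Section DiscFamily.
Variable R : realType.
Variables (t e k l : R).
Hypotheses (t0 : 0 < t) (he : 0 < e <= 1) (l0 : 0 < l).
Hypothesis eF : (1 - t)%:C * ev (Fs e 0) (-1) = k%:C * ev (Fs e (1/3)) (-1).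
Hypothesis eG : (1 + t)%:C * ev (Gs e 0) (-1) = k%:C * ev (Gs e (1/3)) (-1).

Let F := Fs e 0.
Let G := Fs e (1/3).
Let lF : l1 F. Proof. exact: l1_F0. Qed.
Let lG : l1 G. Proof. exact: l1_F1. Qed.

Definition zdisc (x : R[i]) : R[i] := 'i * l%:C * ev F x.
Definition Wdisc (x : R[i]) : R[i] := 'i * l%:C ^+ 3 * (k%:C ^+ 3 * (x * ev G x ^+ 3)).
Definition Phi (s : R) (x : R[i]) : 'rV[R[i]]_2 := pt t (s%:C * zdisc x) (s%:C ^+ 3 * Wdisc x).

(** The second coordinate involves [W - z^3]; since [i^3 = - i], this is [i l^3] times a single
    power series with real coefficients, so both coordinates can be treated alike. *)
Let H (n : nat) : R := k ^+ 3 * delay (conv G (conv G G)) n + 1 * conv F (conv F F) n.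
Let lGG : l1 (conv G (conv G G)). Proof. by do !apply: l1_conv. Qed.
Let lFF : l1 (conv F (conv F F)). Proof. by do !apply: l1_conv. Qed.
Let lH : l1 H. Proof. by apply: l1_lin => //; exact: l1_delay. Qed.

Let evH x : nc x <= 1 -> ev H x = k%:C ^+ 3 * (x * ev G x ^+ 3) + ev F x ^+ 3.
Proof.
move=> hx; have lG2 : l1 (conv G G) by exact: l1_conv.
have lF2 : l1 (conv F F) by exact: l1_conv.
rewrite ev_lin //; last exact: l1_delay.
rewrite ev_delay // !ev_conv // (rmorph1 (real_complex R)) mul1r !exprS !expr0 !mulr1 !realCM.
by [].
Qed.

Let tC : t%:C != 0 :> R[i]. Proof. by rewrite realC_neq0 gt_eqF. Qed.

Let i3 : 'i ^+ 3 = - 'i :> R[i]. Proof. by rewrite exprS sqrCi mulrN1. Qed.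

Let expo (j : 'I_2) : nat := if j == 0 then 1%N else 3%N.
Let cst (j : 'I_2) : R[i] := if j == 0 then 'i * l%:C else 'i * l%:C ^+ 3 / (3 * t%:C).
Let coef (j : 'I_2) : nat -> R := if j == 0 then F else H.

Let lcoef j : l1 (coef j).
Proof. by rewrite /coef; case: ifP. Qed.

Let PhiE s x i j : nc x <= 1 -> Phi s x i j = s%:C ^+ expo j * (cst j * ev (coef j) x).
Proof.
move=> hx; rewrite (ord1 i); move: j; apply: ord2_cases.
  by rewrite /Phi pt0 /expo /cst /coef eqxx expr1.
rewrite /Phi pt1 /expo /cst /coef /= evH // /zdisc /Wdisc.
move: (ev F x) (ev G x) => f g; rewrite !exprMn i3; field.
by rewrite tC.
Qed.

Lemma Phi_continuous : {within `]0, 1[ `*` @closed_disc R, continuous (fun u : R * R[i] => Phi u.1 u.2)}.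
Proof.
have := (@continuous_entries R (R * R[i])%type (`]0, 1[ `*` @closed_disc R) 2 (fun u : R * R[i] => Phi u.1 u.2) (fun j u => u.1%:C ^+ expo j * (cst j * ev (coef j) u.2))).
move=> h; apply: h.
  by move=> j [s x] [_ /= hx]; apply: PhiE; exact/closed_disc_nc.
move=> j [s x] [/= hs /closed_disc_nc nx] d d0.
pose f x := cst j * ev (coef j) x.
have df : dalg f by apply: dalgM; [exact: dalg_cst|exact: dalg_ev].
have [B B0 hB] := dalg_bounded df.
have d2 : 0 < d / 2 by rewrite divr_gt0.
have [r r0 hr] := dalg_unif_cont df d2.
have B1 : 0 < 3 * B + 1 by rewrite ltr_wpDl // mulr_ge0.
pose r' := d / 2 / (3 * B + 1).
have r'0 : 0 < r' by rewrite divr_gt0.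
exists ([set a : R | `|a - s| <= r'], [set y : R[i] | nc (y - x) <= r]) => /=.
  split; last exact: near_nc.
  apply: filterS (nbhsx_ballx s _ r'0) => a; rewrite /ball /= distrC; exact: ltW.
move=> [a y] /= [ha hy] [/= has hay].
have ny : nc y <= 1 by exact/closed_disc_nc.
have s01 : 0 <= s <= 1 by move: hs; rewrite in_itv /= => /andP[/ltW -> /ltW ->].
have a01 : 0 <= a <= 1 by move: has; rewrite in_itv /= => /andP[/ltW -> /ltW ->].
have unitC (b : R) : 0 <= b <= 1 -> nc b%:C <= 1 by move=> /andP[b0 b1]; rewrite ncR ger0_norm.
change (nc (s%:C ^+ expo j * f x - a%:C ^+ expo j * f y) <= d).
have -> : s%:C ^+ expo j * f x - a%:C ^+ expo j * f y =
  - (a%:C ^+ expo j - s%:C ^+ expo j) * f x - a%:C ^+ expo j * (f y - f x).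
  by move: (f x) (f y) (a%:C ^+ _) (s%:C ^+ _) => p q v w; ring.
apply: (le_trans (ncB _ _)); rewrite [leRHS](splitr d); apply: lerD.
  rewrite ncM ncN.
  have h3 : nc (a%:C ^+ expo j - s%:C ^+ expo j) <= 3 * r'.
    have [n en n3] : exists2 n, expo j = n.+1 & (n < 3)%N.
      by rewrite /expo; case: ifP; [exists 0%N|exists 2%N].
    rewrite en; apply: (le_trans (pow_sub_le _ (unitC s s01) (unitC a a01))).
    by rewrite -realCB ncR; apply: ler_pM => //; rewrite ler_nat.
  apply: (le_trans (ler_pM (nc_ge0 _) (nc_ge0 _) h3 (hB x nx))).
  have -> : 3 * r' * B = r' * (3 * B) by ring.
  by apply: div1_le; [exact: ltW|rewrite mulr_ge0].
rewrite ncM ncX; apply: le_trans (hr x y nx ny hy).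
by rewrite ler_piMl ?nc_ge0 // exprn_ile1 ?nc_ge0 // unitC.
Qed.

Lemma Phi_analytic s : 0 < s < 1 -> analytic_disc (S_ t) (Phi s).
Proof.
move=> /andP[s0 s1]; split.
- apply: (@continuous_entries R _ _ _ _ (fun j x => s%:C ^+ expo j * (cst j * ev (coef j) x))).
    by move=> j x hx; apply: PhiE; exact/closed_disc_nc.
  move=> j x /closed_disc_nc nx d d0.
  have df : dalg (fun x => s%:C ^+ expo j * (cst j * ev (coef j) x)).
    by do 2!(apply: dalgM; first exact: dalg_cst); exact: dalg_ev.
  have [r r0 hr] := dalg_unif_cont df d0.
  apply: filterS (near_nc x r0) => y hy /closed_disc_nc ny.
  by rewrite ncBC; exact: hr.
- move=> x hx; have nx : nc x < 1 by move: hx; rewrite /open_disc /= norm_nc ltcR.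
  apply: (@derivable_entries R _ _ (fun j x => s%:C ^+ expo j * (cst j * ev (coef j) x)) _ nx).
    by move=> j y; exact: PhiE.
  move=> j; have [D hD] := ev_diff_open (lcoef j) nx.
  pose C := s%:C ^+ expo j * cst j; exists (C * D) => d d0.
  have C0 := nc_ge0 C.
  have dC : 0 < d / (nc C + 1) by rewrite divr_gt0 // ltr_wpDl.
  have [r r0 hr] := hD _ dC; exists r => // y h1.
  have -> : s%:C ^+ expo j * (cst j * ev (coef j) y) - s%:C ^+ expo j * (cst j * ev (coef j) x) -
    (y - x) * (C * D) = C * (ev (coef j) y - ev (coef j) x - (y - x) * D).
    by rewrite /C; move: (s%:C ^+ _) (cst j) (ev _ y) (ev _ x) => a b p q; ring.
  rewrite ncM; apply: (le_trans (ler_wpM2l C0 (hr y h1))).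
  by rewrite mulrA ler_wpM2r ?nc_ge0 // mulrC; apply: div1_le => //; exact: ltW.
- move=> _ [x hx <-]; have nx : nc x = 1.
    by move: hx; rewrite /unit_circle /= norm_nc => -[].
  apply/S_pt; first by rewrite gt_eqF.
  have rel := boundary_relation he eF eG nx; rewrite -/F -/G in rel.
  rewrite /Wdisc /zdisc !rmorphM /= !conjR in rel *.
  have -> : s%:C ^+ 3 * ('i * l%:C ^+ 3 * (k%:C ^+ 3 * (x * ev G x ^+ 3))) =
    (s%:C * l%:C) ^+ 3 * ('i * (k%:C ^+ 3 * (x * ev G x ^+ 3))).
    by move: (ev G x) => g; ring.
  rewrite rel -exprMn; congr (_ ^+ 3).
  by move: (ev F x) (ev F x)^* 'i^* => f fb ib; ring.
Qed.

Lemma zdisc0 : zdisc 0 = 'i * l%:C.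
Proof. by rewrite /zdisc ev0 // /F /Fs /= mulr1. Qed.

Lemma zdisc1 : zdisc 1 = 0.
Proof. by rewrite /zdisc F_one // mulr0. Qed.

Lemma Wdisc1 : Wdisc 1 = 0.
Proof. by rewrite /Wdisc G_one // expr0n /= !mulr0. Qed.

Lemma nc_zdisc0 : nc (zdisc 0) = l.
Proof. by rewrite zdisc0 ncM nc_i mul1r ncR gtr0_norm. Qed.

Lemma nc_Phi0 s x : 0 < s -> nc (Phi s x 0 0) = s * nc (zdisc x).
Proof. by move=> s0; rewrite /Phi pt0 ncM ncR gtr0_norm. Qed.

(** The first coordinates of the disc with parameter [s] are [s] times a fixed bounded set
    containing a nonzero point, so inclusion of images compares the parameters. *)
Lemma Phi_image_inj s s' : 0 < s < 1 -> 0 < s' < 1 ->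
  Phi s @` @closed_disc R = Phi s' @` @closed_disc R -> s = s'.
Proof.
have dz : dalg zdisc by apply: dalgM; [exact: dalg_cst|exact: dalg_ev].
have [B B0 hB] := dalg_bounded dz.
suff half (a b : R) : 0 < a -> 0 < b ->
    Phi b @` @closed_disc R `<=` Phi a @` @closed_disc R -> b <= a.
  move=> /andP[s0 _] /andP[s'0 _] h; apply/eqP; rewrite eq_le.
  by rewrite (half s' s) ?(half s s') // h.
move=> a0 b0 h.
apply: (scaling_le (Z := fun x => nc (zdisc x)) a0 b0 hB (x0 := 0)); first by rewrite nc0.
  by rewrite nc_zdisc0.
move=> x hx; have [|y hy e1] := h (Phi b x); first by exists x => //; exact/closed_disc_nc.
exists y; first exact/closed_disc_nc.
by rewrite -(nc_Phi0 x b0) -(nc_Phi0 y a0) e1.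
Qed.

Lemma Phi_family : disc_family (S_ t) Phi.
Proof.
split.
- exact: Phi_continuous.
- exact: Phi_analytic.
- move=> s /andP[s0 _]; exists 0, 1; split; try by apply/closed_disc_nc; rewrite ?nc0 ?nc1.
  have h0 := nc_Phi0 0 s0; have h1 := nc_Phi0 1 s0.
  rewrite nc_zdisc0 in h0; rewrite zdisc1 nc0 mulr0 in h1.
  apply/eqP => e1; move: h0; rewrite e1 h1 {e1 h1} => /esym h0.
  by have := mulr_gt0 s0 l0; rewrite h0 ltxx.
- exact: Phi_image_inj.
Qed.

Lemma Phi_origin s : (Phi s @` @closed_disc R) 0.
Proof.
exists 1; first by apply/closed_disc_nc; rewrite nc1.
rewrite /Phi zdisc1 Wdisc1 !mulr0; apply/rowP; apply: ord2_cases.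
  by rewrite pt0 mxE.
by rewrite pt1 mxE expr0n /= subr0 mul0r.
Qed.

Variable d : R.

Lemma Phi_in_hull s : 0 < s < 1 ->
  (forall x, nc x <= 1 -> closed_eball 0 d (Phi s x)) ->
  Phi s @` @closed_disc R `<=` poly_hull (S_ t `&` closed_eball 0 d).
Proof.
move=> hs hd _ [x /closed_disc_nc hx <-].
have dz : dalg (fun x => s%:C * zdisc x).
  by do 2!(apply: dalgM; first exact: dalg_cst); exact: dalg_ev.
have dW : dalg (fun x => s%:C ^+ 3 * Wdisc x).
  do 3!(apply: dalgM; first exact: dalg_cst).
  by apply: dalgM; [exact: dalg_id|apply: dalgX; exact: dalg_ev].
apply: (hull_disc_pt dz dW) hx => u hu; apply: S_sub_hull; split.
  have [_ _ h] := Phi_analytic hs; apply: h; exists u => //.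
  by rewrite /unit_circle /= norm_nc hu.
by apply: hd; rewrite hu.
Qed.

End DiscFamily.

(** * The three conclusions *)

Section Conclusion.
Variable R : realType.
Implicit Types t d : R.

(** The last conclusion is kept for [part_one]: the centre of a disc is a point of the hull off the
    surface, since there [W = 0] while [z] is nonzero and [t < 1] keeps [z] plus [t] times its
    conjugate nonzero. *)
Lemma part_three t : 0 < t -> Num.sqrt 3 / 2 <= t -> t < 1 -> forall d, 0 < d ->
  exists Phi : R -> R[i] -> 'rV[R[i]]_2,
    [/\ disc_family (S_ t) Phi,
        forall s : R, 0 < s < 1 -> (Phi s @` @closed_disc R) 0 /\
          Phi s @` @closed_disc R `<=` poly_hull (S_ t `&` closed_eball 0 d) &
        ~ S_ t (Phi (1/2) 0)].
Proof.
move=> t0 ts t1 d d0.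
(* The matching argument works from [4/5] on, and [sqrt 3 / 2] is larger because [16/25 < 3/4]. *)
have t45 : 4/5 <= t.
  apply: le_trans ts; have s3 : 0 <= Num.sqrt 3 :> R by exact: sqrtr_ge0.
  have := @sqr_sqrtr R 3 (ltac:(by [])); move: (Num.sqrt 3) s3 => q q0 q2; nra.
have [e [k [he eF eG]]] := matching t45 t1.
have lF := l1_F0 he; have lG := l1_F1 he.
have [e1 e10 hd] := enorm_pt_small t0 d0.
have [BF BF0 hF] := dalg_bounded (dalg_ev lF).
have [BG BG0 hG] := dalg_bounded (dalg_ev lG).
pose B := BF + `|k| ^+ 3 * BG ^+ 3 + 1.
have kB : 0 <= `|k| ^+ 3 * BG ^+ 3 by rewrite mulr_ge0 ?exprn_ge0.
have B0 : 0 < B by rewrite /B; lra.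
pose l := Num.min 1 (e1 / B).
have l0 : 0 < l by rewrite lt_min ltr01 divr_gt0.
have l1 : l <= 1 by rewrite /l ge_min lexx.
have lB : l * B <= e1 by rewrite -ler_pdivlMr // /l ge_min lexx orbT.
have l3 : l ^+ 3 <= l by rewrite exprS ler_piMr ?exprn_ile1 // ltW.
clearbody l.
exists (Phi t e k l); split.
- exact: Phi_family.
- move=> s hs; split; first exact: Phi_origin.
  apply: Phi_in_hull => // x hx; have /andP[s0 s1] := hs.
  have ns : nc s%:C <= 1 :> R by rewrite ncR gtr0_norm // ltW.
  have nl : nc l%:C = l :> R by rewrite ncR gtr0_norm.
  apply: hd.
    apply: le_trans lB; rewrite /zdisc [nc (s%:C * _)]ncM [nc (_ * ev _ x)]ncM ncM nc_i nl !mul1r.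
    rewrite -[leRHS]mul1r; apply: ler_pM; rewrite ?mulr_ge0 ?nc_ge0 ?(ltW l0) //.
    rewrite ler_wpM2l ?(ltW l0) //; apply: (le_trans (hF x hx)); rewrite /B; lra.
  apply: le_trans lB; rewrite /Wdisc.
  have -> : nc (s%:C ^+ 3 * ('i * l%:C ^+ 3 * (k%:C ^+ 3 * (x * ev (Fs e (1/3)) x ^+ 3)))) =
    nc s%:C ^+ 3 * (l ^+ 3 * (`|k| ^+ 3 * (nc x * nc (ev (Fs e (1/3)) x) ^+ 3))).
    move: (s%:C) => v; move: (ev _ x) => g.
    rewrite [LHS]ncM [nc ('i * _ * _)]ncM [nc ('i * _)]ncM nc_i mul1r.
    by rewrite [nc (k%:C ^+ 3 * _)]ncM [nc (x * _)]ncM !ncX nl ncR.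
  rewrite -[leRHS]mul1r; apply: ler_pM; rewrite ?mulr_ge0 ?exprn_ge0 ?nc_ge0 ?(ltW l0) //.
    by rewrite exprn_ile1 ?nc_ge0.
  apply: ler_pM => //; rewrite ?mulr_ge0 ?exprn_ge0 ?nc_ge0 ?(ltW l0) //.
  apply: (@le_trans _ _ (`|k| ^+ 3 * BG ^+ 3)); last by rewrite /B; lra.
  rewrite ler_wpM2l ?exprn_ge0 // -[leRHS]mul1r; apply: ler_pM; rewrite ?exprn_ge0 ?nc_ge0 //.
  by rewrite lerXn2r ?nnegrE ?nc_ge0 ?hG.
have tn : t != 0 by rewrite gt_eqF.
move=> /(S_pt _ _ tn); rewrite /Wdisc mul0r !mulr0 => /esym/eqP.
rewrite expf_eq0 /= zdisc0 //; set z := _ * _; rewrite addr_eq0 => /eqP hz.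
have z0 : 0 < nc z.
  rewrite /z [nc (_ * _)]ncM ncR gtr0_norm; last lra.
  by rewrite [nc ('i * _)]ncM nc_i mul1r ncR gtr0_norm // mulr_gt0 //; lra.
have : nc z = t * nc z by rewrite {1}hz ncN ncM ncR nc_conj gtr0_norm.
nra.
Qed.

Lemma part_one t : 0 < t -> t < 1 -> ~ locally_polynomially_convex (S_ t) 0.
Proof.
move=> t0 t1 [d d0 conv]; have tn : t != 0 by rewrite gt_eqF.
case: (ltP t (Num.sqrt 3 / 2)) => ts.
  have [b b0 hb] := part_two t0 ts d0.
  (* Over [z = 0] the surface contains only [w = 0], so any other point of the ball on that line is
     a witness. *)
  pose u : 'rV[R[i]]_2 := \row_(i < 2) (if i == 0 then 0 else (b / 2)%:C).
  have u0 : u 0 0 = 0 by rewrite mxE.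
  have u1 : u 0 1 = (b / 2)%:C by rewrite mxE.
  have : poly_hull (S_ t `&` closed_eball 0 d) u.
    apply: hb; rewrite /eball /= subr0; apply: (le_lt_trans (enorm_le _)).
    rewrite u0 u1 nc0 add0r ncR gtr0_norm ?divr_gt0 //; lra.
  rewrite conv => -[]; rewrite /S_ /= u0 u1 /p_ rmorph0 !expr0n /= !mulr0 !addr0 => h _.
  by have := congr1 (@nc R) h; rewrite nc0 ncR gtr0_norm ?divr_gt0 //; lra.
have [Phi [fam hPhi nS]] := part_three t0 ts t1 d0.
have [_ sub] := hPhi (1/2) (ltac:(lra)).
apply: nS; have : poly_hull (S_ t `&` closed_eball 0 d) (Phi (1/2) 0).
  by apply: sub; exists 0 => //; apply/closed_disc_nc; rewrite nc0.
by rewrite conv => -[].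
Qed.

End Conclusion.

Theorem theorem1p9 (R : realType) (t : R) (ht : 0 < t) :
  [/\ t < 1 -> ~ locally_polynomially_convex (S_ t) 0,
      t < Num.sqrt 3%:R / 2%:R ->
        forall delta : R, 0 < delta ->
        exists2 r : R, 0 < r &
          eball 0 r `<=` poly_hull (S_ t `&` closed_eball 0 delta)
    & Num.sqrt 3%:R / 2%:R <= t -> t < 1 ->
        forall delta : R, 0 < delta ->
        exists Phi : R -> R[i] -> 'rV[R[i]]_2,
          disc_family (S_ t) Phi /\
          (forall s : R, 0 < s < 1 ->
             (Phi s @` @closed_disc R) 0 /\
             Phi s @` @closed_disc R `<=`
               poly_hull (S_ t `&` closed_eball 0 delta))].
Proof.
split.
- exact: part_one.
- exact: part_two.
- move=> ts t1 d d0; have [Phi [h1 h2 _]] := part_three ht ts t1 d0.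
  by exists Phi.
Qed.
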